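(* Let $\mathcal{G}$ be a principal, minimal, almost finite groupoid. Then the AH conjecture is true for $\mathcal{G}$, i.e. there is an exact sequence $$H_0(\mathcal{G})\otimes\mathbb{Z}_2\xrightarrow{\ j\ }[[\mathcal{G}]]_{\mathrm{ab}}\xrightarrow{\ I\ }H_1(\mathcal{G})\longrightarrow0 ;$$ especially, if $H_0(\mathcal{G})$ is $2$-divisible, then $[[\mathcal{G}]]_{\mathrm{ab}}\cong H_1(\mathcal{G})$. Here $I$ is the index map and $j$ is the homomorphism described in the context.
   Context: An étale groupoid is a second countable locally compact Hausdorff groupoid whose range map is a local homeomorphism; $s,r$ are the source and range maps, $\mathcal{G}^{(0)}$ is the unit space. $\mathcal{G}$ is principal if $r(g)=s(g)$ implies $g\in\mathcal{G}^{(0)}$; essentially principal if the interior of $\{g: r(g)=s(g)\}$ is $\mathcal{G}^{(0)}$; minimal if every orbit $r(s^{-1}(x))$ is dense in $\mathcal{G}^{(0)}$. Almost finite: an étale groupoid is elementary if it is compact and principal. Let $\mathcal{G}$ be an étale groupoid whose unit space is a Cantor set (compact, metrizable, totally disconnected, no isolated points). It is almost finite if for every compact $C\subset\mathcal{G}$ and $\varepsilon>0$ there is an elementary (open) subgroupoid $\mathcal{K}\subset\mathcal{G}$ with $\mathcal{K}^{(0)}=\mathcal{G}^{(0)}$ such that $\#(C\mathcal{K}x\setminus\mathcal{K}x)/\#(\mathcal{K}x)<\varepsilon$ for all $x\in\mathcal{G}^{(0)}$, where $\mathcal{K}x=\{g\in\mathcal{K}: s(g)=x\}$. A $\mathcal{G}$-set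 is a subset $U\subset\mathcal{G}$ with $r|U,s|U$ injective; for $U$ open, $\theta(U)=(r|U)\circ(s|U)^{-1}:s(U)\to r(U)$. The topological full group $[[\mathcal{G}]]$ of an essentially principal $\mathcal{G}$ with Cantor unit space is the group of homeomorphisms $\alpha$ of $\mathcal{G}^{(0)}$ of the form $\alpha=\theta(U)$ with $U$ a compact open $\mathcal{G}$-set (such $U$ is unique). $\Gamma_{\mathrm{ab}}$ is the abelianization of a group $\Gamma$; $\mathbb{Z}_2$ is the cyclic group of order 2. Homology: $C_c(X,\mathbb{Z})$ denotes continuous compactly supported $\mathbb{Z}$-valued functions; a local homeomorphism $\pi:X\to Y$ induces $\pi_*(f)(y)=\sum_{\pi(x)=y}f(x)$. Let $\mathcal{G}^{(n)}$ be the space of composable $n$-strings ($s(g_i)=r(g_{i+1})$), with $d_0,\dots,d_n:\mathcal{G}^{(n)}\to\mathcal{G}^{(n-1)}$ given by dropping $g_1$ ($i=0$), multiplying $g_ig_{i+1}$ ($1\le i\le n-1$), dropping $g_n$ ($i=n$); for $n=1$, $d_0=s,d_1=r$. With $\partial_n=\sum_i(-1)^id_{i*}$, $H_n(\mathcal{G})$ is the $n$-th homology of $(C_c(\mathcal{G}^{(n)},\mathbb{Z}),\partial_n)$. Index map: $I:[[\mathcal{G}]]\to H_1(\mathcal{G})$, $I(\theta(U))=[1_U]$; it is a homomorphism and so factors through $[[\mathcal{G}]]_{\mathrm{ab}}$ (same symbol). The map $j$: for a compact open $\mathcal{G}$-set $U$ with $r(U)\cap s(U)=\emptyset$ let $\tau_U\in[[\mathcal{G}]]$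 be $\theta(U)$ on $s(U)$, $\theta(U)^{-1}$ on $r(U)$, and the identity elsewhere. For $f\in C(\mathcal{G}^{(0)},\mathbb{Z})$, let $A=\{x: f(x)\text{ odd}\}$, choose compact open $\mathcal{G}$-sets $U_1,\dots,U_n$ with $r(U_i)\cap s(U_i)=\emptyset$ such that the $s(U_i)$ form a clopen partition of $A$; then $j([f]\otimes\bar1)$ is the class of $\tau_{U_1}\cdots\tau_{U_n}$. (That this is a well-defined homomorphism is part of the assertion.) *)

(* Defs.v *)
From HB Require Import structures.
From mathcomp Require Import all_boot all_algebra.
From mathcomp Require Import finmap all_classical reals topology.
From mathcomp Require Import freeg.

Set Implicit Arguments.
Unset Strict Implicit.
Unset Printing Implicit Defensive.

Import GRing.Theory.

Local Open Scope classical_set_scope.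
Local Open Scope ring_scope.

Definition homeomorphism (X Y : topologicalType) (f : X -> Y) : Prop :=
  continuous f /\ exists g : Y -> X, [/\ continuous g, cancel f g & cancel g f].

(* The restriction of [p] to [U] is a homeomorphism onto the open set [p(U)]. *)
Definition local_homeomorphism (X Y : topologicalType) (p : X -> Y) : Prop :=
  continuous p /\
  forall x, exists U : set X,
    [/\ open U, U x, {in U &, injective p} &
        forall V : set X, open V -> V `<=` U -> open (p @` V)].

Definition metrizable (R : realType) (X : topologicalType) : Prop :=
  exists (M : metricType R) (f : X -> M), homeomorphism f.

Definition cantor_set (R : realType) (X : topologicalType) : Prop :=
  [/\ [set: X] !=set0, compact [set: X], metrizable R X,
      totally_disconnected [set: X] & perfect_set [set: X]].

(* [arrows G] is the groupoid itself and [units G] its unit space, a space of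
   its own which [gid] embeds in [arrows G] ([gid] is continuous with
   continuous left inverse [gsrc]).  [gmul] is total, but its values matter
   only on composable pairs, [gsrc g = grng h]. *)
Record etale_groupoid := EtaleGroupoid {
  arrows :> topologicalType;
  units : topologicalType;
  gsrc : arrows -> units;
  grng : arrows -> units;
  gid : units -> arrows;
  ginv : arrows -> arrows;
  gmul : arrows -> arrows -> arrows;
  gsrc_id : forall x, gsrc (gid x) = x;
  grng_id : forall x, grng (gid x) = x;
  gsrc_mul : forall g h, gsrc g = grng h -> gsrc (gmul g h) = gsrc h;
  grng_mul : forall g h, gsrc g = grng h -> grng (gmul g h) = grng g;
  gsrc_inv : forall g, gsrc (ginv g) = grng g;
  grng_inv : forall g, grng (ginv g) = gsrc g;
  gmulA : forall g h k, gsrc g = grng h -> gsrc h = grng k ->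
    gmul g (gmul h k) = gmul (gmul g h) k;
  gmul1l : forall g, gmul (gid (grng g)) g = g;
  gmul1r : forall g, gmul g (gid (gsrc g)) = g;
  gmulVl : forall g, gmul (ginv g) g = gid (gsrc g);
  gmulVr : forall g, gmul g (ginv g) = gid (grng g);
  gsrc_continuous : continuous gsrc;
  grng_continuous : continuous grng;
  gid_continuous : continuous gid;
  ginv_continuous : continuous ginv;
  gmul_continuous : {within [set p : arrows * arrows | gsrc p.1 = grng p.2],
                       continuous (fun p => gmul p.1 p.2)};
  arrows_hausdorff : hausdorff_space arrows;
  arrows_second_countable : @second_countable arrows;
  arrows_locally_compact : locally_compact [set: arrows];
  grng_local_homeo : local_homeomorphism grng
}.

Record cantor_groupoid (R : realType) := CantorGroupoid {
  groupoid_of :> etale_groupoid;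
  units_cantor : cantor_set R (units groupoid_of)
}.

Section Groupoid.
Variable G : etale_groupoid.
Implicit Types (g h : G) (x : units G) (C D K U V : set G).

Definition principal : Prop :=
  forall g, grng g = gsrc g -> range (@gid G) g.

Definition gorbit x : set (units G) := @grng G @` (@gsrc G @^-1` [set x]).

Definition minimal : Prop := forall x, dense (gorbit x).

Definition set_mul C D : set G :=
  [set k | exists g h, [/\ C g, D h, gsrc g = grng h & k = gmul g h]].

Definition subgroupoid K : Prop :=
  (forall g, K g -> K (ginv g)) /\ set_mul K K `<=` K.

(* The unit space of a subgroupoid [K] consists of the units lying in [K]. *)
Definition elementary K : Prop :=
  compact K /\ forall g, K g -> grng g = gsrc g -> range (@gid G) g.

Definition arrows_from K x : set G := K `&` @gsrc G @^-1` [set x].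

Definition Gset U : Prop :=
  {in U &, injective (@grng G)} /\ {in U &, injective (@gsrc G)}.

Definition compact_open_Gset U : Prop := [/\ compact U, open U & Gset U].

(* The graph of [theta(U) : s(U) -> r(U)] is [{(s(g), r(g)) | g in U}]; equality
   with the total map [a] includes [s(U)] being the whole unit space. *)
Definition is_theta U (a : units G -> units G) : Prop :=
  forall x y, a x = y <-> exists2 g, U g & gsrc g = x /\ grng g = y.

Definition in_full_group (a : units G -> units G) : bool :=
  `[< homeomorphism a /\ exists2 U, compact_open_Gset U & is_theta U a >].

End Groupoid.

(* [#|` fset_set A|] is 0 on infinite sets, but for [C] and [K] compact the two
   sets counted here are finite, the source fibres being discrete.  The
   condition [range gid `<=` K] says that [K] has the same units as [G]. *)
Definition almost_finite (R : realType) (G : cantor_groupoid R) : Prop :=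
  forall (C : set G) (eps : R), compact C -> 0 < eps ->
  exists K : set G,
    [/\ open K, subgroupoid K, elementary K, range (@gid G) `<=` K &
        forall x : units G,
          (#|` fset_set (set_mul C (arrows_from K x) `\` arrows_from K x)|)%:R
            / (#|` fset_set (arrows_from K x)|)%:R < eps].

Section GroupoidTheory.
Variable G : etale_groupoid.
Implicit Types (g h k : G) (x y : units G) (U V : set G).

Lemma ginvK : involutive (@ginv G).
Proof.
move=> g; rewrite -[LHS]gmul1r gsrc_inv grng_inv -gmulVl gmulA ?gsrc_inv //.
by rewrite gmulVl gsrc_inv gmul1l.
Qed.

Lemma gmulKl g h : gsrc g = grng h -> gmul (ginv g) (gmul g h) = h.
Proof. by move=> e; rewrite gmulA ?gsrc_inv // gmulVl e gmul1l. Qed.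

Lemma gmulVKl g h : grng g = grng h -> gmul g (gmul (ginv g) h) = h.
Proof.
by move=> e; rewrite gmulA ?grng_inv ?gsrc_inv // gmulVr e gmul1l.
Qed.

Lemma ginv_inj : injective (@ginv G).
Proof. exact: inv_inj ginvK. Qed.

Lemma units_hausdorff : hausdorff_space (units G).
Proof.
move=> x y cxy; rewrite -(gsrc_id x) -(gsrc_id y); congr gsrc.
apply: (@arrows_hausdorff G) => A B nA nB.
by have [z [Az Bz]] := cxy _ _ (gid_continuous nA) (gid_continuous nB);
  exists (gid z).
Qed.

Lemma local_homeo_open (X Y : topologicalType) (p : X -> Y) (V : set X) :
  local_homeomorphism p -> open V -> open (p @` V).
Proof.
move=> [_ lp] oV; rewrite openE => _ [x Vx <-].
have [U [oU Ux _ opU]] := lp x.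
have oW := opU (U `&` V) (openI oU oV) (@subIsetl _ _ _).
apply: filterS (open_nbhs_nbhs (conj oW _)); last by exists x.
by move=> _ [z [_ Vz] <-]; exists z.
Qed.

Lemma composable_closed : closed [set p : G * G | gsrc p.1 = grng p.2].
Proof.
move=> [g h] clgh /=; apply: units_hausdorff => A B nA nB.
have nAB : nbhs (g, h) ((@gsrc G @^-1` A) `*` (@grng G @^-1` B)).
  by exists (@gsrc G @^-1` A, @grng G @^-1` B) => //; split;
    [exact: gsrc_continuous | exact: grng_continuous].
have [[g' h'] /= [e [/= Ag' Bh']]] := clgh _ nAB.
by exists (gsrc g'); split=> //; rewrite e.
Qed.

Lemma set_mulE U V :
  set_mul U V = (fun p : G * G => gmul p.1 p.2) @`
    ((U `*` V) `&` [set p | gsrc p.1 = grng p.2]).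
Proof.
apply/seteqP; split=> [k [g [h [Ug Vh e ->]]]|_ [[g h] [[/= Ug Vh] e] <-]].
  by exists (g, h).
by exists g, h.
Qed.

Lemma set_mul_compact U V : compact U -> compact V -> compact (set_mul U V).
Proof.
move=> cU cV; rewrite set_mulE; apply: continuous_compact.
  by apply: continuous_subspaceW (@gmul_continuous G) => p [].
by apply: compact_closedI; [exact: compact_setX | exact: composable_closed].
Qed.

Lemma set_mul_open U V :
  {in U &, injective (@grng G)} -> open U -> open V -> open (set_mul U V).
Proof.
move=> injU oU oV; rewrite openE => _ [g0 [h0 [Ug Vh e ->]]].
set k0 := gmul g0 h0.
have rk0 : grng k0 = grng g0 by rewrite grng_mul.
have e0 : gsrc (ginv g0) = grng k0 by rewrite gsrc_inv.
have Vk0 : V (gmul (ginv g0) k0) by rewrite gmulKl.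
have := @gmul_continuous G (ginv g0, k0).
rewrite /continuous_at => /(_ _ (open_nbhs_nbhs (conj oV Vk0))).
rewrite nbhs_simpl /= => nV.
have {nV} : within [set p : G * G | gsrc p.1 = grng p.2]
    (nbhs (ginv g0, k0)) [set p | V (gmul p.1 p.2)].
  by move: nV; rewrite /nbhs /= -nbhs_subspace_in.
move=> [[A B] /= [nA nB] AB].
have oA : nbhs g0 (@ginv G @^-1` A) by exact: ginv_continuous.
move: oA; rewrite nbhsE => -[O [oO Og0] OA].
have oW : open (@grng G @` (U `&` O)).
  by apply: local_homeo_open (grng_local_homeo G) _; exact: openI.
have nW : nbhs k0 (@grng G @^-1` (@grng G @` (U `&` O))).
  apply: grng_continuous; apply: open_nbhs_nbhs; split=> //.
  by exists g0.
apply: filterS (filterI nW nB) => k [[g [Ug' Og] rg] Bk].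
have Ag := OA _ Og.
exists g, (gmul (ginv g) k); split=> //.
- by apply: (AB (ginv g, k)) => //=; rewrite gsrc_inv.
- by rewrite grng_mul ?grng_inv // gsrc_inv.
- by rewrite gmulVKl.
Qed.

Lemma gid_open : open (range (@gid G)).
Proof.
rewrite openE => _ [x _ <-].
have [_ /(_ (gid x)) [U [oU Ux injU _]]] := grng_local_homeo G.
have nU := open_nbhs_nbhs (conj oU Ux).
have n1 : nbhs (gid x) ((@gid G \o @grng G) @^-1` U).
  apply: continuous_comp; first exact: grng_continuous.
    exact: gid_continuous.
  by rewrite /= grng_id.
apply: filterS (filterI nU n1) => g [Ug Urg]; exists (grng g) => //.
by apply: injU; rewrite ?inE ?grng_id.
Qed.

Lemma theta_comp U V (a b : units G -> units G) :
  is_theta U a -> is_theta V b -> is_theta (set_mul U V) (a \o b).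
Proof.
move=> ta tb x y; split=> [<-|[_ [g [h [Ug Vh e ->]]] [<- <-]]].
  have [h Vh [sh rh]] := (tb x (b x)).1 erefl.
  have [g Ug [sg rg]] := (ta (b x) (a (b x))).1 erefl.
  have e : gsrc g = grng h by rewrite sg rh.
  by exists (gmul g h); [exists g, h | rewrite gsrc_mul ?grng_mul].
rewrite gsrc_mul // grng_mul //=; apply/ta; exists g => //; split=> //.
by rewrite e; apply/esym/tb; exists h.
Qed.

Lemma set_mul_Gset U V : Gset U -> Gset V -> Gset (set_mul U V).
Proof.
move=> [rU sU] [rV sV]; split=> k k'; rewrite !inE.
  move=> [g [h [Ug Vh e ->]]] [g' [h' [Ug' Vh' e' ->]]].
  rewrite !grng_mul // => r; have eg : g = g' by apply: rU; rewrite ?inE.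
  by congr gmul => //; apply: rV; rewrite ?inE // -e -e' eg.
move=> [g [h [Ug Vh e ->]]] [g' [h' [Ug' Vh' e' ->]]].
rewrite !gsrc_mul // => r; have eh : h = h' by apply: sV; rewrite ?inE.
by congr gmul => //; apply: sU; rewrite ?inE // e e' eh.
Qed.

Lemma compact_open_Gset_mul U V :
  compact_open_Gset U -> compact_open_Gset V -> compact_open_Gset (set_mul U V).
Proof.
move=> [cU oU GU] [cV oV GV]; split.
- exact: set_mul_compact.
- by apply: set_mul_open => //; case: GU.
- exact: set_mul_Gset.
Qed.

Lemma compact_open_Gset_inv U :
  compact_open_Gset U -> compact_open_Gset (@ginv G @^-1` U).
Proof.
move=> [cU oU [rU sU]]; split.
- have -> : @ginv G @^-1` U = @ginv G @` U.
    apply/seteqP; split=> [g Ug|_ [g Ug <-]]; last by rewrite /= ginvK.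
    by exists (ginv g) => //; rewrite ginvK.
  apply: continuous_compact => //; apply: continuous_subspaceT.
  exact: ginv_continuous.
- by apply: open_comp => // g _; exact: ginv_continuous.
- split=> g h; rewrite !inE => Ug Uh e; apply: ginv_inj.
    by apply: sU; rewrite ?inE // !gsrc_inv.
  by apply: rU; rewrite ?inE // !grng_inv.
Qed.

Lemma in_full_group_comp (a b : units G -> units G) :
  in_full_group a -> in_full_group b -> in_full_group (a \o b).
Proof.
move=> /asboolP[[ca [a' [ca' aK a'K]]] [U cU tU]].
move=> /asboolP[[cb [b' [cb' bK b'K]]] [V cV tV]].
apply/asboolP; split; last first.
  exists (set_mul U V); first exact: compact_open_Gset_mul.
  exact: theta_comp.
split; first by move=> x; apply: continuous_comp; [exact: cb | exact: ca].
exists (b' \o a'); split.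
- by move=> x; apply: continuous_comp; [exact: ca' | exact: cb'].
- exact: can_comp.
- exact: can_comp.
Qed.

Lemma in_full_group_id (cG : compact [set: units G]) :
  @in_full_group G id.
Proof.
apply/asboolP; split.
  have cid : continuous (@id (units G)) by move=> x; exact: cvg_id.
  by split=> //; exists id; split.
exists (range (@gid G)); last first.
  move=> x y; split=> [<-|]; last first.
    by case=> g [z _ <-]; rewrite gsrc_id grng_id => -[-> ->].
  by exists (gid x); [exists x | rewrite gsrc_id grng_id].
split; last first.
- by split=> g h; rewrite !inE => -[x _ <-] [y _ <-];
    rewrite ?gsrc_id ?grng_id => ->.
- exact: gid_open.
- apply: continuous_compact => //; apply: continuous_subspaceT.
  exact: gid_continuous.
Qed.

Lemma in_full_group_inv (a b : units G -> units G) :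
  in_full_group a -> cancel a b -> cancel b a -> in_full_group b.
Proof.
move=> /asboolP[[ca [a' [ca' aK a'K]]] [U cU tU]] ab ba.
have eb : b = a' by apply/funext => x; rewrite -{1}(a'K x) ab.
apply/asboolP; split; first by split; [rewrite eb | exists a].
exists (@ginv G @^-1` U); first exact: compact_open_Gset_inv.
move=> x y; split=> [<-|[g /= Ug [<- <-]]].
  have [g Ug [sg rg]] := (tU (b x) (a (b x))).1 erefl.
  exists (ginv g); first by rewrite /= ginvK.
  by rewrite gsrc_inv grng_inv rg ba.
rewrite -[RHS]ab; congr b; apply/esym/tU; exists (ginv g) => //.
by rewrite gsrc_inv grng_inv.
Qed.

End GroupoidTheory.

Section FullGroup.
Variables (R : realType) (G : cantor_groupoid R).

Record full_group : Type := FullGroup {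
  full_fun :> units G -> units G;
  full_funP : in_full_group full_fun
}.

HB.instance Definition _ := [isSub for full_fun].
HB.instance Definition _ := [Choice of full_group by <:].

Lemma full_group_ext (a b : full_group) : (forall x, a x = b x) -> a = b.
Proof. by move=> ab; apply/val_inj/funext. Qed.

Definition full_one : full_group.
Proof.
exists id; apply: in_full_group_id.
by have [_ ? _ _ _] := units_cantor G.
Defined.

Definition full_mul (a b : full_group) : full_group :=
  FullGroup (in_full_group_comp (full_funP a) (full_funP b)).

Lemma full_inv_subproof (a : full_group) :
  {b : full_group | cancel a b /\ cancel b a}.
Proof.
apply: cid; have /asboolP[[_ [b [_ ab ba]]] _] := full_funP a.
by exists (FullGroup (in_full_group_inv (full_funP a) ab ba)).
Qed.

Definition full_inv (a : full_group) : full_group := sval (full_inv_subproof a).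

Fact full_mulA : associative full_mul.
Proof. by move=> a b c; apply: full_group_ext. Qed.

Fact full_mul1 : left_id full_one full_mul.
Proof. by move=> a; apply: full_group_ext. Qed.

Fact full_mulr1 : right_id full_one full_mul.
Proof. by move=> a; apply: full_group_ext. Qed.

Fact full_mulV : left_inverse full_one full_inv full_mul.
Proof.
move=> a; apply: full_group_ext => x; rewrite /full_inv.
by have [ab _] := svalP (full_inv_subproof a); exact: ab.
Qed.

Fact full_mulrV : right_inverse full_one full_inv full_mul.
Proof.
move=> a; apply: full_group_ext => x; rewrite /full_inv.
by have [_ ba] := svalP (full_inv_subproof a); exact: ba.
Qed.

HB.instance Definition _ := isGroup.Build full_group
  full_mulA full_mul1 full_mulr1 full_mulV full_mulrV.

End FullGroup.

Section Abelianization.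
Variable H : groupType.
Implicit Types (x y z : H) (S : set H).
Local Open Scope group_scope.

Definition is_subgroup S : Prop :=
  [/\ S 1, (forall x y, S x -> S y -> S (x * y)) & forall x, S x -> S x^-1].

Definition derived_subgroup : set H :=
  [set z | forall S, is_subgroup S -> (forall x y, S [~ x, y]) -> S z].

Lemma derived_subgroupP : is_subgroup derived_subgroup.
Proof.
split=> [S [S1 _ _] _ //|x y Dx Dy S sS cS|x Dx S sS cS].
  by case: (sS) => _ + _; apply; [exact: Dx | exact: Dy].
by case: (sS) => _ _; apply; exact: Dx.
Qed.

Lemma derived_comm x y : derived_subgroup [~ x, y].
Proof. by move=> S _; exact. Qed.

Lemma derived_conj x y : derived_subgroup x -> derived_subgroup (x ^ y).
Proof.
have [_ DM _] := derived_subgroupP.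
move=> Dx; rewrite (_ : x ^ y = x * [~ x, y]); last by rewrite commgEl mulVKg.
by apply: DM => //; exact: derived_comm.
Qed.

Definition ab_equiv x y : bool := `[< derived_subgroup (x^-1 * y) >].

Lemma ab_equiv_is_equiv : equiv_class_of ab_equiv.
Proof.
have [D1 DM DV] := derived_subgroupP.
split=> [x|x y|y x z]; rewrite /ab_equiv.
- by apply/asboolP; rewrite mulVg.
- by apply/asboolP/asboolP => /DV; rewrite invgM invgK.
- move=> /asboolP Dxy /asboolP Dyz; apply/asboolP.
  by rewrite -(mulVKg y z) mulgA; exact: DM.
Qed.

Canonical ab_equiv_equiv := EquivRelPack ab_equiv_is_equiv.
Canonical ab_equiv_encModRel := defaultEncModRel ab_equiv.

Definition abelianization := {eq_quot ab_equiv}%qT.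

HB.instance Definition _ := EqQuotient.on abelianization.
HB.instance Definition _ := Choice.on abelianization.

Definition ab_class (x : H) : abelianization := (\pi_abelianization x)%qT.

Lemma ab_classP x y : ab_class x = ab_class y <-> derived_subgroup (x^-1 * y).
Proof.
split=> [/eqP|Dxy]; first by rewrite /ab_class piE => /asboolP.
by apply/eqP; rewrite /ab_class piE; apply/asboolP.
Qed.

Definition ab_repr (u : abelianization) : H := repr u.

Lemma ab_reprK u : ab_class (ab_repr u) = u.
Proof. exact: reprK. Qed.

Lemma ab_classM x x' y y' : ab_class x = ab_class x' ->
  ab_class y = ab_class y' -> ab_class (x * y) = ab_class (x' * y').
Proof.
have [D1 DM DV] := derived_subgroupP.
move=> /ab_classP Dx /ab_classP Dy; apply/ab_classP.
rewrite invgM (_ : _ * _ = (x^-1 * x') ^ y * (y^-1 * y')).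
  by apply: DM => //; exact: derived_conj.
by rewrite /conjg -!mulgA mulVKg.
Qed.

Lemma ab_classV x x' : ab_class x = ab_class x' ->
  ab_class x^-1 = ab_class x'^-1.
Proof.
have [D1 DM DV] := derived_subgroupP.
move=> /ab_classP Dx; apply/ab_classP; rewrite invgK.
have /DV := derived_conj x^-1 Dx.
by rewrite /conjg invgK -(mulgA x^-1) mulVKg invgM invgK.
Qed.

Definition ab_zero : abelianization := ab_class 1.
Definition ab_add (u v : abelianization) : abelianization :=
  ab_class (ab_repr u * ab_repr v).
Definition ab_opp (u : abelianization) : abelianization :=
  ab_class (ab_repr u)^-1.

Lemma ab_addE x y : ab_add (ab_class x) (ab_class y) = ab_class (x * y).
Proof. by apply: ab_classM; rewrite ab_reprK. Qed.

Lemma ab_oppE x : ab_opp (ab_class x) = ab_class x^-1.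
Proof. by apply: ab_classV; rewrite ab_reprK. Qed.

Fact ab_addA : associative ab_add.
Proof.
move=> u v w; rewrite -(ab_reprK u) -(ab_reprK v) -(ab_reprK w).
by rewrite !ab_addE mulgA.
Qed.

Fact ab_addC : commutative ab_add.
Proof.
move=> u v; rewrite -(ab_reprK u) -(ab_reprK v) !ab_addE; apply/ab_classP.
by rewrite invgM -mulgA; exact: derived_comm.
Qed.

Fact ab_add0 : left_id ab_zero ab_add.
Proof. by move=> u; rewrite -(ab_reprK u) ab_addE mul1g. Qed.

Fact ab_addN : left_inverse ab_zero ab_opp ab_add.
Proof. by move=> u; rewrite -(ab_reprK u) ab_oppE ab_addE mulVg. Qed.

HB.instance Definition _ := GRing.isZmodule.Build abelianization
  ab_addA ab_addC ab_add0 ab_addN.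

End Abelianization.

Section Tensor.
Variables A B : zmodType.

Local Notation free := {freeg (A * B) / int}.

Definition tensor_relations : set free :=
  [set w | exists a a' b, w = << (a + a', b) >> - << (a, b) >> - << (a', b) >>]
  `|`
  [set w | exists a b b', w = << (a, b + b') >> - << (a, b) >> - << (a, b') >>].

Definition tensor_null : pred free := fun w =>
  `[< forall S : set free, S 0 -> (forall u v, S u -> S v -> S (u - v)) ->
        tensor_relations `<=` S -> S w >].

Fact tensor_null_zmod_closed : zmod_closed tensor_null.
Proof.
split=> [|u v /asboolP Nu /asboolP Nv]; apply/asboolP=> S S0 SB RS //.
by apply: (SB); [exact: (Nu S) | exact: (Nv S)].
Qed.

HB.instance Definition _ :=
  GRing.isZmodClosed.Build free tensor_null tensor_null_zmod_closed.

Definition tensor := Quotient.quot (GRing.ZmodClosed.clone free tensor_null _).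

HB.instance Definition _ := GRing.Zmodule.on tensor.

Definition tensor_pure (a : A) (b : B) : tensor :=
  (\pi_tensor (<< (a, b) >> : free))%qT.

End Tensor.

Section CompactSupport.
Variable X : topologicalType.

Definition is_Cc (f : X -> int) : bool :=
  `[< continuous (f : X -> discrete_topology int) /\
      compact (closure [set x | f x != 0]) >].

Record Cc : Type := MkCc { Cc_fun :> X -> int; Cc_funP : Cc_fun \in is_Cc }.

HB.instance Definition _ := [isSub for Cc_fun].
HB.instance Definition _ := [Choice of Cc by <:].

Fact is_Cc_zmod_closed : zmod_closed is_Cc.
Proof.
have locP (f : X -> int) : continuous (f : X -> discrete_topology int) ->
    forall x, \forall y \near x, f y = f x.
  move=> cf x; have := cf x [set f x]; apply.
  exact: (@discrete_set1 (discrete_topology int)).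
split=> [|f g /asboolP[cf kf] /asboolP[cg kg]]; apply/asboolP; split.
- by move=> x; exact: cvg_cst.
- rewrite (_ : [set x | _] = set0) ?closure0; first exact: compact0.
  by apply/seteqP; split=> x //=; rewrite eqxx.
- move=> x; apply/(@discrete_cvg (discrete_topology int)).
  change (\forall y \near x, (f - g) y = (f - g) x).
  near=> y; have fy : f y = f x by near: y; exact: locP.
  have gy : g y = g x by near: y; exact: locP.
  by rewrite /= (_ : (f - g) y = f y - g y) // fy gy.
- apply: subclosed_compact (compactU kf kg) _; first exact: closed_closure.
  rewrite -closureU; apply: closureS => x /=.
  have -> : (f - g) x = f x - g x by [].
  by apply: contra_neqP => /not_orP[/negP/negPn/eqP-> /negP/negPn/eqP->];
    rewrite subrr.
Unshelve. all: by end_near. Qed.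

HB.instance Definition _ :=
  GRing.isZmodClosed.Build (X -> int) is_Cc is_Cc_zmod_closed.
HB.instance Definition _ := [SubChoice_isSubZmodule of Cc by <:].

End CompactSupport.

(* Used only when [f] has finite support on the fibres of [p]. *)
Definition pushforward (X Y : topologicalType) (p : X -> Y) (f : X -> int) :
    Y -> int :=
  fun y => \sum_(x \in p @^-1` [set y]) f x.

Definition locally_injective (X Y : topologicalType) (p : X -> Y) : Prop :=
  forall x, exists U : set X, [/\ open U, U x & {in U &, injective p}].

Lemma Cc_fibre_finite (X Y : topologicalType) (p : X -> Y) (f : Cc X) y :
  locally_injective p -> finite_set (p @^-1` [set y] `&` [set x | f x != 0]).
Proof.
move=> injp; set A := _ `&` _.
have [->|/set0P[x0 _]] := eqVneq A set0; first exact: finite_set0.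
have /asboolP[_ kf] := Cc_funP f.
pose T : ptopologicalType :=
  HB.pack (Topological.sort X) X (isPointed.Build X x0).
have : @compact T _ := kf; rewrite compact_cover => cov.
pose U x := sval (cid (injp x)).
have UP x : [/\ open (U x), U x x & {in U x &, injective p}].
  by rewrite /U; case: cid.
have [x _||D _ KD] := cov T setT U.
- by case: (UP x).
- by move=> x _; exists x => //; case: (UP x).
have AD : A `<=` \bigcup_(x in [set` D]) (A `&` U x).
  move=> x Ax; have /KD[z Dz Uzx] : closure [set x | f x != 0] x.
    by apply: subset_closure; case: Ax.
  by exists z.
apply: (sub_finite_set AD); apply: bigcup_finite; first exact: finite_fset.
move=> x _; set B := A `&` U x.
have [->|/set0P[z [Az Uz]]] := eqVneq B set0; first exact: finite_set0.
suff Bz : B `<=` [set z] by exact: sub_finite_set Bz (finite_set1 z).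
move=> w [Aw Uw]; have [_ _ inj] := UP x; apply: inj; rewrite ?inE //.
by case: Aw Az => /= -> _ [-> _].
Qed.

Lemma pushforwardB (X Y : topologicalType) (p : X -> Y) (f g : Cc X) :
  locally_injective p ->
  pushforward p (f - g)%R = pushforward p f - pushforward p g.
Proof.
move=> injp; apply/funext => y.
pose P h := p @^-1` [set y] `&` [set x | (h : X -> int) x != 0].
pose D := P f `|` P g.
have finD : finite_set D by rewrite finite_setU; split; exact: Cc_fibre_finite.
have DE (h : X -> int) : (forall x, ~ D x -> p x = y -> h x = 0) ->
    pushforward p h y = \sum_(x \in D) h x.
  move=> hD; apply/esym/fsbig_widen; first by move=> x [] [].
  by move=> x [/= pxy] /hD; exact.
have f0 x : ~ D x -> p x = y -> f x = 0.
  by move=> nD pxy; apply: contra_notP nD => /eqP fx; left.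
have g0 x : ~ D x -> p x = y -> g x = 0.
  by move=> nD pxy; apply: contra_notP nD => /eqP gx; right.
have -> : (pushforward p f - pushforward p g) y =
  pushforward p f y - pushforward p g y by [].
rewrite !DE //; last by move=> x nD pxy;
  rewrite /= [LHS](_ : _ = f x - g x) // f0 // g0 // subrr.
by rewrite !fsbig_finite //= -sumrB; apply: eq_bigr.
Qed.

Section Homology.
Variable G : etale_groupoid.

Definition composable : set (G * G) := [set p | gsrc p.1 = grng p.2].

Definition G2 : topologicalType := set_type composable.

Definition face0 (p : G2) : G := (val p).2.
Definition face1 (p : G2) : G := gmul (val p).1 (val p).2.
Definition face2 (p : G2) : G := (val p).1.

(* The face maps are local homeomorphisms, so these functions are again
   continuous with compact support. *)
Definition boundary1 (f : Cc G) : units G -> int :=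
  pushforward (@gsrc G) f - pushforward (@grng G) f.

Definition boundary2 (f : Cc G2) : G -> int :=
  pushforward face0 f - pushforward face1 f + pushforward face2 f.

Lemma G2_comp (p : G2) : gsrc (val p).1 = grng (val p).2.
Proof. exact: set_mem (valP p). Qed.

Lemma grng_locally_injective : locally_injective (@grng G).
Proof.
by move=> g; have [_ /(_ g)[U [oU Ug iU _]]] := grng_local_homeo G; exists U.
Qed.

Lemma gsrc_locally_injective : locally_injective (@gsrc G).
Proof.
move=> g; have [U [oU Ug iU]] := grng_locally_injective (ginv g).
exists (@ginv G @^-1` U); split=> //.
  by apply: open_comp => // h _; exact: ginv_continuous.
move=> h k; rewrite !inE => Uh Uk e; apply: (@ginv_inj G).
by apply: iU; rewrite ?inE // !grng_inv.
Qed.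

Lemma G2_open_preimage (q : G * G -> G) (U : set G) :
  continuous q -> open U -> open [set p : G2 | U (q (val p))].
Proof.
move=> cq oU; apply: (@open_comp _ _ (q \o (@set_val _ composable))) => // p _.
apply: continuous_comp; last exact: cq.
exact: initial_continuous.
Qed.

Lemma face0_locally_injective : locally_injective face0.
Proof.
move=> p; have [U [oU Up iU]] := gsrc_locally_injective (val p).1.
exists [set p : G2 | U (val p).1]; split=> //.
  by apply: (@G2_open_preimage fst) => // x; exact: cvg_fst.
move=> a b; rewrite !inE /= /face0 => Ua Ub e; apply: val_inj.
apply: injective_projections => //; apply: iU; rewrite ?inE //.
by rewrite !G2_comp e.
Qed.

Lemma face2_locally_injective : locally_injective face2.
Proof.
move=> p; have [U [oU Up iU]] := grng_locally_injective (val p).2.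
exists [set p : G2 | U (val p).2]; split=> //.
  by apply: (@G2_open_preimage snd) => // x; exact: cvg_snd.
move=> a b; rewrite !inE /= /face2 => Ua Ub e; apply: val_inj.
apply: injective_projections => //; apply: iU; rewrite ?inE //.
by rewrite -!G2_comp e.
Qed.

Lemma face1_locally_injective : locally_injective face1.
Proof.
move=> p; have [U [oU Up iU]] := grng_locally_injective (val p).1.
exists [set p : G2 | U (val p).1]; split=> //.
  by apply: (@G2_open_preimage fst) => // x; exact: cvg_fst.
move=> a b; rewrite !inE /= /face1 => Ua Ub e; apply: val_inj.
have e1 : (val a).1 = (val b).1.
  by apply: iU; rewrite ?inE // -(grng_mul (G2_comp a)) e grng_mul ?G2_comp.
apply: injective_projections => //.
by rewrite -(gmulKl (G2_comp a)) e e1 gmulKl // G2_comp.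
Qed.

Lemma boundary1B (f g : Cc G) : boundary1 (f - g) = boundary1 f - boundary1 g.
Proof.
have [isrc irng] := (gsrc_locally_injective, grng_locally_injective).
rewrite /boundary1 !pushforwardB //.
by rewrite !opprD !opprK addrACA.
Qed.

Lemma boundary2B (f g : Cc G2) : boundary2 (f - g) = boundary2 f - boundary2 g.
Proof.
have [i0 [i1 i2]] :=
  (face0_locally_injective, (face1_locally_injective, face2_locally_injective)).
rewrite /boundary2 !pushforwardB //.
by rewrite !opprD !opprK [RHS]addrACA; congr (_ + _); rewrite addrACA.
Qed.

Definition is_boundary0 : pred (Cc (units G)) := fun f =>
  `[< exists h : Cc G, f = boundary1 h :> (units G -> int) >].

Fact is_boundary0_zmod_closed : zmod_closed is_boundary0.
Proof.
split=> [|f g /asboolP[h e] /asboolP[k e']]; apply/asboolP.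
  by exists 0; rewrite -(subrr (0 : Cc G)) boundary1B subrr.
by exists (h - k); rewrite boundary1B -e -e'.
Qed.

HB.instance Definition _ := GRing.isZmodClosed.Build (Cc (units G))
  is_boundary0 is_boundary0_zmod_closed.

Definition homology0 :=
  Quotient.quot (GRing.ZmodClosed.clone (Cc (units G)) is_boundary0 _).

HB.instance Definition _ := GRing.Zmodule.on homology0.

Definition homology0_class (f : Cc (units G)) : homology0 :=
  (\pi_homology0 f)%qT.

Definition is_cycle1 : pred (Cc G) := fun f => `[< boundary1 f = 0 >].

Fact is_cycle1_zmod_closed : zmod_closed is_cycle1.
Proof.
split=> [|f g /asboolP e /asboolP e']; apply/asboolP.
  by rewrite -(subrr (0 : Cc G)) boundary1B subrr.
by rewrite boundary1B e e' subrr.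
Qed.

HB.instance Definition _ :=
  GRing.isZmodClosed.Build (Cc G) is_cycle1 is_cycle1_zmod_closed.

Record cycles1 : Type := MkCycles1 {
  cycles1_fun :> Cc G;
  cycles1_funP : cycles1_fun \in is_cycle1
}.

HB.instance Definition _ := [isSub for cycles1_fun].
HB.instance Definition _ := [Choice of cycles1 by <:].
HB.instance Definition _ := [SubChoice_isSubZmodule of cycles1 by <:].

Definition is_boundary1 : pred cycles1 := fun z =>
  `[< exists h : Cc G2, z = boundary2 h :> (G -> int) >].

Fact is_boundary1_zmod_closed : zmod_closed is_boundary1.
Proof.
split=> [|f g /asboolP[h e] /asboolP[k e']]; apply/asboolP.
  by exists 0; rewrite -(subrr (0 : Cc G2)) boundary2B subrr.
by exists (h - k); rewrite boundary2B -e -e'.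
Qed.

HB.instance Definition _ :=
  GRing.isZmodClosed.Build cycles1 is_boundary1 is_boundary1_zmod_closed.

Definition homology1 :=
  Quotient.quot (GRing.ZmodClosed.clone cycles1 is_boundary1 _).

HB.instance Definition _ := GRing.Zmodule.on homology1.

Definition homology1_class (z : cycles1) : homology1 :=
  (\pi_homology1 z)%qT.

End Homology.

Section AH.
Variables (R : realType) (G : cantor_groupoid R).

Local Notation Gamma_ab := (abelianization (full_group G)).

(* [z] is the indicator 1_U, a cycle because s(U) = r(U) is the unit space; for
   a principal groupoid [U] is determined by [a]. *)
Definition is_index_map (I : Gamma_ab -> homology1 G) : Prop :=
  forall (a : full_group G) (U : set G), compact_open_Gset U -> is_theta U a ->
  exists z : cycles1 G,
    (forall g, z g = (`[< U g >] : nat)%:R) /\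
    I (ab_class a) = homology1_class z.

Definition is_tau (U : set G) (a : full_group G) : Prop :=
  (forall g, U g -> a (gsrc g) = grng g /\ a (grng g) = gsrc g) /\
  (forall x, ~ (@gsrc G @` U) x -> ~ (@grng G @` U) x -> a x = x).

Record j_choice (f : Cc (units G)) (n : nat) (U : 'I_n -> set G)
    (t : 'I_n -> full_group G) : Prop := JChoice {
  j_Gset : forall i, compact_open_Gset (U i);
  j_disjoint : forall i, @grng G @` U i `&` @gsrc G @` U i = set0;
  j_clopen : forall i, clopen (@gsrc G @` U i);
  j_trivIset : trivIset setT (fun i => @gsrc G @` U i);
  j_cover : \bigcup_i (@gsrc G @` U i) = [set x | ~~ (2 %| f x)%Z];
  j_tau : forall i, is_tau (U i) (t i)
}.

Definition is_j_map (j : tensor (homology0 G) 'Z_2 -> Gamma_ab) : Prop :=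
  forall f : Cc (units G),
    (exists n (U : 'I_n -> set G) (t : 'I_n -> full_group G), j_choice f U t) /\
    (forall n (U : 'I_n -> set G) (t : 'I_n -> full_group G), j_choice f U t ->
       j (tensor_pure (homology0_class f) 1) = ab_class (\prod_(i < n) t i)%g).

End AH.

Definition exact_at (A B C : zmodType) (f : A -> B) (g : B -> C) : Prop :=
  forall b, g b = 0 <-> exists a, f a = b.

Definition surjective (A B : Type) (f : A -> B) : Prop :=
  forall b, exists a, f a = b.

Definition two_divisible (A : zmodType) : Prop :=
  forall a : A, exists b, a = b *+ 2.

Definition zmod_isomorphic (A B : zmodType) : Prop :=
  exists f : {additive A -> B}, bijective f.

(* Main.v *)
Require Import Defs.
From HB Require Import structures.
From mathcomp Require Import all_boot all_algebra.
From mathcomp Require Import finmap all_classical reals topology.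
From mathcomp Require Import freeg zify.

(* A full group element is determined by its graph, so everything is done with
   compact open bisections.

   The class of [tau_U] in the abelianization depends only on [s(U)]: orbits are
   infinite (minimality), so locally any two choices of [U] can be compared with
   a third one whose range avoids both, and [tau_U], [tau_W] are conjugate when
   [s(U) = s(W)] and the ranges are disjoint.  This makes [j] well defined.

   For the kernel of the index map, write the indicator of the graph of [a] as a
   boundary.  Off the units, the boundary of the indicator of a small set of
   composable pairs is a signed sum of indicators of graphs of transpositions
   and of 3-cycles (products of two transpositions), so it suffices to show: if
   sum 1_{a_i} = sum 1_{b_j} off the units, then prod a_i = prod b_j modulo
   transpositions and commutators.  Take an elementary [K] such that few points
   of each [K]-orbit leave it under the [a_i] and [b_j].  Modulo the full group of
   [K], which consists of products of transpositions, the [a_i] can be given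
   disjoint supports, so their product [c] sends as many points from one
   [K]-orbit to another as the [a_i] do together; likewise for the product [d] of
   the [b_j].  Having equal counts, [c] and [d] are matched by an element of the
   full group of [K].

   For surjectivity, a cycle is a sum of indicators of bisections; the parts
   outside [K] are translated inside [K] to have disjoint sources and ranges, so
   that they form one bisection, which extends by arrows of [K] to the graph of a
   full group element.  What remains is a cycle supported in [K], a boundary. *)

Set Implicit Arguments.
Unset Strict Implicit.
Unset Printing Implicit Defensive.

Import GRing.Theory Num.Theory.

Local Open Scope classical_set_scope.
Local Open Scope ring_scope.

(** * Compact open sets *)

(** Inside [K] everything is reduced to counting. Any two points of a [K]-orbit are joined by an
    arrow of [K], so a bisection of [K] carrying one clopen set into another exists as soon as every
    orbit has enough points of the second; the finite combinatorics becomes continuous by a greedy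
    matching along a finite cover by bisections. Almost finiteness enters only as room in the
    orbits: with tolerance 1/(n+1), the points leaving their orbit along n given bisections number,
    all added up, at most the size of the orbit. By principality an arrow is known from its source
    and range, so identities between products of bisections are checked on end points. Units are
    ignored when boundaries are compared with sums of graphs: the graph of a transposition contains
    the units it fixes, so the values there depend on the number of terms, whereas the orbit counts
    only involve arrows between distinct points. *)

Lemma clopen_setC (Y : topologicalType) (A : set Y) : clopen A -> clopen (~` A).
Proof. exact: clopenC. Qed.

Section CompactOpen.
Variable Y : topologicalType.
Implicit Types A B D N : set Y.

Lemma compact_finite_cover D (N : Y -> set Y) : compact D ->
  (forall x, D x -> open (N x) /\ N x x) ->
  exists s : seq Y, (forall x, x \in s -> D x) /\
    forall x, D x -> exists2 y, y \in s & N y x.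
Proof.
move=> cD HN; have [->|/set0P[x0 Dx0]] := eqVneq D set0.
  by exists [::]; split=> // x [].
(* [compact_cover] is about pointed spaces; a point of [D] serves as base point. *)
pose T : ptopologicalType :=
  HB.pack (Topological.sort Y) Y (isPointed.Build Y x0).
have : @compact T D by [].
rewrite compact_cover => /(_ _ D N)[x Dx|x Dx|S SD cS].
- by case: (HN _ Dx).
- by exists x => //; case: (HN _ Dx).
- exists S; split=> [x xS|x Dx]; first by have := SD x xS; rewrite inE.
  by have [y yS Ny] := cS _ Dx; exists y.
Qed.

Hypothesis hausY : hausdorff_space Y.

Definition copen A := compact A /\ open A.

Lemma copenT_closed A : copen A -> closed A.
Proof. by case=> cA _; exact: compact_closed. Qed.

Lemma copenU A B : copen A -> copen B ->
  copen (A `|` B).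
Proof.
by move=> [cA oA] [cB oB]; split; [exact: compactU|exact: openU].
Qed.

Lemma copenI A B : copen A -> clopen B ->
  copen (A `&` B).
Proof.
move=> [cA oA] [oB cB]; split; last exact: openI.
exact: compact_closedI.
Qed.

Lemma copen_clopen A : copen A -> clopen A.
Proof. by move=> A1; split; [case: A1|exact: copenT_closed]. Qed.

Lemma copenD A B : copen A -> clopen B ->
  copen (A `\` B).
Proof. by move=> A1 B1; rewrite setDE; apply/copenI/clopenC. Qed.

Lemma copen0 : copen set0.
Proof. by split; [exact: compact0|exact: open0]. Qed.

Lemma copen_ind (P : set Y -> Prop) D :
  P set0 ->
  (forall A B, copen A -> copen B -> A `&` B = set0 ->
     A `<=` D -> B `<=` D -> P A -> P B -> P (A `|` B)) ->
  copen D ->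
  (forall x, D x -> exists N, [/\ copen N, N x &
     forall B, copen B -> B `<=` N -> B `<=` D -> P B]) -> P D.
Proof.
move=> P0 PU coD loc.
have /choice[f fP] : forall x, exists N, D x -> [/\ copen N, N x &
    forall B, copen B -> B `<=` N -> B `<=` D -> P B].
  move=> x; have [/loc[N HN]|nDx] := pselect (D x); first by exists N.
  by exists set0 => /nDx.
have [|s [sD sc]] := @compact_finite_cover D f coD.1.
  by move=> x /fP[[_ ?] ? _].
suff [E [coE ED sE PE]] : exists E, [/\ copen E, E `<=` D,
    forall x, D x -> (exists2 y, y \in s & f y x) -> E x & P E].
  suff <- : E = D by [].
  by apply/seteqP; split=> // x Dx; apply: sE => //; exact: sc.
elim: s sD {sc} => [|y s IH] sD.
  by exists set0; split=> // [|x Dx []//]; exact: copen0.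
have [|E [coE ED sE PE]] := IH.
  by move=> x xs; apply: sD; rewrite inE xs orbT.
have [cofy fyy Pfy] := fP y (sD y (mem_head _ _)).
pose B := (D `&` f y) `\` E.
have coB : copen B.
  apply: copenD; last exact: copen_clopen.
  by apply: copenI => //; exact: copen_clopen.
have BD : B `<=` D by move=> x [[]].
exists (E `|` B); split.
- exact: copenU.
- by move=> x [/ED|/BD].
- move=> x Dx [z]; rewrite inE => /orP[/eqP-> fyx|zs fzx].
    by have [Ex|nEx] := pselect (E x); [left|right].
  by left; apply: sE => //; exists z.
- apply: PU => //; last by apply: Pfy => // x [[]].
  by apply/seteqP; split=> // x [Ex [_ []]].
Qed.

(** In a compact Hausdorff space the intersection [Q] of the clopen sets around [x] is connected. If
    no clopen set separated [x] from [y], then [Q] would contain [y], against total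
    disconnectedness. *)
Lemma quasi_component x y : compact [set: Y] ->
  totally_disconnected [set: Y] -> x != y ->
  exists U : set Y, [/\ clopen U, U x & ~ U y].
Proof.
move=> cT tdT xy; apply: contrapT => noU.
pose Q := [set z | forall C, clopen C -> C x -> C z].
have Qx : Q x by [].
have Qy : Q y by move=> C cC Cx; apply: contrapT => nCy; apply: noU; exists C.
have clQ : closed Q.
  have -> : Q = \bigcap_(C in [set C | clopen C /\ C x]) C.
    by apply/seteqP; split=> z Qz C; [case=> c1 c2|move=> c1 c2]; apply: Qz.
  by apply: closed_bigI => C [[]].
have key E F : closed E -> closed F -> E `&` F = set0 -> Q = E `|` F ->
    E x -> F = set0.
  move=> cE cF EF0 QEF Ex.
  have FE : set_nbhs E (~` F).
    apply/set_nbhsP; exists (~` F); split=> //; first exact: closed_openC.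
    by move=> z Ez Fz; have : (E `&` F) z by []; rewrite EF0.
  have [W /set_nbhsP[U [oU EU UW]] Wc] := compact_normal hausY cT cE FE.
  pose V := ~` closure W.
  have oV : open V by apply: closed_openC; exact: closed_closure.
  have FV : F `<=` V by move=> z Fz /Wc.
  have UV z : U z -> V z -> False by move=> /UW /subset_closure.
  (* Some clopen set around [x] stays inside the union of [U] and [V]: otherwise the traces of these
     clopen sets on the compact complement [K] generate a filter, and its cluster point lies in [Q]
     but in neither [U] nor [V]. *)
  have [D [[cD Dx] DUV]] : exists D, (clopen D /\ D x) /\ D `<=` U `|` V.
    apply: contrapT => noD.
    pose K := ~` (U `|` V).
    have cK : compact K.
      by apply: subclosed_compact cT _ => //; apply: open_closedC; exact: openU.
    pose G := filter_from [set D | clopen D /\ D x] (fun D => D `&` K).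
    have FG : ProperFilter G.
      apply: filter_from_proper; last first.
        move=> D [cD Dx]; apply: contrapT => K0; apply: noD; exists D.
        by split=> // z Dz; apply: contrapT => nz; apply: K0; exists z.
      apply: filter_from_filter; first by exists setT; split=> //;
        exact: clopenT.
      move=> A B [cA Ax] [cB Bx]; exists (A `&` B).
        by split=> //; exact: clopenI.
      by move=> z [[? ?] ?].
    have [|p [Kp clp]] := cK G FG.
      by exists setT; [split=> //; exact: clopenT|move=> z []].
    have Qp : Q p.
      move=> C cC Cx; have [_ clC] := cC; apply: clC => A nA.
      have GC : G C by exists C => // z [].
      by have [z [Cz Az]] := clp C A GC nA; exists z.
    by apply: Kp; move: Qp; rewrite QEF => -[/EU|/FV]; [left|right].
  have cDU : clopen (D `&` U).
    split; first by apply: openI => //; case: cD.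
    have -> : D `&` U = D `&` ~` V.
      apply/seteqP; split=> z [Dz]; first by move=> Uz; split=> // /(UV _ Uz).
      by move=> nV; split=> //; case: (DUV _ Dz).
    by apply: closedI; [case: cD|exact: open_closedC].
  apply/seteqP; split=> // z Fz.
  have Qz : Q z by rewrite QEF; right.
  by have [|_ /UV] := Qz _ cDU; [split=> //; exact: EU|apply; exact: FV].
have cQ : connected Q.
  move=> B [b Bb] [O oO BO] [F cF BF].
  have cB : closed B by rewrite BF; exact: closedI.
  have cB' : closed (Q `\` B).
    have -> : Q `\` B = Q `&` ~` O.
      rewrite BO; apply/seteqP; split=> z [Qz nz]; split=> //.
        by move=> Oz; apply: nz.
      by move=> [].
    by apply: closedI => //; exact: open_closedC.
  have BQ : B `<=` Q by rewrite BO => z [].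
  have QE : Q = B `|` (Q `\` B) by rewrite setDUK.
  have [Bx|nBx] := pselect (B x).
    have Q0 := key _ _ cB cB' (setDIK _ _) QE Bx.
    by rewrite [RHS]QE Q0 setU0.
  have B0 : B = set0.
    apply: (key _ _ cB' cB) => //; first by rewrite setIC setDIK.
    by rewrite setUC.
  by move: Bb; rewrite B0.
have : connected_component [set: Y] x y by exists Q.
by rewrite tdT // => /eqP; rewrite eq_sym (negbTE xy).
Qed.

Lemma clopen_nbhs x (A : set Y) : compact [set: Y] ->
  totally_disconnected [set: Y] -> nbhs x A ->
  exists N, [/\ clopen N, N x & N `<=` A].
Proof.
move=> cT tdT nA.
have zd : zero_dimensional Y by move=> a b; exact: quasi_component.
have [N [Nx cN] NA] := @zero_dimensional_cvg Y x hausY zd cT A nA.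
by exists N.
Qed.

End CompactOpen.

(** * Compact open bisections *)

Section Bisections.
Variables (R : realType) (G : cantor_groupoid R).
Implicit Types (g h k : G) (x y : units G) (U V W D : set G).
Implicit Types (A B : set (units G)).

Definition src U : set (units G) := @gsrc G @` U.
Definition rng U : set (units G) := @grng G @` U.
Definition inv_set U : set G := @ginv G @^-1` U.
Definition restr U A : set G := U `&` @gsrc G @^-1` A.

Lemma units_compact : compact [set: units G].
Proof. by have [] := units_cantor G. Qed.

Lemma units_clopen_nbhs x A : nbhs x A ->
  exists N, [/\ clopen N, N x & N `<=` A].
Proof.
have [_ c _ td _] := units_cantor G.
by apply: clopen_nbhs => //; exact: units_hausdorff.
Qed.

Lemma clopen_copen A : clopen A -> copen A.
Proof.
by move=> [oA cA]; split=> //; apply: subclosed_compact units_compact _.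
Qed.

Lemma clopen_units_ind (P : set (units G) -> Prop) (D : set (units G)) :
  P set0 ->
  (forall A B, clopen A -> clopen B -> A `&` B = set0 ->
     A `<=` D -> B `<=` D -> P A -> P B -> P (A `|` B)) ->
  clopen D ->
  (forall x, D x -> exists N, [/\ clopen N, N x &
     forall B, clopen B -> B `<=` N -> B `<=` D -> P B]) -> P D.
Proof.
have co := copen_clopen (@units_hausdorff G).
move=> P0 PU cD loc; apply: (copen_ind (@units_hausdorff G)) => //.
- by move=> A B /co cA /co cB; exact: PU.
- exact: clopen_copen.
- move=> x /loc[N [cN Nx NP]]; exists N; split=> //.
    exact: clopen_copen.
  by move=> B /co; exact: NP.
Qed.

Lemma copen_arrows_clopen U : copen U -> clopen U.
Proof. exact/copen_clopen/arrows_hausdorff. Qed.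

Lemma grng_open U : open U -> open (rng U).
Proof. by apply: local_homeo_open; exact: grng_local_homeo. Qed.

Lemma src_inv_set U : src (inv_set U) = rng U.
Proof.
apply/seteqP; split=> x [g Ug <-].
  by exists (ginv g); rewrite ?grng_inv.
by exists (ginv g); rewrite ?gsrc_inv // /inv_set /= ginvK.
Qed.

Lemma rng_inv_set U : rng (inv_set U) = src U.
Proof.
apply/seteqP; split=> x [g Ug <-].
  by exists (ginv g); rewrite ?gsrc_inv.
by exists (ginv g); rewrite ?grng_inv // /inv_set /= ginvK.
Qed.

Lemma inv_set_open U : open U -> open (inv_set U).
Proof. by move=> oU; apply: open_comp => // g _; exact: ginv_continuous. Qed.

Lemma gsrc_open U : open U -> open (src U).
Proof. by move=> oU; rewrite -rng_inv_set; exact/grng_open/inv_set_open. Qed.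

Lemma gsrc_preimage_clopen A : clopen A -> clopen (@gsrc G @^-1` A).
Proof. by move=> cA; apply: preimage_clopen => //; exact: gsrc_continuous. Qed.

Lemma grng_preimage_clopen A : clopen A -> clopen (@grng G @^-1` A).
Proof. by move=> cA; apply: preimage_clopen => //; exact: grng_continuous. Qed.

Lemma src_clopen U : copen U -> clopen (src U).
Proof.
move=> [cU oU]; split; first exact: gsrc_open.
apply: compact_closed; first exact: units_hausdorff.
apply: continuous_compact => //; apply: continuous_subspaceT.
exact: gsrc_continuous.
Qed.

Lemma inv_set_copen U : copen U -> copen (inv_set U).
Proof.
move=> [cU oU]; split; last exact: inv_set_open.
have -> : inv_set U = @ginv G @` U.
  apply/seteqP; split=> [g Ug|_ [g Ug <-]]; last by rewrite /inv_set /= ginvK.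
  by exists (ginv g) => //; rewrite ginvK.
apply: continuous_compact => //; apply: continuous_subspaceT.
exact: ginv_continuous.
Qed.

Lemma rng_clopen U : copen U -> clopen (rng U).
Proof. by rewrite -src_inv_set => /inv_set_copen/src_clopen. Qed.

Lemma cob_copen U : compact_open_Gset U -> copen U.
Proof. by case. Qed.

Lemma cob_rng_inj U g h : compact_open_Gset U -> U g -> U h ->
  grng g = grng h -> g = h.
Proof. by move=> [_ _ [rU _]] Ug Uh; apply: rU; rewrite inE. Qed.

Lemma cob_src_inj U g h : compact_open_Gset U -> U g -> U h ->
  gsrc g = gsrc h -> g = h.
Proof. by move=> [_ _ [_ sU]] Ug Uh; apply: sU; rewrite inE. Qed.

Lemma cobP U : copen U ->
  (forall g h, U g -> U h -> grng g = grng h -> g = h) ->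
  (forall g h, U g -> U h -> gsrc g = gsrc h -> g = h) -> compact_open_Gset U.
Proof.
by move=> [cU oU] rU sU; split=> //; split=> g h; rewrite !inE;
  [exact: rU|exact: sU].
Qed.

Lemma cob_sub U V : compact_open_Gset U -> copen V -> V `<=` U ->
  compact_open_Gset V.
Proof.
move=> cU cV VU; apply: cobP => // g h /VU Ug /VU Uh.
  exact: (cob_rng_inj cU).
exact: (cob_src_inj cU).
Qed.

Lemma cobI U D : compact_open_Gset U -> clopen D -> compact_open_Gset (U `&` D).
Proof.
move=> cU cD; apply: (cob_sub cU); last by move=> g [].
by apply: copenI => //; exact: cob_copen.
Qed.

Lemma cobD U D : compact_open_Gset U -> clopen D -> compact_open_Gset (U `\` D).
Proof. by move=> cU cD; rewrite setDE; apply/cobI/clopenC. Qed.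

Lemma cob_restr U A : compact_open_Gset U -> clopen A ->
  compact_open_Gset (restr U A).
Proof. by move=> cU cA; apply: cobI => //; exact: gsrc_preimage_clopen. Qed.

Lemma cob_inv U : compact_open_Gset U -> compact_open_Gset (inv_set U).
Proof. exact: compact_open_Gset_inv. Qed.

Lemma src_restr U A : src (restr U A) = src U `&` A.
Proof.
apply/seteqP; split=> [x [g [Ug Ag] <-]|x [[g Ug <-] Ag]].
  by split=> //; exists g.
by exists g.
Qed.

Lemma cobU U V : compact_open_Gset U -> compact_open_Gset V ->
  src U `&` src V = set0 -> rng U `&` rng V = set0 ->
  compact_open_Gset (U `|` V).
Proof.
move=> cU cV s0 r0; apply: cobP; first by apply: copenU; case: cU; case: cV.
  have rx g h : U g -> V h -> grng g <> grng h.
    move=> Ug Vh e; suff : (rng U `&` rng V) (grng g) by rewrite r0.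
    by split; [exists g|exists h].
  move=> g h [Ug|Vg] [Uh|Vh] e; first exact: (cob_rng_inj cU).
  - by case: (rx _ _ Ug Vh e).
  - by case: (rx _ _ Uh Vg).
  - exact: (cob_rng_inj cV).
have sx g h : U g -> V h -> gsrc g <> gsrc h.
  move=> Ug Vh e; suff : (src U `&` src V) (gsrc g) by rewrite s0.
  by split; [exists g|exists h].
move=> g h [Ug|Vg] [Uh|Vh] e; first exact: (cob_src_inj cU).
- by case: (sx _ _ Ug Vh e).
- by case: (sx _ _ Uh Vg).
- exact: (cob_src_inj cV).
Qed.

(** On [O] the range map is injective and open. Restricted to the arrows with range in a small
    clopen [N], it is a homeomorphism onto [N], so compactness of [N] passes to these arrows. *)
Lemma cob_nbhs g D : nbhs g D ->
  exists U, [/\ compact_open_Gset U, U g & U `<=` D].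
Proof.
rewrite nbhsE => -[D' [oD' D'g] D'D].
have [U1 [oU1 U1g iU1]] := @grng_locally_injective G g.
have [U2 [oU2 U2g iU2]] := @gsrc_locally_injective G g.
pose O := D' `&` (U1 `&` U2).
have oO : open O by do 2?apply: openI.
have Og : O g by [].
have [|N [cN Ng NO]] := @units_clopen_nbhs (grng g) (rng O).
  by apply: open_nbhs_nbhs; split; [exact: grng_open|exists g].
have Oinj a b : O a -> O b -> grng a = grng b -> a = b.
  by move=> [_ [U1a _]] [_ [U1b _]]; apply: iU1; rewrite inE.
pose W := O `&` @grng G @^-1` N.
have oW : open W by apply: openI => //; case: (grng_preimage_clopen cN).
have WN : rng W = N.
  apply/seteqP; split=> [_ [a [_ Na] <-] //|x Nx].
  by have [a Oa ax] := NO _ Nx; exists a => //; split=> //=; rewrite ax.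
exists W; split=> //; last by move=> a [[/D'D]].
apply: cobP.
- split=> // F PF FW.
  have cN' : compact N by case: (clopen_copen cN).
  have [|x [Nx clx]] := cN' (@grng G @ F) (fmap_proper_filter _ _).
    by rewrite nbhs_simpl /=; apply: filterS FW => a [].
  have [w Ww wx] : rng W x by rewrite WN.
  exists w; split=> // A B FA nB.
  have [C [oC Cw CB]] : exists C, [/\ open C, C w & C `<=` B].
    by move: nB; rewrite nbhsE => -[C [? ?] ?]; exists C.
  have [||_ [[a [Wa Aa] <-] [b [Wb Cb] eb]]] :=
      clx (rng (W `&` A)) (rng (W `&` C)).
  + rewrite nbhs_simpl /=; apply: filterS (filterI FW FA) => a Wa; by exists a.
  + apply: open_nbhs_nbhs; split; last by exists w.
    by apply/grng_open/openI.
  exists a; split=> //; apply: CB.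
  by rewrite -(Oinj b a) //; [case: Wb|case: Wa].
- by move=> a b [Oa _] [Ob _]; exact: Oinj.
- by move=> a b [[_ [_ U2a]] _] [[_ [_ U2b]] _]; apply: iU2; rewrite inE.
Qed.

Lemma cob_nbhs_clopen g D : clopen D -> D g ->
  exists U, [/\ compact_open_Gset U, U g & U `<=` D].
Proof. by move=> [oD _] Dg; apply: cob_nbhs; exact: open_nbhs_nbhs. Qed.

Lemma gid_copen A : clopen A -> copen (@gid G @` A).
Proof.
move=> cA; split.
  apply: continuous_compact; last by case: (clopen_copen cA).
  by apply: continuous_subspaceT; exact: gid_continuous.
have -> : @gid G @` A = range (@gid G) `&` @gsrc G @^-1` A.
  apply/seteqP; split=> [_ [x Ax <-]|_ [[x _ <-]]].
    by split; [exists x|rewrite /= gsrc_id].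
  by rewrite /= gsrc_id => Ax; exists x.
by apply: openI; [exact: gid_open|case: (gsrc_preimage_clopen cA)].
Qed.

Lemma cob_gid A : clopen A -> compact_open_Gset (@gid G @` A).
Proof.
by move=> cA; apply: cobP; first exact: gid_copen;
  move=> _ _ [x _ <-] [y _ <-]; rewrite ?gsrc_id ?grng_id => ->.
Qed.

Lemma src_gid A : src (@gid G @` A) = A.
Proof.
apply/seteqP; split=> [_ [_ [x Ax <-] <-]|x Ax]; first by rewrite gsrc_id.
by exists (gid x); rewrite ?gsrc_id //; exists x.
Qed.

Lemma rng_gid A : rng (@gid G @` A) = A.
Proof.
apply/seteqP; split=> [_ [_ [x Ax <-] <-]|x Ax]; first by rewrite grng_id.
by exists (gid x); rewrite ?grng_id //; exists x.
Qed.

Lemma gid_range_clopen : clopen (range (@gid G)).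
Proof.
by apply: copen_arrows_clopen; apply: gid_copen; exact: clopenT.
Qed.

Lemma cob_cover D : compact D ->
  exists s : seq G, exists N : G -> set G,
    (forall g, compact_open_Gset (N g)) /\
    (forall g, D g -> exists2 h, h \in s & N h g).
Proof.
move=> cD.
have /choice[N HN] : forall g, exists U, compact_open_Gset U /\ U g.
  move=> g; have [U [? ? _]] := @cob_nbhs g setT filterT.
  by exists U.
have [|s [_ sc]] := compact_finite_cover (N := N) cD.
  by move=> g _; have [[]] := HN g.
by exists s, N; split=> // g; have [] := HN g.
Qed.

Lemma compact_subset_copen D : compact D ->
  exists2 E, copen E & D `<=` E.
Proof.
move=> cD; have [s [N [cN DN]]] := cob_cover cD.
exists (\bigcup_(h in [set` s]) N h).
  rewrite bigcup_seq; elim/big_ind: _ => [|U V|h _]; first exact: copen0.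
    exact: copenU.
  by move: (cN h) => /cob_copen.
by move=> g /DN[h hs Nhg]; exists h.
Qed.

End Bisections.

(** * Integer-valued functions *)

Definition ind (X : topologicalType) (A : set X) : X -> int :=
  fun x => (`[< A x >] : nat)%:R.

Lemma indT (X : topologicalType) (A : set X) x : A x -> ind A x = 1.
Proof. by move=> Ax; rewrite /ind asboolT. Qed.

Lemma indF (X : topologicalType) (A : set X) x : ~ A x -> ind A x = 0.
Proof. by move=> Ax; rewrite /ind asboolF. Qed.

Lemma ind_equiv (X Z : topologicalType) (A : set X) (B : set Z)
    (x : X) (z : Z) : (A x <-> B z) -> ind A x = ind B z.
Proof. by move=> AB; rewrite /ind (asbool_equiv_eq AB). Qed.

Lemma indU_disjoint (X : topologicalType) (A B : set X) (x : X) :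
  ~ (A x /\ B x) -> ind (A `|` B) x = ind A x + ind B x.
Proof.
move=> nAB; have [Ax|nAx] := pselect (A x).
  rewrite (indT (or_introl Ax : (A `|` B) x)) (indT Ax) indF ?addr0 // => Bx.
  by apply: nAB.
rewrite (indF nAx) add0r; have [Bx|nBx] := pselect (B x).
  by rewrite (indT (or_intror Bx : (A `|` B) x)) indT.
by rewrite !indF // => -[].
Qed.

Section Functions.
Variable Y : topologicalType.
Hypothesis hausY : hausdorff_space Y.
Implicit Types (A B D : set Y) (f g : Cc Y).

Lemma is_CcI (f : Y -> int) K : (forall x, \forall y \near x, f y = f x) ->
  compact K -> (forall x, f x != 0 -> K x) -> f \in is_Cc (X := Y).
Proof.
move=> lf cK fK; apply/asboolP; split.
  by move=> x; apply/(@discrete_cvg (discrete_topology int)); exact: lf.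
apply: (subclosed_compact (@closed_closure _ _) cK).
have /closure_id-> : closed K by exact: compact_closed.
by apply: closureS => x; exact: fK.
Qed.

Lemma Cc_locally_constant f x : \forall y \near x, f y = f x.
Proof.
have /asboolP[cf _] := Cc_funP f; have := cf x [set f x]; apply.
exact: (@discrete_set1 (discrete_topology int)).
Qed.

Lemma Cc_level_clopen f (S : set int) : clopen [set x | S (f x)].
Proof.
have opS (T : set int) : open [set x | T (f x)].
  rewrite openE => x Tx; have := @Cc_locally_constant f x.
  by apply: filterS => y /= ->.
split; first exact: opS.
by rewrite -openC; have := opS (~` S).
Qed.

Lemma Cc_support_copen f : copen [set x | f x != 0].
Proof.
have [oS cS] := @Cc_level_clopen f [set z | z != 0].
split=> //; have /asboolP[_ kf] := Cc_funP f.
by apply: (subclosed_compact cS kf); exact: subset_closure.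
Qed.

Lemma ind_Cc A : copen A -> ind A \in is_Cc (X := Y).
Proof.
move=> cA; have [oA lA] := copen_clopen hausY cA.
apply: (is_CcI _ cA.1); last first.
  by move=> x; apply: contra_neqP => nAx; rewrite indF.
move=> x; have [Ax|nAx] := pselect (A x).
  have := open_nbhs_nbhs (conj oA Ax); apply: filterS => y Ay.
  by rewrite !indT.
have := open_nbhs_nbhs (conj (closed_openC lA) nAx); apply: filterS => y Ay.
by rewrite !indF.
Qed.

Definition indc A : Cc Y := insubd (0 : Cc Y) (ind A).

Lemma indcE A : copen A -> indc A = ind A :> (Y -> int).
Proof. by move=> /ind_Cc iA; rewrite /indc; exact: (insubdK (0 : Cc Y) iA). Qed.

Lemma Cc_ext f g : (forall x, f x = g x) -> f = g.
Proof. by move=> fg; apply/val_inj/funext. Qed.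

Lemma CcD f g x : (f + g) x = f x + g x. Proof. by []. Qed.
Lemma CcN f x : (- f) x = - f x. Proof. by []. Qed.
Lemma CcB f g x : (f - g) x = f x - g x. Proof. by []. Qed.

Lemma CcMn f n x : (f *+ n) x = f x *+ n.
Proof. by elim: n => // n IH; rewrite !mulrS CcD IH. Qed.

(** Locally [f] is an integer multiple of an indicator, and additivity glues. Statements about
    chains thus reduce to indicators, up to sign, of arbitrarily small compact open sets. *)
Lemma Cc_ind (P : Cc Y -> Prop) f : P 0 ->
  (forall g h, P g -> P h -> P (g + h)) ->
  (forall x, f x != 0 -> exists N, [/\ copen N, N x &
     forall B, copen B -> B `<=` N -> P (indc B) /\ P (- indc B)]) -> P f.
Proof.
move=> P0 PD loc.
pose D := [set x | f x != 0]; have coD := Cc_support_copen f.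
pose F B : Y -> int := fun x => f x * ind B x.
have FE B : copen B -> F B \in is_Cc (X := Y).
  move=> cB; have [oB lB] := copen_clopen hausY cB.
  apply: (is_CcI _ cB.1); last first.
    by move=> x; apply: contra_neqP => nBx; rewrite /F indF ?mulr0.
  move=> x; near=> y; rewrite /F; congr (_ * _).
    by near: y; exact: Cc_locally_constant.
  have -> : ind B = indc B by rewrite indcE.
  by near: y; exact: Cc_locally_constant.
pose FC B : Cc Y := insubd (0 : Cc Y) (F B).
have FCE B : copen B -> FC B = F B :> (Y -> int).
  by move=> /FE iB; exact: (insubdK (0 : Cc Y) iB).
suff : P (FC D).
  congr P; apply: Cc_ext => x; rewrite FCE // /F.
  have [fx|/negP/negPn/eqP->] := pselect (f x != 0); last by rewrite mul0r.
  by rewrite indT ?mulr1.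
apply: (copen_ind hausY (P := fun B => P (FC B))) => //.
- suff -> : FC set0 = 0 by [].
  apply: Cc_ext => x; rewrite FCE; last exact: copen0.
  by rewrite /F indF // mulr0.
- move=> A B cA cB AB _ _ PA PB.
  suff -> : FC (A `|` B) = FC A + FC B by exact: PD.
  apply: Cc_ext => x; rewrite CcD !FCE //; last exact: copenU.
  rewrite /F -mulrDr; congr (_ * _).
  by apply: indU_disjoint => ABx; rewrite -[False]/(set0 x) -AB.
- move=> x fx; have [N [cN Nx NP]] := loc x fx.
  exists (N `&` [set y | f y = f x]); split=> //.
    by apply: copenI => //; exact: (Cc_level_clopen f [set f x]).
  move=> B cB BN _.
  have [PB PNB] := NP B cB (fun y By => (BN y By).1).
  have Pn g n : P g -> P (g *+ n).
    by move=> Pg; elim: n => // n IH; rewrite mulrS; exact: PD.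
  suff -> : FC B = indc B *~ f x by case: (f x) => n;
    [exact: Pn|rewrite NegzE mulrNz -pmulrn -mulNrn; exact: Pn].
  apply: Cc_ext => y; rewrite FCE // /F.
  have -> : (indc B *~ f x) y = ind B y *~ f x.
    by rewrite -indcE //; case: (f x) => n;
      rewrite ?NegzE ?mulrNz -?pmulrn ?CcN CcMn.
  have [By|nBy] := pselect (B y); last by rewrite indF // mulr0 mul0rz.
  by have [_ /= ->] := BN y By; rewrite indT // mulr1 intz.
Unshelve. all: by end_near. Qed.

End Functions.

(** * Pushforwards of indicators *)

Section Pushforward.
Variables (X Y : topologicalType) (p : X -> Y).

Lemma pushforward1 (f : X -> int) y x : p x = y ->
  (forall x', p x' = y -> f x' != 0 -> x' = x) -> pushforward p f y = f x.
Proof.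
move=> pxy uniq; rewrite /pushforward -[RHS](@fsbig_set1 _ 0 +%R).
apply/esym/fsbig_widen; first by move=> _ ->.
move=> x' [/= px' nx']; apply: contra_notP nx' => /eqP; exact: uniq.
Qed.

Lemma pushforward0 (f : X -> int) y :
  (forall x', p x' = y -> f x' = 0) -> pushforward p f y = 0.
Proof. by move=> f0; apply: fsbig1 => x /f0. Qed.

Lemma pushforward_ind (U : set X) y :
  (forall x x', U x -> U x' -> p x = p x' -> x = x') ->
  pushforward p (ind U) y = ind (p @` U) y.
Proof.
move=> inj; have [[x Ux pxy]|nU] := pselect ((p @` U) y).
  rewrite (pushforward1 pxy) ?indT //; first by exists x.
  move=> x' px'; have [Ux'|nUx'] := pselect (U x'); last by rewrite indF.
  by move=> _; apply: inj => //; rewrite pxy.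
rewrite pushforward0 ?indF // => x' px'; rewrite indF // => Ux'.
by apply: nU; exists x'.
Qed.

End Pushforward.

Lemma set_type_compact (Z : topologicalType) (C A : set Z) :
  closed C -> compact A -> compact [set p : set_type C | A (val p)].
Proof.
move=> cC cA F PF FA.
pose v : set_type C -> Z := val.
have [|z [[Az Cz] clz]] :=
    compact_closedI cA cC (F := v @ F) (fmap_proper_filter _ _).
  rewrite nbhs_simpl /=; apply: filterS FA => p Ap.
  by split=> //; exact: set_mem (valP p).
exists (SigSub (mem_set Cz)); split=> // B D FB.
rewrite nbhsE => -[W [[O oO OW] Wz] WD].
have nO : nbhs z O.
  by apply: open_nbhs_nbhs; split=> //; move: Wz; rewrite -OW.
have [||w [[p Bp <-] Op]] := clz (v @` B) O.
- by rewrite nbhs_simpl /=; apply: filterS FB => p Bp; exists p.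
- exact: nO.
by exists p; split=> //; apply: WD; rewrite -OW.
Qed.

(** * Boundaries *)

Section Boundaries.
Variables (R : realType) (G : cantor_groupoid R).
Implicit Types (g h k : G) (x y : units G) (U V W D : set G).
Implicit Types (A B : set (units G)).

Let hausG := @arrows_hausdorff G.

Definition mkpair g h (e : gsrc g = grng h) : G2 G :=
  SigSub (mem_set (e : composable (g, h))).

Lemma G2_ext (p q : G2 G) : (val p).1 = (val q).1 -> (val p).2 = (val q).2 ->
  p = q.
Proof. by move=> e1 e2; apply/val_inj/injective_projections. Qed.

Definition pairs U V : set (G2 G) := [set p | U (val p).1 /\ V (val p).2].

Lemma G2_hausdorff : hausdorff_space (G2 G).
Proof.
move=> p q cpq; apply: G2_ext; apply: hausG => A B nA nB.
  pose pr (p : G2 G) := (val p).1.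
  have cpr : continuous pr.
    by move=> r; apply: (@continuous_comp _ _ _ (@set_val _ _) fst);
      [exact: initial_continuous|exact: cvg_fst].
  by have [r [Ar Br]] := cpq _ _ (cpr p _ nA) (cpr q _ nB); exists (pr r).
pose pr (p : G2 G) := (val p).2.
have cpr : continuous pr.
  by move=> r; apply: (@continuous_comp _ _ _ (@set_val _ _) snd);
    [exact: initial_continuous|exact: cvg_snd].
by have [r [Ar Br]] := cpq _ _ (cpr p _ nA) (cpr q _ nB); exists (pr r).
Qed.

Lemma pairs_copen U V : copen U -> copen V -> copen (pairs U V).
Proof.
move=> [cU oU] [cV oV]; split.
  have := set_type_compact (@composable_closed G) (compact_setX cU cV).
  by congr compact; apply/seteqP; split=> p [].
have -> : pairs U V =
    [set p : G2 G | U (val p).1] `&` [set p : G2 G | V (val p).2].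
  by apply/seteqP; split=> p [].
apply: openI.
  by apply: (@G2_open_preimage _ fst) => // z; exact: cvg_fst.
by apply: (@G2_open_preimage _ snd) => // z; exact: cvg_snd.
Qed.

Lemma G2_nbhs_pairs (p : G2 G) (D : set (G2 G)) : nbhs p D ->
  exists U V, [/\ compact_open_Gset U, compact_open_Gset V,
    pairs U V p & pairs U V `<=` D].
Proof.
rewrite nbhsE => -[_ [[O oO <-] Op] OD].
have := open_nbhs_nbhs (conj oO Op) => -[[A B] /= [nA nB] AB].
have [U [cU Up UA]] := cob_nbhs nA; have [V [cV Vp VB]] := cob_nbhs nB.
exists U, V; split=> // q [/UA Aq /VB Bq]; apply: OD.
by apply: (AB (val q)).
Qed.

(** A pair in [pairs U V] is determined by its first arrow, [V] being injective on ranges. So [B] is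
    recovered from its first projection [U'], with [V'] the part of [V] composable with it. *)
Lemma subset_pairs U V (B : set (G2 G)) : compact_open_Gset U ->
  compact_open_Gset V -> copen B -> B `<=` pairs U V ->
  exists U' V', [/\ compact_open_Gset U', compact_open_Gset V',
    B = pairs U' V', src U' = rng V' & U' `<=` U /\ V' `<=` V].
Proof.
move=> cU cV [cB oB] BUV.
pose U' : set G := (fun p : G2 G => (val p).1) @` B.
have cU' : compact_open_Gset U'.
  apply: (cob_sub cU); last by move=> _ [p /BUV[Up _] <-].
  split.
    apply: continuous_compact => //; apply: continuous_subspaceT => r.
    by apply: (@continuous_comp _ _ _ (@set_val _ _) fst);
      [exact: initial_continuous|exact: cvg_fst].
  rewrite openE => _ [q Bq <-].
  have := open_nbhs_nbhs (conj oB Bq).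
  move=> /G2_nbhs_pairs[O1 [O2 [[_ oO1 _] [_ oO2 _] [O1q O2q] OB]]].
  have oE : open (O1 `&` @gsrc G @^-1` rng O2).
    apply: openI => //; apply: open_comp; last exact: grng_open.
    by move=> g _; exact: gsrc_continuous.
  apply: filterS (open_nbhs_nbhs (conj oE _)); last first.
    by split=> //; exists (val q).2 => //; rewrite G2_comp.
  move=> u [O1u [w O2w e]]; exists (mkpair (esym e)) => //.
  by apply: OB.
pose V' := V `&` @grng G @^-1` src U'.
have cV' : compact_open_Gset V'.
  by apply: cobI => //; apply/grng_preimage_clopen/src_clopen/cob_copen.
exists U', V'; split=> //.
- apply/seteqP; split=> [p Bp|p [[q Bq e] [Vp _]]].
    have [Up Vp] := BUV _ Bp; split; first by exists p.
    by split=> //; exists (val p).1; [exists p|rewrite /= G2_comp].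
  suff -> : p = q by [].
  apply: G2_ext => //; have [_ Vq] := BUV _ Bq.
  by apply: (cob_rng_inj cV) => //; rewrite -!G2_comp e.
- apply/seteqP; split=> [_ [_ [q Bq <-] <-]|_ [v [_ U'v] <-]] //.
  have [Uq Vq] := BUV _ Bq; exists (val q).2; last by rewrite -G2_comp.
  by split=> //; exists (val q).1; [exists q|rewrite G2_comp].
- by split=> [_ [q /BUV[? _] <-] //|v []].
Qed.

Lemma boundary1_ind U : compact_open_Gset U ->
  boundary1 (indc U) = ind (src U) - ind (rng U) :> (units G -> int).
Proof.
move=> cU; apply/funext => x; rewrite /boundary1 (indcE hausG (cob_copen cU)).
have -> : (pushforward (@gsrc G) (ind U) - pushforward (@grng G) (ind U)) x =
  pushforward (@gsrc G) (ind U) x - pushforward (@grng G) (ind U) x by [].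
rewrite !pushforward_ind //; first by move=> g h; exact: (cob_rng_inj cU).
by move=> g h; exact: (cob_src_inj cU).
Qed.

(** All three faces are injective on such pairs. [V] is only asked to be injective on ranges: in
    [K_cycle_bounds] it consists of the arrows of [K] out of a transversal, many of which share a
    source. *)
Lemma boundary2_pairs U V : compact_open_Gset U -> copen V ->
  (forall g h, V g -> V h -> grng g = grng h -> g = h) ->
  boundary2 (indc (pairs U V)) = ind (V `&` @grng G @^-1` src U)
    - ind (set_mul U V) + ind (U `&` @gsrc G @^-1` rng V) :> (G -> int).
Proof.
move=> cU cV rV; apply/funext => g; rewrite /boundary2.
rewrite (indcE G2_hausdorff (pairs_copen (cob_copen cU) cV)).
set f := ind _.
have -> : (pushforward (@face0 G) f - pushforward (@face1 G) f
   + pushforward (@face2 G) f) g = pushforward (@face0 G) f g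
    - pushforward (@face1 G) f g + pushforward (@face2 G) f g by [].
have -> : (ind (V `&` @grng G @^-1` src U) - ind (set_mul U V)
   + ind (U `&` @gsrc G @^-1` rng V)) g = ind (V `&` @grng G @^-1` src U) g
  - ind (set_mul U V) g + ind (U `&` @gsrc G @^-1` rng V) g by [].
have sU := cob_src_inj cU; have rU := cob_rng_inj cU.
rewrite !pushforward_ind.
- congr (_ - _ + _); congr (ind _ g); apply/seteqP; split.
  + move=> _ [p [Up Vp] <-]; split=> //; exists (val p).1 => //.
    by rewrite G2_comp.
  + by move=> v [Vv [u Uu e]]; exists (mkpair e).
  + move=> _ [p [Up Vp] <-]; exists (val p).1, (val p).2; split=> //.
    by rewrite G2_comp.
  + by move=> _ [u [v [Uu Vv e ->]]]; exists (mkpair e).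
  + move=> _ [p [Up Vp] <-]; split=> //; exists (val p).2 => //.
    by rewrite -G2_comp.
  + by move=> u [Uu [v Vv e]]; exists (mkpair (esym e)).
- move=> p q [Up Vp] [Uq Vq] e; apply: G2_ext => //.
  by apply: rV => //; rewrite -!G2_comp; exact: (congr1 (@gsrc G) e).
- move=> p q [Up Vp] [Uq Vq] e.
  have e1 : (val p).1 = (val q).1.
    apply: rU => //; rewrite -(grng_mul (G2_comp p)) -(grng_mul (G2_comp q)).
    exact: (congr1 (@grng G) e).
  by apply: G2_ext => //; apply: rV => //; rewrite -!G2_comp e1.
- move=> p q [Up Vp] [Uq Vq] e; apply: G2_ext => //.
  by apply: sU => //; rewrite !G2_comp; exact: (congr1 (@grng G) e).
Qed.

Lemma boundary1_0 : boundary1 (0 : Cc G) = 0 :> (units G -> int).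
Proof. by rewrite -(subrr (0 : Cc G)) boundary1B subrr. Qed.

Lemma boundary1N (f : Cc G) : boundary1 (- f) = - boundary1 f.
Proof. by rewrite -[- f]add0r boundary1B boundary1_0 add0r. Qed.

Lemma boundary1D (f g : Cc G) : boundary1 (f + g) = boundary1 f + boundary1 g.
Proof. by rewrite -[g]opprK boundary1B !boundary1N opprK. Qed.

Lemma boundary2_0 : boundary2 (0 : Cc (G2 G)) = 0 :> (G -> int).
Proof. by rewrite -(subrr (0 : Cc (G2 G))) boundary2B subrr. Qed.

Lemma boundary2N (f : Cc (G2 G)) : boundary2 (- f) = - boundary2 f.
Proof. by rewrite -[- f]add0r boundary2B boundary2_0 add0r. Qed.

Lemma boundary2D (f g : Cc (G2 G)) :
  boundary2 (f + g) = boundary2 f + boundary2 g.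
Proof. by rewrite -[g]opprK boundary2B !boundary2N opprK. Qed.

(* Being a cycle is recorded here, which avoids proving
   [boundary1 \o boundary2 = 0] for arbitrary chains. *)
Definition bounds (f : Cc G) : Prop :=
  boundary1 f = 0 /\ exists h : Cc (G2 G), f = boundary2 h :> (G -> int).

Lemma bounds0 : bounds 0.
Proof.
split; first exact: boundary1_0.
by exists 0; rewrite boundary2_0.
Qed.

Lemma boundsB (f g : Cc G) : bounds f -> bounds g -> bounds (f - g).
Proof.
move=> [f0 [h fh]] [g0 [k gk]]; split; first by rewrite boundary1B f0 g0 subrr.
by exists (h - k); rewrite boundary2B -fh -gk.
Qed.

Lemma boundsN (f : Cc G) : bounds f -> bounds (- f).
Proof. by rewrite -[- f]add0r; apply: boundsB; exact: bounds0. Qed.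

Lemma boundsD (f g : Cc G) : bounds f -> bounds g -> bounds (f + g).
Proof. by move=> bf /boundsN; rewrite -{2}[g]opprK; exact: boundsB. Qed.

Lemma src_mul U V : src U = rng V -> src (set_mul U V) = src V.
Proof.
move=> e; apply/seteqP; split=> [_ [_ [u [v [Uu Vv uv ->]]] <-]|_ [v Vv <-]].
  by exists v; rewrite ?gsrc_mul.
have [u Uu uv] : src U (grng v) by rewrite e; exists v.
by exists (gmul u v); [exists u, v|rewrite gsrc_mul].
Qed.

Lemma rng_mul U V : src U = rng V -> rng (set_mul U V) = rng U.
Proof.
move=> e; apply/seteqP; split=> [_ [_ [u [v [Uu Vv uv ->]]] <-]|_ [u Uu <-]].
  by exists u; rewrite ?grng_mul.
have [v Vv uv] : rng V (gsrc u) by rewrite -e; exists u.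
by exists (gmul u v); [exists u, v|rewrite grng_mul].
Qed.

(** The basic relation in homology: the class of a product is the sum of the classes, witnessed by
    the chain of all composable pairs. The relations for units, for inverses and for the index map
    are derived from it. *)
Lemma bounds_mul U V : compact_open_Gset U -> compact_open_Gset V ->
  src U = rng V -> bounds (indc U + indc V - indc (set_mul U V)).
Proof.
move=> cU cV e; have cUV := compact_open_Gset_mul cU cV; split.
  rewrite boundary1B boundary1D !boundary1_ind // src_mul // rng_mul // e.
  rewrite [X in X - _]addrC addrA subrK.
  exact: subrr.
exists (indc (pairs U V)).
rewrite boundary2_pairs //; last by move=> g h; exact: (cob_rng_inj cV).
  have -> : V `&` @grng G @^-1` src U = V.
    by apply/seteqP; split=> [g []//|g Vg]; split=> //=; rewrite e; exists g.
  have -> : U `&` @gsrc G @^-1` rng V = U.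
    by apply/seteqP; split=> [g []//|g Ug]; split=> //=; rewrite -e; exists g.
  apply/funext => g; rewrite CcB CcD !indcE //; try exact: cob_copen.
  by rewrite [ind U g + _]addrC addrAC.
exact: cob_copen.
Qed.

Lemma set_mul_gidl A U : rng U `<=` A -> set_mul (@gid G @` A) U = U.
Proof.
move=> rA; apply/seteqP; split=> [_ [_ [u [[x Ax <-] Uu e ->]]]|u Uu].
  by rewrite gsrc_id in e; rewrite e gmul1l.
exists (gid (grng u)), u; split=> //; rewrite ?gsrc_id ?gmul1l //.
by exists (grng u) => //; apply: rA; exists u.
Qed.

(** A set of units is its own square, so the product relation leaves exactly one copy of it. *)
Lemma bounds_gid A : clopen A -> bounds (indc (@gid G @` A)).
Proof.
move=> cA; have cgA := cob_gid cA.
have := bounds_mul cgA cgA; rewrite src_gid rng_gid => /(_ erefl).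
by rewrite set_mul_gidl ?rng_gid // addrK.
Qed.

Lemma set_mul_inv U : compact_open_Gset U ->
  set_mul U (inv_set U) = @gid G @` rng U.
Proof.
move=> cU; apply/seteqP; split=> [_ [u [v [Uu Uv e ->]]]|_ [_ [u Uu <-] <-]].
  have -> : u = ginv v by apply: (cob_src_inj cU) => //; rewrite gsrc_inv.
  by rewrite gmulVl; exists (gsrc v) => //; exists (ginv v); rewrite ?grng_inv.
exists u, (ginv u); split; rewrite ?grng_inv ?gmulVr //.
by rewrite /inv_set /= ginvK.
Qed.

Lemma bounds_inv U : compact_open_Gset U ->
  bounds (indc U + indc (inv_set U)).
Proof.
move=> cU; have cV := cob_inv cU.
rewrite -[X in bounds X](subrK (indc (set_mul U (inv_set U)))).
apply: boundsD; first by apply: bounds_mul; rewrite // rng_inv_set.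
by rewrite set_mul_inv //; apply/bounds_gid/rng_clopen/cob_copen.
Qed.

Lemma indcU (Y : topologicalType) (hY : hausdorff_space Y) (A B : set Y) :
  copen A -> copen B -> A `&` B = set0 -> indc (A `|` B) = indc A + indc B.
Proof.
move=> cA cB AB; apply: Cc_ext => x; rewrite CcD !indcE //; last exact: copenU.
by apply: indU_disjoint => ABx; rewrite -[False]/(set0 x) -AB.
Qed.

End Boundaries.

(** * Elements of the topological full group *)

Section AbClass.
Variable H : groupType.

Lemma ab_class_mul (x y : H) : ab_class (x * y)%g = ab_class x + ab_class y.
Proof. by apply/esym; exact: ab_addE. Qed.

Lemma ab_class1 : ab_class (1%g : H) = 0.
Proof. by []. Qed.

Lemma ab_class_inv (x : H) : ab_class (x^-1)%g = - ab_class x.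
Proof. by apply/esym; exact: ab_oppE. Qed.

Lemma ab_class_prod I (s : seq I) (F : I -> H) :
  ab_class (\prod_(i <- s) F i)%g = \sum_(i <- s) ab_class (F i).
Proof.
by elim: s => [|i s IH]; rewrite ?big_nil // !big_cons ab_class_mul IH.
Qed.

End AbClass.

Section FullGroupElements.
Variables (R : realType) (G : cantor_groupoid R).
Hypothesis hp : principal G.
Implicit Types (g h k : G) (x y : units G) (U V W D : set G).
Implicit Types (A B : set (units G)) (a b : full_group G).

Lemma arrow_unique g h : gsrc g = gsrc h -> grng g = grng h -> g = h.
Proof.
move=> s r.
have e : gsrc (ginv g) = grng h by rewrite gsrc_inv.
have [|x _ gx] := hp (g := gmul (ginv g) h).
  by rewrite grng_mul // gsrc_mul // grng_inv.
have := gmulVKl r; rewrite -gx => <-.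
suff -> : x = gsrc g by rewrite gmul1r.
by rewrite -(grng_id x) gx grng_mul // grng_inv.
Qed.

Definition graph (a : units G -> units G) : set G :=
  [set g | a (gsrc g) = grng g].

Lemma theta_graph U (a : units G -> units G) : is_theta U a -> U = graph a.
Proof.
move=> tU; apply/seteqP; split=> [g Ug|g e]; first by apply/tU; exists g.
have [h Uh [sh rh]] := (tU (gsrc g) (grng g)).1 e.
by rewrite (arrow_unique (esym sh) (esym rh)).
Qed.

Lemma full_theta a : is_theta (graph a) a.
Proof.
by have /asboolP[_ [U cU tU]] := full_funP a; rewrite -(theta_graph tU).
Qed.

Lemma graph_cob a : compact_open_Gset (graph a).
Proof.
by have /asboolP[_ [U cU tU]] := full_funP a; rewrite -(theta_graph tU).
Qed.

Lemma graph_arrow a x : exists g, [/\ graph a g, gsrc g = x & grng g = a x].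
Proof. by have [g ? [? ?]] := (full_theta a x (a x)).1 erefl; exists g. Qed.

Lemma full_inj a : injective a.
Proof.
by have /asboolP[[_ [b [_ ab _]]] _] := full_funP a; exact: can_inj ab.
Qed.

Lemma full_VK a x : ((a^-1)%g : full_group G) (a x) = x.
Proof. by have := mulVg a => /(congr1 (fun b : full_group G => b x)). Qed.

Lemma full_KV a x : a (((a^-1)%g : full_group G) x) = x.
Proof. by have := mulgV a => /(congr1 (fun b : full_group G => b x)). Qed.

Lemma src_graph a : src (graph a) = setT.
Proof.
by apply/seteqP; split=> // x _; have [g [gg <- _]] := graph_arrow a x;
  exists g.
Qed.

Lemma rng_graph a : rng (graph a) = setT.
Proof.
apply/seteqP; split=> // x _.
have [g [gg _ rg]] := graph_arrow a (((a^-1)%g : full_group G) x).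
by exists g => //; rewrite rg full_KV.
Qed.

Lemma full_of_cob U : compact_open_Gset U -> src U = setT -> rng U = setT ->
  exists a : full_group G, is_theta U a.
Proof.
move=> cU sU rU.
have /choice[f fP] :
  forall x, exists y, exists2 g, U g & gsrc g = x /\ grng g = y.
  move=> x; have [g Ug gx] : src U x by rewrite sU.
  by exists (grng g), g.
have tU : is_theta U f.
  move=> x y; split=> [<-//|[g Ug [sg rg]]].
  have [h Uh [sh rh]] := fP x.
  by rewrite -rg -rh; congr grng; apply: (cob_src_inj cU) => //; rewrite sg.
have cont V (c : units G -> units G) : compact_open_Gset V -> is_theta V c ->
    continuous c.
  move=> cV tV x A; rewrite nbhsE => -[O [oO Ox] OA].
  have oE : open (src (V `&` @grng G @^-1` O)).
    apply/gsrc_open/openI; first by case: cV.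
    by apply: open_comp => // g _; exact: grng_continuous.
  have [g Vg [sg rg]] := (tV x (c x)).1 erefl.
  apply: filterS (open_nbhs_nbhs (conj oE _)); last first.
    by exists g => //; split=> //=; rewrite rg.
  move=> _ [h [Vh Oh] <-]; apply: OA => /=.
  by rewrite ((tV _ _).2 (ex_intro2 _ _ h Vh (conj erefl erefl))).
have /choice[f' fP'] :
  forall x, exists y, exists2 g, U g & gsrc g = y /\ grng g = x.
  move=> x; have [g Ug gx] : rng U x by rewrite rU.
  by exists (gsrc g), g.
have tU' : is_theta (inv_set U) f'.
  move=> x y; split=> [<-|[g Ug [sg rg]]].
    have [h Uh [sh rh]] := fP' x; exists (ginv h).
      by rewrite /inv_set /= ginvK.
    by rewrite gsrc_inv grng_inv.
  have [h Uh [sh rh]] := fP' x.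
  rewrite -rg -sh -gsrc_inv; congr gsrc; apply: (cob_rng_inj cU) => //.
  by rewrite rh grng_inv sg.
suff ff : in_full_group f by exists (FullGroup ff).
apply/asboolP; split; last by exists U.
split; first exact: cont cU tU.
exists f'; split; first exact: cont (cob_inv cU) tU'.
  move=> x; apply/tU'; have [g Ug [sg rg]] := fP x; exists (ginv g).
    by rewrite /inv_set /= ginvK.
  by rewrite gsrc_inv grng_inv.
by move=> x; apply/tU; have [g Ug [sg rg]] := fP' x; exists g.
Qed.

Definition adm U : Prop := compact_open_Gset U /\ rng U `&` src U = set0.

Lemma adm_sub U V : adm U -> copen V -> V `<=` U -> adm V.
Proof.
move=> [cU dU] cV VU; split; first exact: cob_sub cU cV VU.
apply/seteqP; split=> // x [[g /VU Ug gx] [h /VU Uh hx]].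
by rewrite -dU; split; [exists g|exists h].
Qed.

Lemma adm_neq U g h : adm U -> U g -> U h -> grng g <> gsrc h.
Proof.
move=> [_ dU] Ug Uh e; suff : (rng U `&` src U) (grng g) by rewrite dU.
by split; [exists g|exists h].
Qed.

Lemma adm_inv U : adm U -> adm (inv_set U).
Proof.
move=> [cU dU]; split; first exact: cob_inv.
by rewrite src_inv_set rng_inv_set setIC.
Qed.

Lemma adm0 : adm set0.
Proof.
split; last by rewrite /rng image_set0 set0I.
by apply: cobP => //; exact: copen0.
Qed.

Definition moved U : set (units G) := src U `|` rng U.

Lemma tau_exists U : adm U -> exists a : full_group G, is_tau U a.
Proof.
move=> aU; have [cU dU] := aU; have aV := adm_inv aU; have [cV _] := aV.
have cM : clopen (moved U).
  by apply: clopenU; [apply: src_clopen|apply: rng_clopen]; exact: cob_copen.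
have cE := cob_gid (clopen_setC cM).
have cUV : compact_open_Gset (U `|` inv_set U).
  by apply: cobU; rewrite // ?src_inv_set ?rng_inv_set // setIC.
have sUV : src (U `|` inv_set U) = moved U.
  by rewrite /src image_setU -!/(src _) src_inv_set.
have rUV : rng (U `|` inv_set U) = moved U.
  by rewrite /rng image_setU -!/(rng _) rng_inv_set setUC.
have cP : compact_open_Gset (U `|` inv_set U `|` @gid G @` ~` moved U).
  by apply: cobU; rewrite // ?sUV ?rUV ?src_gid ?rng_gid setICr.
have [||a ta] := full_of_cob cP.
- by rewrite /src image_setU -!/(src _) sUV src_gid setUv.
- by rewrite /rng image_setU -!/(rng _) rUV rng_gid setUv.
exists a; split=> [g Ug|x nsx nrx].
  split; apply/ta; first by exists g => //; left; left.
  exists (ginv g); last by rewrite gsrc_inv grng_inv.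
  by left; right; rewrite /inv_set /= ginvK.
apply/ta; exists (gid x); last by rewrite gsrc_id grng_id.
by right; exists x => // -[].
Qed.

Lemma is_tau_unique U a b : is_tau U a -> is_tau U b -> a = b.
Proof.
move=> [a1 a2] [b1 b2]; apply: full_group_ext => x.
have [[g Ug <-]|nx] := pselect (src U x).
  by have [-> _] := a1 _ Ug; have [-> _] := b1 _ Ug.
have [[g Ug <-]|nx'] := pselect (rng U x).
  by have [_ ->] := a1 _ Ug; have [_ ->] := b1 _ Ug.
by rewrite a2 // b2.
Qed.

Definition tau U : full_group G := xget 1%g [set a | is_tau U a].

Lemma tauP U : adm U -> is_tau U (tau U).
Proof.
by move=> /tau_exists[a ta]; rewrite /tau; case: xgetP => [b _ //|/(_ a)].
Qed.

Lemma is_tauE U a : is_tau U a -> adm U -> a = tau U.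
Proof. by move=> ta aU; apply: is_tau_unique ta (tauP aU). Qed.

Lemma tau_src U g : adm U -> U g -> tau U (gsrc g) = grng g.
Proof. by move=> /tauP[t _] /t[]. Qed.

Lemma tau_rng U g : adm U -> U g -> tau U (grng g) = gsrc g.
Proof. by move=> /tauP[t _] /t[]. Qed.

Lemma tau_out U x : adm U -> ~ src U x -> ~ rng U x -> tau U x = x.
Proof. by move=> /tauP[_ t]; exact: t. Qed.

Lemma tauE U a : adm U -> (forall g, U g -> a (gsrc g) = grng g) ->
  (forall g, U g -> a (grng g) = gsrc g) ->
  (forall x, ~ src U x -> ~ rng U x -> a x = x) -> tau U = a.
Proof.
by move=> aU a1 a2 a3; apply/esym/is_tauE => //; split=> // g Ug; split; auto.
Qed.

Lemma tau0 : tau set0 = 1%g.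
Proof. by apply: tauE => //; exact: adm0. Qed.

Lemma tau_inv U : adm U -> tau (inv_set U) = tau U.
Proof.
move=> aU; apply: tauE; first exact: adm_inv.
- by move=> g Ug; rewrite -(grng_inv g) -(gsrc_inv g) tau_rng.
- by move=> g Ug; rewrite -(grng_inv g) -(gsrc_inv g) tau_src.
- by move=> x; rewrite src_inv_set rng_inv_set => ? ?; rewrite tau_out.
Qed.

Lemma tauK U : adm U -> (tau U * tau U)%g = 1%g.
Proof.
move=> aU; apply: full_group_ext => x /=.
have [[g Ug <-]|nx] := pselect (src U x); first by rewrite tau_src // tau_rng.
have [[g Ug <-]|nx'] := pselect (rng U x); first by rewrite tau_rng // tau_src.
by rewrite !tau_out.
Qed.

Lemma tauU U V : adm (U `|` V) -> copen U -> copen V -> U `&` V = set0 ->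
  tau (U `|` V) = (tau U * tau V)%g.
Proof.
move=> aUV coU coV UV.
have aU : adm U by apply: adm_sub aUV coU _; left.
have aV : adm V by apply: adm_sub aUV coV _; right.
have [cUV _] := aUV.
have nUV g : U g -> V g -> False.
  by move=> Ug Vg; have : (U `&` V) g by []; rewrite UV.
have sV g : U g -> ~ src V (gsrc g).
  move=> Ug [h Vh e]; apply: (nUV g) => //.
  by rewrite -(cob_src_inj cUV (or_intror Vh) (or_introl Ug) e).
have rV g : U g -> ~ rng V (grng g).
  move=> Ug [h Vh e]; apply: (nUV g) => //.
  by rewrite -(cob_rng_inj cUV (or_intror Vh) (or_introl Ug) e).
have sU g : V g -> ~ src U (gsrc g).
  move=> Vg [h Uh e]; apply: (nUV g) => //.
  by rewrite -(cob_src_inj cUV (or_introl Uh) (or_intror Vg) e).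
have rU g : V g -> ~ rng U (grng g).
  move=> Vg [h Uh e]; apply: (nUV g) => //.
  by rewrite -(cob_rng_inj cUV (or_introl Uh) (or_intror Vg) e).
have rsV g : U g -> ~ rng V (gsrc g).
  by move=> Ug [h Vh]; apply: (adm_neq aUV); [right|left].
have srV g : U g -> ~ src V (grng g).
  by move=> Ug [h Vh e]; apply: (adm_neq aUV (or_introl Ug) (or_intror Vh)).
have rsU g : V g -> ~ rng U (gsrc g).
  by move=> Vg [h Uh]; apply: (adm_neq aUV); [left|right].
have srU g : V g -> ~ src U (grng g).
  by move=> Vg [h Uh e]; apply: (adm_neq aUV (or_intror Vg) (or_introl Uh)).
apply: tauE => // [g [Ug|Vg]|g [Ug|Vg]|x nsx nrx] /=.
- by rewrite (tau_out aV) ?tau_src //; [exact: sV|exact: rsV].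
- by rewrite tau_src // tau_out //; [exact: srU|exact: rU].
- by rewrite (tau_out aV) ?tau_rng //; [exact: srV|exact: rV].
- by rewrite tau_rng // tau_out //; [exact: sU|exact: rsU].
have hV : ~ src V x /\ ~ rng V x.
  by split=> -[g Vg gx]; [apply: nsx|apply: nrx]; exists g => //; right.
have hU : ~ src U x /\ ~ rng U x.
  by split=> -[g Ug gx]; [apply: nsx|apply: nrx]; exists g => //; left.
by rewrite !tau_out //; case: hU; case: hV.
Qed.

Lemma graph_tau U g : adm U -> ~ range (@gid G) g ->
  graph (tau U) g <-> U g \/ inv_set U g.
Proof.
move=> aU ng; split=> [|[Ug|Ug]]; last 2 first.
- by rewrite /graph /= tau_src.
- by rewrite /graph /= -(grng_inv g) -(gsrc_inv g) tau_rng.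
rewrite /graph /=; have [[h Uh e]|nx] := pselect (src U (gsrc g)).
  rewrite -e tau_src // => r; left.
  by rewrite (arrow_unique (esym e) (esym r)).
have [[h Uh e]|nx'] := pselect (rng U (gsrc g)).
  rewrite -e tau_rng // => r; right; rewrite /inv_set /=.
  have -> // : ginv g = h.
  by apply: arrow_unique; rewrite ?gsrc_inv ?grng_inv.
by rewrite tau_out // => r; case: ng; apply: hp.
Qed.

Lemma ab_tauK U : adm U -> ab_class (tau U) + ab_class (tau U) = 0.
Proof. by move=> aU; rewrite -ab_class_mul tauK. Qed.

Lemma full_class_eq a b c : (c * a)%g = (b * c)%g -> ab_class a = ab_class b.
Proof.
move=> /(congr1 (@ab_class _)); rewrite !ab_class_mul [X in X = _]addrC.
by move/addIr.
Qed.

(** The subgroup generated by the classes of transpositions, which turns out to be the image of [j].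
    Sums suffice because each generator has order two. The default [set0] of [nth] is itself
    admissible, so [i] needs no bound. *)
Definition tau_class (u : abelianization (full_group G)) : Prop :=
  exists s : seq (set G),
    (forall i, adm (nth set0 s i)) /\ u = \sum_(U <- s) ab_class (tau U).

Lemma tau_class0 : tau_class 0.
Proof.
by exists [::]; split; rewrite ?big_nil // => i; rewrite nth_nil; exact: adm0.
Qed.

Lemma tau_classD u v : tau_class u -> tau_class v -> tau_class (u + v).
Proof.
move=> [s [sa ->]] [t [ta ->]]; exists (s ++ t); split; last by rewrite big_cat.
by move=> i; rewrite nth_cat; case: ifP.
Qed.

Lemma tau_class_tau U : adm U -> tau_class (ab_class (tau U)).
Proof.
move=> aU; exists [:: U]; split; last by rewrite big_seq1.
by case=> // i; rewrite /= nth_nil; exact: adm0.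
Qed.

Lemma tau_classK u : tau_class u -> u + u = 0.
Proof.
move=> [s [sa ->]]; elim: s sa => [|U s IH] sa; first by rewrite !big_nil addr0.
rewrite !big_cons addrACA ab_tauK; last exact: (sa 0%N).
by rewrite add0r IH // => i; exact: (sa i.+1).
Qed.

Lemma tau_classN u : tau_class u -> tau_class (- u).
Proof. by move=> tu; rewrite (addr0_eq (tau_classK tu)). Qed.

Lemma tau_classB u v : tau_class u -> tau_class v -> tau_class (u - v).
Proof. by move=> tu tv; apply/tau_classD/tau_classN. Qed.

End FullGroupElements.

(** * The homomorphism [j] *)

Section JMap.
Variables (R : realType) (G : cantor_groupoid R).
Hypothesis hp : principal G.
Hypothesis hm : minimal G.
Implicit Types (g h k : G) (x y : units G) (U V W D : set G).
Implicit Types (A B : set (units G)) (a b : full_group G).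
Implicit Types (u v : abelianization (full_group G)).

Let cl (U : set G) : abelianization (full_group G) := ab_class (tau U).

Lemma open_avoid (s : seq (units G)) : open [set x | x \notin s].
Proof.
elim: s => [|y s IH].
  by have -> : [set x : units G | x \notin [::]] = setT;
    [apply/seteqP; split|exact: openT].
have -> : [set x | x \notin y :: s] = ~` [set y] `&` [set x | x \notin s].
  apply/seteqP; split=> x /=; rewrite inE negb_or.
    by case/andP=> /eqP.
  by case=> /eqP -> ->.
apply: openI => //; apply: closed_openC.
by apply: compact_closed (@compact_set1 _ _); exact: units_hausdorff.
Qed.

(** The complement of a finite set is open, and nonempty because no point is isolated; the orbit of
    [x] is dense, so it meets that complement. *)
Lemma arrow_avoid x (s : seq (units G)) :
  exists g, gsrc g = x /\ grng g \notin s.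
Proof.
have [[x0 _] _ _ _ /perfectTP pf] := units_cantor G.
have key (t : seq (units G)) : [set z | z \notin t] !=set0.
  elim: t => [|y t IH]; first by exists x0.
  apply: contrapT => n0; apply: (pf y).
  have -> : [set y] = [set z | z \notin t].
    apply/seteqP; split=> [_ ->|z /= zt].
      have [z zt] := IH; rewrite /=; apply: contra_notN n0 => yt;
        exists z => /=.
      by rewrite inE negb_or zt andbT; apply: contraNN zt => /eqP->.
    apply: contrapT => zy; apply: n0; exists z => /=.
    by rewrite inE negb_or zt andbT; exact/eqP.
  exact: open_avoid.
have [z [zs [g gx gz]]] := hm x (key s) (open_avoid s).
by exists g; split=> //; rewrite gz.
Qed.

(** The conjugating element is [tau S] for [S] the product of [W] and the inverse of [U]: it
    exchanges the two ranges and fixes the common source. Disjointness of the ranges is what makes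
    [S] admissible. *)
Lemma tau_conj U W : adm U -> adm W -> src U = src W ->
  rng U `&` rng W = set0 -> cl U = cl W.
Proof.
move=> aU aW e UW; have [[cU dU] [cW dW]] := (aU, aW).
pose S := set_mul W (inv_set U).
have eS : src W = rng (inv_set U) by rewrite rng_inv_set.
have sS : src S = rng U by rewrite src_mul // src_inv_set.
have rS : rng S = rng W by rewrite rng_mul.
have aS : adm S.
  split; last by rewrite sS rS setIC.
  exact/compact_open_Gset_mul/cob_inv.
have rUW g h : U g -> W h -> grng g <> grng h.
  move=> Ug Wh r; suff : (rng U `&` rng W) (grng g) by rewrite UW.
  by split; [exists g|exists h].
have mate g h : U g -> W h -> gsrc g = gsrc h ->
    S (gmul h (ginv g)) /\ gsrc h = grng (ginv g).
  move=> Ug Wh s; split; last by rewrite grng_inv.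
  exists h, (ginv g); split; rewrite ?grng_inv //.
  by rewrite /inv_set /= ginvK.
have Sr g h : U g -> W h -> gsrc g = gsrc h -> tau S (grng g) = grng h.
  move=> Ug Wh s; have [Sm em] := mate g h Ug Wh s.
  by have := tau_src aS Sm; rewrite gsrc_mul // grng_mul // gsrc_inv.
have Ss g h : U g -> W h -> gsrc g = gsrc h -> tau S (grng h) = grng g.
  move=> Ug Wh s; have [Sm em] := mate g h Ug Wh s.
  by have := tau_rng aS Sm; rewrite gsrc_mul // grng_mul // gsrc_inv.
have SrcU g : U g -> tau S (gsrc g) = gsrc g.
  move=> Ug; have [h Wh hg] : src W (gsrc g) by rewrite -e; exists g.
  apply: (tau_out aS); first by rewrite sS => -[k Uk]; exact: adm_neq aU Uk Ug.
  by rewrite rS -hg => -[k Wk]; exact: adm_neq aW Wk Wh.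
apply: (@full_class_eq _ _ _ _ (tau S)); apply: full_group_ext => x /=.
have [[g Ug <-]|nx] := pselect (src U x).
  have [h Wh hg] : src W (gsrc g) by rewrite -e; exists g.
  by rewrite tau_src // (Sr g h) // SrcU // -hg tau_src.
have [[g Ug <-]|nx'] := pselect (rng U x).
  have [h Wh hg] : src W (gsrc g) by rewrite -e; exists g.
  by rewrite tau_rng // (Sr g h) // SrcU // tau_rng.
have nWx : ~ src W x by rewrite -e.
have [[h Wh hx]|nx''] := pselect (rng W x).
  have [g Ug hg] : src U (gsrc h) by rewrite e; exists h.
  rewrite (tau_out aU) // -hx (Ss g h) // tau_out //.
    by rewrite -e => -[k Uk /esym]; exact: adm_neq aU Ug Uk.
  by move=> [k Wk /esym]; exact: rUW.
by rewrite !tau_out // ?sS ?rS.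
Qed.

Lemma restr_adm U A : adm U -> clopen A -> adm (restr U A).
Proof.
move=> aU cA; apply: (adm_sub aU); last by move=> g [].
by apply/cob_copen/cob_restr => //; case: aU.
Qed.

Lemma restr_src U : restr U (src U) = U.
Proof. by apply/seteqP; split=> [g []//|g Ug]; split=> //; exists g. Qed.

Lemma restrU U A B : restr U (A `|` B) = restr U A `|` restr U B.
Proof. by rewrite /restr preimage_setU setIUr. Qed.

Lemma cl_restrU U A B : adm U -> clopen A -> clopen B -> A `&` B = set0 ->
  cl (restr U (A `|` B)) = cl (restr U A) + cl (restr U B).
Proof.
move=> aU cA cB AB; rewrite /cl restrU tauU ?ab_class_mul //.
- by rewrite -restrU; apply: restr_adm => //; exact: clopenU.
- by have [/cob_copen] := restr_adm aU cA.
- by have [/cob_copen] := restr_adm aU cB.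
apply/seteqP; split=> // g [[_ Ag] [_ Bg]].
by have : (A `&` B) (gsrc g) by []; rewrite AB.
Qed.

(** The third bisection [W] is taken around an arrow out of [x] whose range differs from [x] and
    from the ranges of [u] and [v]; [tau_conj] then compares both [U] and [V] with it. *)
Lemma tau_same_locally U V x : adm U -> adm V -> src U x -> src V x ->
  exists N, [/\ clopen N, N x & forall B, clopen B -> B `<=` N ->
    cl (restr U B) = cl (restr V B)].
Proof.
move=> aU aV [u Uu ux] [v Vv vx].
have [w [wx wn]] := arrow_avoid x [:: x; grng u; grng v].
have [|C [cC Cw CN]] := @units_clopen_nbhs _ G (grng w)
    [set z | z \notin [:: x; grng u; grng v]].
  by apply: open_nbhs_nbhs; split=> //; exact: open_avoid.
have nC z : z \in [:: x; grng u; grng v] -> ~ C z.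
  by move=> zin /CN /=; rewrite zin.
have [W [cW Ww WC]] := cob_nbhs_clopen (grng_preimage_clopen cC) Cw.
have cCC : clopen (~` C) := clopenC set0 cC.
(* Sources of the arrows of [Z] that end outside [C]. Over them [Z] ends outside [C] while [W] ends
   inside, so the two ranges are disjoint. *)
pose T (Z : set G) := src (Z `&` @grng G @^-1` ~` C).
have cT Z : adm Z -> clopen (T Z).
  move=> [cZ _]; apply/src_clopen/cob_copen/cobI => //.
  exact: grng_preimage_clopen.
exists (src W `&` ~` C `&` T U `&` T V); split.
- do 3![apply: clopenI; last by [|exact: cT]].
  exact/src_clopen/cob_copen.
- split; last by exists v => //; split=> //; apply: nC; rewrite !inE eqxx !orbT.
  split; last by exists u => //; split=> //; apply: nC; rewrite !inE eqxx !orbT.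
  by split; [exists w|apply: nC; rewrite inE eqxx].
move=> B cB BN.
have BW : src (restr W B) = B.
  by rewrite src_restr; apply/setIidr => z /BN[[[]]].
have rW : rng (restr W B) `<=` C by move=> _ [g [/WC Cg _] <-].
have aW : adm (restr W B).
  split; first exact: cob_restr.
  by rewrite BW; apply/seteqP; split=> // z [/rW Cz /BN[[[_ /(_ Cz)]]]].
have key Z : adm Z -> B `<=` T Z -> cl (restr Z B) = cl (restr W B).
  move=> aZ BZ; have [cZ _] := aZ.
  apply: tau_conj => //; first exact: restr_adm.
    by rewrite BW src_restr; apply/setIidr => z /BZ[g [Zg _] <-]; exists g.
  apply/seteqP; split=> // _ [[g [Zg Bg] <-] /rW Cg].
  have [g' [Zg' nCg'] s] := BZ _ Bg.
  by apply: nCg'; rewrite /= (cob_src_inj cZ Zg' Zg s).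
by rewrite !key // => z /BN[[]].
Qed.

(* Any two choices of [U] with a given source are compared locally with a third
   one whose range avoids both, using that orbits are infinite. *)
Lemma tau_same U V : adm U -> adm V -> src U = src V -> cl U = cl V.
Proof.
move=> aU aV e; rewrite -(restr_src U) -(restr_src V) -e.
apply: (@clopen_units_ind _ _ (fun B => cl (restr U B) = cl (restr V B))).
- by rewrite /restr preimage_set0 !setI0.
- by move=> A B cA cB AB _ _ eA eB; rewrite !cl_restrU // eA eB.
- by apply/src_clopen/cob_copen; case: aU.
move=> x sx; have [|N [cN Nx NP]] := tau_same_locally aU aV sx.
  by rewrite -e.
by exists N; split=> // B cB BN _; exact: NP.
Qed.

(* [u] is the value which one choice of bisections gives to [j] on the class of
   the indicator of [A]. *)
Inductive fam : set (units G) -> abelianization (full_group G) -> Prop :=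
| fam0 : fam set0 0
| famS U A u : adm U -> fam A u -> src U `&` A = set0 ->
    fam (src U `|` A) (cl U + u).

Lemma adm_src_clopen U : adm U -> clopen (src U).
Proof. by move=> [cU _]; exact/src_clopen/cob_copen. Qed.

Lemma fam_clopen A u : fam A u -> clopen A.
Proof.
elim=> [|U B v aU _ cB _]; first exact: clopen0.
by apply: clopenU => //; exact: adm_src_clopen.
Qed.

Lemma fam_cat A u B v : fam A u -> fam B v -> A `&` B = set0 ->
  fam (A `|` B) (u + v).
Proof.
move=> fA fB; elim: fA => [|U A' u' aU fA' IH UA] AB.
  by rewrite set0U add0r.
rewrite -setUA -addrA; apply: famS => //.
  by apply: IH; rewrite -subset0 -AB => z [? ?]; split=> //; right.
rewrite -subset0 => z [Uz [Az|Bz]]; first by rewrite -UA.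
by rewrite -AB; split=> //; left.
Qed.

Lemma fam_adm U : adm U -> fam (src U) (cl U).
Proof.
move=> aU; rewrite -[src U]setU0 -[cl U]addr0; apply: famS => //.
  exact: fam0.
by rewrite setI0.
Qed.

Lemma fam_split A u B : fam A u -> clopen B ->
  exists v w, [/\ fam (A `&` B) v, fam (A `\` B) w & u = v + w].
Proof.
move=> fA cB; elim: fA => [|U A' u' aU fA' [v [w [fv fw ->]]] UA].
  by exists 0, 0; rewrite set0I set0D addr0; split=> //; exact: fam0.
have cB' := clopenC set0 cB.
exists (cl (restr U B) + v), (cl (restr U (~` B)) + w); split.
- rewrite setIUl -src_restr; apply: famS => //; first exact: restr_adm.
  by rewrite src_restr -subset0 -UA => z [[? ?] []].
- rewrite setDUl [src U `\` B]setDE -src_restr; apply: famS => //.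
    exact: restr_adm.
  by rewrite src_restr -subset0 -UA => z [[? ?] []].
rewrite addrACA -cl_restrU // ?setICr // setUv.
by rewrite (_ : restr U setT = U) // /restr preimage_setT setIT.
Qed.

(** Cut [U] along the sources of the pieces of the family; on each piece the two bisections have the
    same source and [tau_same] applies. *)
Lemma fam_adm_unique U u : adm U -> fam (src U) u -> u = cl U.
Proof.
move=> aU; move e : (src U) => A fA;
  elim: fA U aU e => [U aU e|V A' u' aV fA' IH VA U aU e].
  rewrite /cl (_ : U = set0) ?tau0 //; apply/seteqP; split=> // g Ug.
  by have : src U (gsrc g) by [exists g]; rewrite e.
have cV := adm_src_clopen aV; have cA := fam_clopen fA'.
rewrite -(restr_src U) e cl_restrU //; congr (_ + _).
  apply: tau_same => //; first exact: restr_adm.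
  by rewrite src_restr e setIUl setIid [A' `&` _]setIC VA setU0.
apply: IH; first exact: restr_adm.
by rewrite src_restr e setIUl setIid VA set0U.
Qed.

(** By induction on the first family: the second is cut along the source of its first piece, where
    the previous lemma compares, and the rest is left to the induction hypothesis. *)
Lemma fam_unique A u v : fam A u -> fam A v -> u = v.
Proof.
move=> fA; elim: fA v => [v|U A' u' aU fA' IH UA v fv].
  move e : set0 => B fv; elim: fv e => // U A' u' aU _ IH _ e.
  have e0 : src U = set0 by rewrite -subset0 e; left.
  have e1 : set0 = A' by apply/esym; rewrite -subset0 e; right.
  rewrite -(IH e1) addr0 /cl (_ : U = set0) ?tau0 //.
  apply/seteqP; split=> // g Ug.
  by have : src U (gsrc g) by [exists g]; rewrite e0.
have [v1 [v2 [f1 f2 ->]]] := fam_split fv (adm_src_clopen aU).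
have e1 : (src U `|` A') `&` src U = src U by rewrite setUK.
have e2 : (src U `|` A') `\` src U = A'.
  by rewrite setDUl setDv set0U; apply/setDidPl; rewrite setIC.
rewrite e1 in f1; rewrite e2 in f2.
by rewrite (IH _ f2) (fam_adm_unique aU f1).
Qed.

Lemma small_adm g : grng g <> gsrc g -> exists2 U, adm U & U g.
Proof.
move=> ng.
have [|C [cC Cg CN]] := @units_clopen_nbhs _ G (grng g)
    [set z | z \notin [:: gsrc g]].
  apply: open_nbhs_nbhs; split; first exact: open_avoid.
  by rewrite /= inE; apply/eqP.
have nC : ~ C (gsrc g) by move=> /CN /=; rewrite inE eqxx.
have [U [cU Ug UC]] := cob_nbhs_clopen (clopenI (grng_preimage_clopen cC)
  (gsrc_preimage_clopen (clopen_setC cC))) (conj Cg nC).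
exists U => //; split=> //;
  rewrite -subset0 => _ [[h /UC[Ch _] <-] [k /UC[_ nCk] e]].
by apply: nCk; rewrite /= e.
Qed.

Lemma fam_exists A : clopen A -> exists u, fam A u.
Proof.
move=> cA; apply: (@clopen_units_ind _ G (fun A => exists u, fam A u)) => //.
- by exists 0; exact: fam0.
- by move=> B C _ _ BC _ _ [u fu] [v fv]; exists (u + v); exact: fam_cat.
move=> x _; have [g [gx gn]] := arrow_avoid x [:: x].
have [|U aU Ug] := @small_adm g.
  by rewrite gx => e; move: gn; rewrite e inE eqxx.
exists (src U); split; [exact: adm_src_clopen|by exists g|].
move=> B cB BU _; exists (cl (restr U B)).
have {1}-> : B = src (restr U B) by rewrite src_restr; apply/esym/setIidr.
exact/fam_adm/restr_adm.
Qed.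

Lemma fam2 A u : fam A u -> u + u = 0.
Proof.
elim=> [|U B v aU _ IH _]; first exact: addr0.
by rewrite addrACA IH ab_tauK // addr0.
Qed.

Lemma fam_tau_class A u : fam A u -> tau_class u.
Proof.
elim=> [|U B v aU _ IH _]; first exact: tau_class0.
by apply: tau_classD => //; exact: tau_class_tau.
Qed.

Definition fam_val A : abelianization (full_group G) :=
  xget 0 [set u | fam A u].

Lemma fam_valP A : clopen A -> fam A (fam_val A).
Proof.
by move=> /fam_exists[u fu]; rewrite /fam_val; case: xgetP => [v _ //|/(_ u)].
Qed.

Lemma fam_valE A u : fam A u -> fam_val A = u.
Proof.
by move=> fu; apply: (fam_unique _ fu); exact/fam_valP/(fam_clopen fu).
Qed.

Lemma fam_valU A B : clopen A -> clopen B -> A `&` B = set0 ->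
  fam_val (A `|` B) = fam_val A + fam_val B.
Proof. by move=> cA cB AB; apply/fam_valE/fam_cat => //; exact: fam_valP. Qed.

(** The intersection is counted twice on the right, and twice any value is zero. As symmetric
    difference is addition of indicators modulo 2, this is what makes [phi] additive. *)
Lemma fam_val_symdiff A B : clopen A -> clopen B ->
  fam_val ((A `\` B) `|` (B `\` A)) = fam_val A + fam_val B.
Proof.
move=> cA cB; have cAB := clopenI cA cB.
have cD (C D : set (units G)) : clopen C -> clopen D -> clopen (C `\` D).
  by move=> cC cD; rewrite setDE; apply/clopenI/clopenC.
have E (C D : set (units G)) : clopen C -> clopen D ->
    fam_val C = fam_val (C `\` D) + fam_val (C `&` D).
  move=> cC cD'; rewrite -fam_valU; last 3 first.
  - exact: cD.
  - exact: clopenI.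
  - by rewrite -subset0 => z [[_ nz] []].
  by congr fam_val; rewrite setUC setUIDK.
rewrite (E A B) // (E B A) // [B `&` A]setIC addrACA (fam2 (fam_valP cAB)) addr0.
apply: fam_valU; [exact: cD|exact: cD|].
by rewrite -subset0 => z [[? ?] []].
Qed.

Definition odd_set (f : units G -> int) : set (units G) :=
  [set x | ~~ (2 %| f x)%Z].

Definition phi (f : units G -> int) := fam_val (odd_set f).

Lemma odd_set_clopen (f : Cc (units G)) : clopen (odd_set f).
Proof. exact: (Cc_level_clopen f [set z | ~~ (2 %| z)%Z]). Qed.

Lemma odd_setD (f g : units G -> int) : odd_set (fun x => f x + g x) =
  (odd_set f `\` odd_set g) `|` (odd_set g `\` odd_set f).
Proof.
have E (a b : int) :
    ~~ (2 %| a + b)%Z = (~~ (2 %| a)%Z (+) ~~ (2 %| b)%Z) by lia.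
apply/seteqP; split=> x; rewrite /odd_set /= E;
  case: (2 %| f x)%Z; case: (2 %| g x)%Z => //=; try by [left|right].
- by move=> [[]|[]].
- by move=> [[]|[]].
Qed.

Lemma phiD (f g : Cc (units G)) : phi (f + g) = phi f + phi g.
Proof.
rewrite /phi -fam_val_symdiff; try exact: odd_set_clopen.
by rewrite -odd_setD.
Qed.

Lemma phiN (f : units G -> int) : phi (fun x => - f x) = phi f.
Proof.
have E (a : int) : (2 %| - a)%Z = (2 %| a)%Z by lia.
by congr fam_val; apply/seteqP; split=> x; rewrite /odd_set /= E.
Qed.

Lemma phiK (f : Cc (units G)) : phi f + phi f = 0.
Proof. exact/fam2/fam_valP/odd_set_clopen. Qed.

Lemma odd_set_ind A : odd_set (ind A) = A.
Proof.
apply/seteqP; split=> x; rewrite /odd_set /=.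
  by have [//|nAx] := pselect (A x); rewrite indF.
by move=> Ax; rewrite indT.
Qed.

Lemma odd_set0 : odd_set 0 = set0.
Proof. by apply/seteqP; split. Qed.

Lemma phi0 : phi 0 = 0.
Proof. by rewrite /phi odd_set0; apply/fam_valE; exact: fam0. Qed.

(** Near a unit, source and range coincide. Near any other arrow the bisection is admissible, and it
    defines the same transposition as its inverse, whose source is its range. *)
Lemma phi_src_rng U : compact_open_Gset U ->
  fam_val (src U) = fam_val (rng U).
Proof.
move=> cU; suff key D :
  copen D -> D `<=` U -> fam_val (src D) = fam_val (rng D).
  by apply: key => //; exact: cob_copen.
move=> coD DU.
have cDE E : copen E -> E `<=` D -> compact_open_Gset E.
  by move=> coE ED; apply: (cob_sub cU coE) => g /ED/DU.
have ssrc E : copen E -> clopen (src E) by exact: src_clopen.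
have srng E : copen E -> clopen (rng E) by exact: rng_clopen.
apply: (copen_ind (@arrows_hausdorff G)
  (P := fun E => fam_val (src E) = fam_val (rng E))) => //.
- by rewrite /src /rng !image_set0.
- move=> A B coA coB AB AD BD eA eB.
  have -> : src (A `|` B) = src A `|` src B by exact: image_setU.
  have -> : rng (A `|` B) = rng A `|` rng B by exact: image_setU.
  rewrite fam_valU; [|exact: ssrc|exact: ssrc|]; last first.
    rewrite -subset0 => _ [[g Ag <-] [h Bh e]].
    have gh : g = h := cob_src_inj cU (DU _ (AD _ Ag)) (DU _ (BD _ Bh)) (esym e).
    have : (A `&` B) g by split; rewrite // gh.
    by rewrite AB.
  rewrite fam_valU; [|exact: srng|exact: srng|]; last first.
    rewrite -subset0 => _ [[g Ag <-] [h Bh e]].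
    have gh : g = h := cob_rng_inj cU (DU _ (AD _ Ag)) (DU _ (BD _ Bh)) (esym e).
    have : (A `&` B) g by split; rewrite // gh.
    by rewrite AB.
  by rewrite eA eB.
move=> g Dg; have [[x _ gx]|ng] := pselect (range (@gid G) g).
  exists (range (@gid G)); split; [exact/gid_copen/clopenT|by exists x|].
  move=> B coB Bgid _; congr fam_val; apply/seteqP; split=> _ [h Bh <-];
    have [z _ zh] := Bgid _ Bh; exists h => //; by rewrite -zh gsrc_id grng_id.
have [|V aV Vg] := @small_adm g; first by move/hp.
have [cV _] := aV; exists V; split=> //; first exact: cob_copen.
move=> B coB BV _; have aB := adm_sub aV coB BV.
rewrite (fam_valE (fam_adm aB)) -src_inv_set (fam_valE (fam_adm (adm_inv aB))).
by rewrite /cl tau_inv.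
Qed.

(** [boundary1 h] is a bare function; the element [f] of [Cc] representing it is produced along the
    same induction that shows [phi] to vanish on it. *)
Lemma phi_boundary (h : Cc G) : exists2 f : Cc (units G),
  f = boundary1 h :> (units G -> int) & phi f = 0.
Proof.
pose P (h : Cc G) := exists2 f : Cc (units G),
  f = boundary1 h :> (units G -> int) & phi f = 0.
apply: (Cc_ind (@arrows_hausdorff G) (P := P) (f := h)).
- by exists 0; [rewrite boundary1_0|exact: phi0].
- move=> h1 h2 [f1 e1 z1] [f2 e2 z2]; exists (f1 + f2);
    last by rewrite phiD z1 z2 addr0.
  by rewrite boundary1D -e1 -e2.
move=> g _; have [N [cN Ng _]] := cob_nbhs (@filterT _ (nbhs g) _).
exists N; split=> //; first exact: cob_copen.
move=> B coB BN; have cB := cob_sub cN coB BN.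
have hX := @units_hausdorff G.
have [f ef zf] : exists2 f : Cc (units G),
    f = boundary1 (indc B) :> (units G -> int)
    & phi f = 0.
  have cs := clopen_copen (src_clopen coB);
    have cr := clopen_copen (rng_clopen coB).
  exists (indc (src B) - indc (rng B)).
    by rewrite boundary1_ind // -(indcE hX cs) -(indcE hX cr).
  have -> : phi (indc (src B) - indc (rng B) : Cc _) =
      phi (indc (src B)) + phi (indc (rng B)).
    by rewrite phiD (_ : phi (- _) = phi (indc (rng B))) //; exact: phiN.
  rewrite /phi (indcE hX cs) (indcE hX cr) !odd_set_ind phi_src_rng //.
  exact/fam2/fam_valP/rng_clopen.
split; first by exists f.
exists (- f); first by rewrite boundary1N -ef.
by rewrite (_ : phi (- f) = phi f) //; exact: phiN.
Qed.

End JMap.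

(** * Maps out of quotients and tensor products *)

Section QuotientLift.
Variables (V W : zmodType) (I : zmodClosed V) (f : V -> W).
Hypothesis fB : forall u v, f (u - v) = f u - f v.
Hypothesis fI : forall u, u \in I -> f u = 0.

Lemma quot_lift : exists g : Quotient.quot I -> W,
  (forall v, g (\pi_(Quotient.quot I) v)%qT = f v) /\
  forall s t, g (s - t) = g s - g t.
Proof.
have gE v : f (repr (\pi_(Quotient.quot I) v)%qT) = f v.
  apply/eqP; rewrite -subr_eq0 -fB; apply/eqP/fI.
  by rewrite Quotient.idealrBE reprK.
exists (fun t => f (repr t)); split=> // s t.
rewrite -[s]reprK -[t]reprK -fB.
have -> : (\pi_(Quotient.quot I) (repr s) - \pi_(Quotient.quot I) (repr t))%qT =
   \pi_(Quotient.quot I)%qT (repr s - repr t) by rewrite !piE.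
by rewrite gE !reprK.
Qed.

End QuotientLift.

Section TensorLift.
Variables (A B W : zmodType) (beta : A -> B -> W).
Hypothesis betaDl : forall a a' b, beta (a + a') b = beta a b + beta a' b.
Hypothesis betaDr : forall a b b', beta a (b + b') = beta a b + beta a b'.

Lemma tensor_lift : exists g : tensor A B -> W,
  (forall a b, g (tensor_pure a b) = beta a b) /\
  forall s t, g (s - t) = g s - g t.
Proof.
(* [zmodule] views the abelian group [W] as a module over the integers, the target required by
   [fglift]. *)
pose F : {freeg (A * B) / int} -> zmodule W :=
  fglift (fun ab : A * B => beta ab.1 ab.2 : zmodule W).
have FB u v : F (u - v) = F u - F v by exact: lift_is_additive.
have FU a b : F << (a, b) >> = beta a b.
  by rewrite /F liftU scale1r.
have F0 : F 0 = 0 by have := FB 0 0; rewrite !subrr.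
have [|g [gE gB]] := @quot_lift _ W (GRing.ZmodClosed.clone _ (@tensor_null A B) _) F FB.
  move=> w /asboolP /(_ [set w | F w = 0]); apply=> //= [u v Fu Fv|w' [|]].
  - by rewrite FB Fu Fv subrr.
  - by case=> [a [a' [b ->]]]; rewrite /= !FB !FU betaDl addrAC addrK subrr.
  - by case=> [a [b [b' ->]]]; rewrite /= !FB !FU betaDr addrAC addrK subrr.
by exists g; split=> // a b; rewrite /tensor_pure gE FU.
Qed.

Lemma tensor_ind (P : tensor A B -> Prop) t : P 0 ->
  (forall u v, P u -> P v -> P (u - v)) ->
  (forall a b, P (tensor_pure a b)) -> P t.
Proof.
move=> P0 PB Pp.
have PN u : P u -> P (- u) by rewrite -[- u]add0r; exact: PB.
have PD u v : P u -> P v -> P (u + v) by move=> Pu /PN; rewrite -{2}[v]opprK;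
  exact: PB.
have piB (u v : {freeg (A * B) / int}) : (\pi_(tensor A B) (u - v))%qT =
    (\pi_(tensor A B) u)%qT - (\pi_(tensor A B) v)%qT by rewrite !piE.
have pi0 : (\pi_(tensor A B) 0)%qT = 0 by have := piB 0 0; rewrite !subrr.
have piN (v : {freeg (A * B) / int}) : (\pi_(tensor A B) (- v))%qT =
    - (\pi_(tensor A B) v)%qT by rewrite -[- v]add0r piB pi0 add0r.
have piD (u v : {freeg (A * B) / int}) : (\pi_(tensor A B) (u + v))%qT =
    (\pi_(tensor A B) u)%qT + (\pi_(tensor A B) v)%qT.
  by rewrite -{1}[v]opprK piB piN opprK.
rewrite -[t]reprK -[X in P (\pi X)%qT]freeg_sumE.
elim/big_rec: _ => [|[a b] w _ Pw]; first by rewrite pi0.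
rewrite piD; apply: (PD) => //; set z := coeff _ _.
have Pn n : P (\pi_(tensor A B) (<< (a, b) >> *+ n))%qT.
  elim: n => [|n IH]; first by rewrite mulr0n pi0.
  by rewrite mulrS piD; apply: PD => //; exact: Pp.
have -> : << z *g (a, b) >> = << (a, b) >> *~ z :> {freeg (A * B) / int}.
  by rewrite freeg_mulz intz.
by case: z => n; rewrite ?NegzE ?mulrNz -?pmulrn ?piN //; exact: PN.
Qed.

End TensorLift.

(** * Construction of [j] *)

Section JExists.
Variables (R : realType) (G : cantor_groupoid R).
Hypothesis hp : principal G.
Hypothesis hm : minimal G.

(** [phi] kills boundaries, and it is compatible with differences because its values are their own
    opposites. *)
Lemma homology0_lift : exists g : homology0 G -> abelianization (full_group G),
  (forall f, g (homology0_class f) = phi f) /\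
  forall s t, g (s - t) = g s - g t.
Proof.
have phiB (f g : Cc (units G)) : phi (f - g : Cc _) = phi f - phi g.
  rewrite (phiD hm) (_ : phi (- g : Cc _) = phi g); last exact: phiN.
  by congr (_ + _); apply/esym/addr0_eq/(phiK hm).
have [|g [gE gB]] := @quot_lift _ _ (GRing.ZmodClosed.clone _ (@is_boundary0 G) _)
  (fun f : Cc (units G) => phi f) phiB.
  move=> f /asboolP[h e]; have [f' e' z] := phi_boundary hp hm h.
  by rewrite -z; congr phi; rewrite e' -e.
by exists g; split.
Qed.

Definition fam_choice A (u : abelianization (full_group G)) :=
  exists n (U : 'I_n -> set G), [/\ forall i, adm (U i),
    trivIset setT (fun i => src (U i)), \bigcup_i src (U i) = A &
    u = \sum_(i < n) ab_class (tau (U i))].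

Lemma fam_choiceP A u : fam A u -> fam_choice A u.
Proof.
move=> fA; suff [n [U [aU tU bU ->]]] : exists n (U : nat -> set G),
    [/\ forall i, adm (U i), trivIset `I_n (fun i => src (U i)),
    \bigcup_(i in `I_n) src (U i) = A &
    u = \sum_(i < n) ab_class (tau (U i))].
  exists n, (fun i : 'I_n => U i); split=> //.
    by move=> i j _ _ /(tU _ _ (ltn_ord i) (ltn_ord j))/val_inj.
  rewrite -bU; apply/seteqP; split=> x [i ni Ux]; first by exists i => //=.
  by exists (Ordinal ni).
elim: fA => [|U B v aU fB [n [V [aV tV bV ->]]] UB].
  exists 0%N, (fun _ => set0); split; rewrite ?big_ord0 //.
  - by move=> i; exact: adm0.
  - by apply/seteqP; split=> x // [].
exists n.+1, (fun i => if i is j.+1 then V j else U); split.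
- by case.
- have disj j : (j < n)%N -> src U `&` src (V j) = set0.
    by move=> jn; rewrite -subset0 -UB -bV => x [Ux Vx]; split=> //; exists j.
  move=> [|i] [|j] //= ni nj; first by rewrite disj // => -[].
    by rewrite setIC disj // => -[].
  by move=> /(tV _ _ ni nj) ->.
- rewrite -bV; apply/seteqP; split=> x.
    by move=> [[|i] ni Ux]; [left|right; exists i].
  by move=> [Ux|[i ni Vx]]; [exists 0%N|exists i.+1].
by rewrite big_ord_recl.
Qed.

Lemma j_exists :
  exists j : tensor (homology0 G) 'Z_2 -> abelianization (full_group G),
  [/\ is_j_map j, forall s t, j (s - t) = j s - j t,
      forall t, tau_class (j t) & two_divisible (homology0 G) ->
        forall t, j t = 0].
Proof.
have [g [gE gB]] := homology0_lift.
have g0 : g 0 = 0 by have := gB 0 0; rewrite !subrr.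
have gD s t : g (s + t) = g s + g t.
  have gN u : g (- u) = - g u by rewrite -[- u]add0r gB g0 add0r.
  by rewrite -{1}[t]opprK gB gN opprK.
have gc (s : homology0 G) : exists f, s = homology0_class f.
  by exists (repr s); rewrite /homology0_class reprK.
have g2 s : g s + g s = 0 by have [f ->] := gc s; rewrite gE; exact: phiK.
have [||j [jE jB]] := @tensor_lift (homology0 G) 'Z_2 _
    (fun a (b : 'Z_2) => g a *+ (b : nat)).
- by move=> a a' b; rewrite gD mulrnDl.
- move=> a b b'; rewrite -mulrnDr; case: b b' => [[|[|//]] ?] [[|[|//]] ?] //=.
  by rewrite mulr0n mulr2n g2.
have j0 : j 0 = 0 by have := jB 0 0; rewrite !subrr.
exists j; split=> //.
- move=> f; have cf := odd_set_clopen f; split.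
    have [n [U [aU tU bU _]]] := fam_choiceP (fam_valP hm cf).
    exists n, U, (fun i => tau (U i)); split=> //.
    + by move=> i; have [] := aU i.
    + by move=> i; have [] := aU i.
    + by move=> i; exact: adm_src_clopen.
    + by move=> i; exact: tauP.
  move=> n U t [cU dU _ trU bU tU]; rewrite jE gE mulr1n ab_class_prod.
  have aU i : adm (U i) by split; [exact: cU|exact: dU].
  rewrite /phi -[odd_set f]bU.
  under eq_bigr => i _ do rewrite (is_tauE (tU i) (aU i)).
  apply: (fam_valE hm).
  (* [fam] adds one piece at a time, so the claim is generalised from all indices to duplicate-free
     lists of indices. *)
  have key (r : seq 'I_n) : uniq r -> fam (\bigcup_(i in [set` r]) src (U i))
      (\sum_(i <- r) ab_class (tau (U i))).
    elim: r => [_|i r IH /= /andP[ir ur]].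
      rewrite big_nil (_ : \bigcup_(i in _) _ = set0); first exact: fam0.
      by rewrite -subset0 => x [].
    have -> : \bigcup_(k in [set` i :: r]) src (U k) =
        src (U i) `|` \bigcup_(k in [set` r]) src (U k).
      apply/seteqP; split=> x.
        move=> [k /=]; rewrite inE => /orP[/eqP->|kr] Ux; first by left.
        by right; exists k.
      move=> [Ux|[k /= kr Ux]]; first by exists i => //=; rewrite mem_head.
      by exists k => //=; rewrite inE kr orbT.
    rewrite big_cons; apply: famS => //; first exact: IH.
    rewrite -subset0 => x [Ux [k /= kr Vx]].
    have /(_ I I) ik := trU i k.
    by move: ir; rewrite ik ?kr //; exists x.
  have := key (index_enum 'I_n) (index_enum_uniq _).
  congr fam; apply/seteqP; split=> x [i _ Ux]; exists i => //=.
  exact: mem_index_enum.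
- move=> t; apply: (tensor_ind (P := fun t => tau_class (j t))).
  + by rewrite j0; exact: tau_class0.
  + by move=> u v tu tv; rewrite jB; exact: tau_classB.
  move=> a b; rewrite jE; have [f ->] := gc a; rewrite gE.
  have tf : tau_class (phi f).
    exact: (fam_tau_class (fam_valP hm (odd_set_clopen f))).
  by elim: (b : nat) => [|n IH]; [exact: tau_class0|rewrite mulrS;
    exact: tau_classD].
- move=> h2 t; apply: (tensor_ind (P := fun t => j t = 0)) => //.
    by move=> u v ju jv; rewrite jB ju jv subrr.
  by move=> a b; rewrite jE; have [c ->] := h2 a; rewrite mulr2n gD g2 mul0rn.
Qed.

End JExists.

(** * Matchings inside compact open sets of arrows *)

Section Matching.
Variables (R : realType) (G : cantor_groupoid R).
Implicit Types (g h k : G) (x y : units G) (U V W D : set G).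
Implicit Types (A B : set (units G)).

Lemma fibre_finite D x : compact D -> finite_set [set g | D g /\ gsrc g = x].
Proof.
move=> /compact_subset_copen[E coE DE].
have := Cc_fibre_finite (indc E) x (@gsrc_locally_injective G).
apply: sub_finite_set => g [/DE Eg gx]; split=> //=.
by rewrite indcE ?indT //; exact: arrows_hausdorff.
Qed.

(** Go through a finite cover of [D] by bisections, each time adding the arrows whose source and
    range are both still free. Every arrow of [D] gets its turn, so at the end it is blocked at one
    of its two ends or belongs to [P]. *)
Lemma greedy_matching D : copen D ->
  exists P, [/\ compact_open_Gset P, P `<=` D &
  forall g, D g -> src P (gsrc g) \/ rng P (grng g)].
Proof.
move=> coD; have [s [N [cN DN]]] := cob_cover coD.1.
suff [P [cP PD sP]] : exists P, [/\ compact_open_Gset P, P `<=` D &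
    forall g, D g -> (exists2 h, h \in s & N h g) ->
      src P (gsrc g) \/ rng P (grng g)].
  by exists P; split=> // g Dg; apply: sP => //; exact: DN.
elim: s {DN} => [|h s [P [cP PD sP]]].
  exists set0; split=> // [|g _ []//].
  by apply: cobP => //; exact: copen0.
have csP := src_clopen (cob_copen cP); have crP := rng_clopen (cob_copen cP).
pose Q := N h `&` D `&` (@gsrc G @^-1` (~` src P)) `&` (@grng G @^-1` (~` rng P)).
have cQ : compact_open_Gset Q.
  apply: cobI; last by apply: grng_preimage_clopen; exact: clopen_setC.
  apply: cobI; last by apply: gsrc_preimage_clopen; exact: clopen_setC.
  by apply: cobI; [exact: cN|exact: copen_arrows_clopen].
have sQ : src P `&` src Q = set0.
  by rewrite -subset0 => x [Px [g [[_ nP] _] gx]]; apply: nP; rewrite /= gx.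
have rQ : rng P `&` rng Q = set0.
  by rewrite -subset0 => x [Px [g [_ nP] gx]]; apply: nP; rewrite /= gx.
exists (P `|` Q); split; first exact: cobU.
  by move=> g [/PD//|[[[_ ?] _] _]].
have sPQ g : src P (gsrc g) \/ rng P (grng g) ->
    src (P `|` Q) (gsrc g) \/ rng (P `|` Q) (grng g).
  by move=> [[u Pu e]|[u Pu e]]; [left|right]; exists u => //; left.
move=> g Dg [k]; rewrite inE => /orP[/eqP-> Nhg|ks Nkg]; last first.
  by apply/sPQ/sP => //; exists k.
have [sg|nsg] := pselect (src P (gsrc g)); first by apply: sPQ; left.
have [rg|nrg] := pselect (rng P (grng g)); first by apply: sPQ; right.
by left; exists g => //; right.
Qed.

(* Hall's condition in the only case needed: all vertices competing for the
   targets [T] of [x] lie in [S], and [S] is not larger than [T]. *)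
Lemma matching D A : copen D ->
  (forall x, A x -> exists S T : seq (units G), [/\ uniq T, x \in S,
     (size S <= size T)%N,
     forall y, y \in T -> exists2 g, D g & gsrc g = x /\ grng g = y &
     forall g, D g -> grng g \in T -> gsrc g \in S]) ->
  exists P, [/\ compact_open_Gset P, P `<=` D & A `<=` src P].
Proof.
move=> /greedy_matching[P [cP PD mP]] hall; exists P; split=> // x Ax.
have [S [T [uT xS ST TD DS]]] := hall x Ax.
apply: contrapT => nx.
(* If [x] is unmatched, maximality of [P] matches every target in [T], by arrows with distinct
   sources in [S] other than [x]. Then [T] has at most one element less than [S], a
   contradiction. *)
have /choice[f fP] : forall y, exists g, y \in T -> P g /\ grng g = y.
  move=> y; have [yT|nyT] := boolP (y \in T); last by exists (gid y).
  have [g Dg [gx gy]] := TD y yT.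
  have [|[p Pp py]] := mP g Dg; first by rewrite gx.
  by exists p => _; rewrite -gy.
have : (size (map (@gsrc G \o f) T) <= size (rem x S))%N.
  apply: uniq_leq_size.
    rewrite map_inj_in_uniq // => y z yT zT /= e.
    have [Py <-] := fP y yT; have [Pz <-] := fP z zT.
    by congr grng; exact: (cob_src_inj cP).
  move=> _ /mapP[y yT ->] /=; have [Py ey] := fP y yT.
  have xfy : gsrc (f y) != x.
    by apply/eqP => e; apply: nx; exists (f y).
  have fyS : gsrc (f y) \in S by apply: DS; rewrite ?ey //; exact: PD.
  have := perm_mem (perm_to_rem xS) (gsrc (f y)).
  by rewrite fyS inE (negbTE xfy).
rewrite size_map size_rem //; case: S xS ST {DS} => //= a S _; lia.
Qed.

End Matching.

(** * Elementary subgroupoids *)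

Section Elementary.
Variables (R : realType) (G : cantor_groupoid R).
Hypothesis hp : principal G.
Variable K : set G.
Hypothesis oK : open K.
Hypothesis sK : subgroupoid K.
Hypothesis cK : compact K.
Hypothesis uK : range (@gid G) `<=` K.
Implicit Types (g h k : G) (x y z : units G) (U V W D P : set G).
Implicit Types (A B S : set (units G)) (a b c : full_group G).

Let coK : copen K. Proof. by split. Qed.

Definition krel x y := exists2 k, K k & gsrc k = x /\ grng k = y.

Lemma krel_refl x : krel x x.
Proof.
by exists (gid x); [apply: uK; exists x|rewrite gsrc_id grng_id].
Qed.

Lemma krel_sym x y : krel x y -> krel y x.
Proof.
move=> [k Kk [<- <-]]; exists (ginv k); last by rewrite gsrc_inv grng_inv.
by case: sK => + _; exact.
Qed.

Lemma krel_trans y x z : krel x y -> krel y z -> krel x z.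
Proof.
move=> [k Kk [<- ky]] [l Kl [ly <-]].
have e : gsrc l = grng k by rewrite ky.
exists (gmul l k); last by rewrite gsrc_mul // grng_mul.
by case: sK => _; apply; exists l, k.
Qed.

Lemma krelK g : krel (gsrc g) (grng g) -> K g.
Proof. by move=> [k Kk [s r]]; rewrite -(arrow_unique hp s r). Qed.

Lemma Kkrel g : K g -> krel (gsrc g) (grng g).
Proof. by move=> Kg; exists g. Qed.

Definition korb x : seq (units G) := fset_set [set y | krel x y].

Lemma korb_finite x : finite_set [set y | krel x y].
Proof.
have -> : [set y | krel x y] = @grng G @` [set k | K k /\ gsrc k = x].
  apply/seteqP; split=> [y [k Kk [kx ky]]|y [k [Kk kx] ky]]; by exists k.
exact/finite_image/fibre_finite.
Qed.

Lemma mem_korb x y : (y \in korb x) = `[< krel x y >].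
Proof.
rewrite /korb in_fset_set; last exact: korb_finite.
by apply/idP/asboolP => [/set_mem|/mem_set].
Qed.

Lemma korbP x y : reflect (krel x y) (y \in korb x).
Proof. by rewrite mem_korb; exact: asboolP. Qed.

Lemma korb_uniq x : uniq (korb x). Proof. exact: fset_uniq. Qed.

Definition kcount A x := count (fun y => `[< A y >]) (korb x).

Lemma kcountC A x : (kcount A x + kcount (~` A) x = size (korb x))%N.
Proof.
rewrite -(count_predC (fun y => `[< A y >])); congr addn.
by apply: eq_count => y /=; rewrite asbool_neg.
Qed.

Lemma kcountU A B x : A `&` B = set0 ->
  kcount (A `|` B) x = (kcount A x + kcount B x)%N.
Proof.
move=> AB; rewrite /kcount -count_predUI addnC.
rewrite (_ : count (predI _ _) _ = 0%N) ?add0n; last first.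
  apply/eqP; rewrite -leqn0 leqNgt -has_count; apply/hasPn => y _ /=.
  apply/negP => /andP[/asboolP Ay /asboolP By].
  by have : (A `&` B) y by []; rewrite AB.
by apply: eq_count => y /=; rewrite asbool_or.
Qed.

Lemma kcount_eq A B x : A `<=` B -> kcount A x = kcount B x ->
  forall y, krel x y -> B y -> A y.
Proof.
move=> AB e y xy By; apply: contrapT => nAy.
have := kcountU x (A := A) (B := B `\` A).
rewrite setDIK setDUK // e => /(_ erefl) E.
suff : (0 < kcount (B `\` A) x)%N by lia.
rewrite -has_count; apply/hasP; exists y; first exact/korbP.
by apply/asboolP; split.
Qed.

Lemma kcount_filter A x : size [seq y <- korb x | `[< A y >]] = kcount A x.
Proof. by rewrite size_filter. Qed.

(** A bisection in [K] injects the sources in an orbit into the ranges in the same orbit; its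
    inverse gives the other inequality. *)
Lemma kcount_src_rng P x : compact_open_Gset P -> P `<=` K ->
  kcount (src P) x = kcount (rng P) x.
Proof.
have key Q : compact_open_Gset Q -> Q `<=` K ->
    (kcount (src Q) x <= kcount (rng Q) x)%N.
  move=> cQ QK; rewrite -!kcount_filter.
  have /choice[f fP] : forall y, exists g, src Q y -> Q g /\ gsrc g = y.
    move=> y; have [[g ? ?]|nQ] := pselect (src Q y); first by exists g.
    by exists (gid y).
  rewrite -(size_map (@grng G \o f)); apply: uniq_leq_size.
    rewrite map_inj_in_uniq; first exact/filter_uniq/korb_uniq.
    move=> y z; rewrite !mem_filter =>
      /andP[/asboolP Qy _] /andP[/asboolP Qz _] /= e.
    have [Qfy <-] := fP y Qy; have [Qfz <-] := fP z Qz.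
    by congr gsrc; exact: (cob_rng_inj cQ).
  move=> _ /mapP[y + ->];
    rewrite !mem_filter => /andP[/asboolP Qy /korbP xy] /=.
  have [Qfy e] := fP y Qy; apply/andP; split; first by apply/asboolP;
    exists (f y).
  by apply/korbP; apply: krel_trans xy _; have := Kkrel (QK _ Qfy); rewrite e.
move=> cP PK; apply/eqP; rewrite eqn_leq key //=.
rewrite -src_inv_set -(rng_inv_set P); apply: key; first exact: cob_inv.
move=> g /PK Kg; apply: krelK; apply: krel_sym.
by have := Kkrel Kg; rewrite gsrc_inv grng_inv.
Qed.

(** Within a [K]-orbit all points of [A] compete for all points of [B], so these two lists are the
    sets [S] and [T] of the matching lemma. *)
Lemma transport_le A B : clopen A -> clopen B ->
  (forall x, kcount A x <= kcount B x)%N ->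
  exists P, [/\ compact_open_Gset P, P `<=` K, src P = A & rng P `<=` B].
Proof.
move=> cA cB AB; pose D := K `&` @gsrc G @^-1` A `&` @grng G @^-1` B.
have coD : copen D.
  apply: copenI; last exact: grng_preimage_clopen.
  by apply: copenI => //; exact: gsrc_preimage_clopen.
have [x Ax|P [cP PD AP]] := matching (A := A) coD.
  exists [seq y <- korb x | `[< A y >]], [seq y <- korb x | `[< B y >]]; split.
  - exact/filter_uniq/korb_uniq.
  - by rewrite mem_filter (asboolT Ax) /=; exact/korbP/krel_refl.
  - by rewrite !kcount_filter.
  - move=> y; rewrite mem_filter => /andP[/asboolP By /korbP[k Kk [kx ky]]].
    by exists k => //; split; [split|]; rewrite //= ?kx ?ky.
  - move=> g [[Kg Ag] Bg]; rewrite !mem_filter => /andP[_ /korbP xg].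
    rewrite (asboolT (Ag : A (gsrc g))) /=; apply/korbP.
    by apply: krel_trans xg _; exact/krel_sym/Kkrel.
exists P; split=> //.
- by move=> g /PD[[]].
- by apply/seteqP; split=> // _ [g /PD[[_ ?] _] <-].
- by move=> _ [g /PD[_ ?] <-].
Qed.

(** The range lies in [B] and has as many points in each orbit; orbits being finite, it is all of
    [B]. *)
Lemma transport A B : clopen A -> clopen B ->
  (forall x, kcount A x = kcount B x) ->
  exists P, [/\ compact_open_Gset P, P `<=` K, src P = A & rng P = B].
Proof.
move=> cA cB AB; have [x|P [cP PK sP rP]] := transport_le cA cB.
  by rewrite AB.
exists P; split=> //; apply/seteqP; split=> // y By.
apply: (kcount_eq (x := y) rP) => //; last exact: krel_refl.
by rewrite -kcount_src_rng // sP AB.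
Qed.

Definition kfull a := forall x, krel x (a x).

Lemma kfull_mul a b : kfull a -> kfull b -> kfull (a * b)%g.
Proof. by move=> ka kb x; apply: krel_trans (kb x) (ka _). Qed.

Lemma kfull_inv a : kfull a -> kfull (a^-1)%g.
Proof.
by move=> ka x; apply: krel_sym; rewrite -{2}(full_KV a x); exact: ka.
Qed.

(** Source and range of [P] have equal counts in every orbit, hence so have their complements, which
    are joined by a second bisection of [K]. *)
Lemma extension P : compact_open_Gset P -> P `<=` K ->
  exists a, kfull a /\ forall g, P g -> a (gsrc g) = grng g.
Proof.
move=> cP PK.
have csP := src_clopen (cob_copen cP); have crP := rng_clopen (cob_copen cP).
have [x|Q [cQ QK sQ rQ]] := transport (clopen_setC csP) (clopen_setC crP).
  by have := kcountC (src P) x; have := kcountC (rng P) x;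
    rewrite kcount_src_rng //; lia.
have cPQ : compact_open_Gset (P `|` Q) by apply: cobU;
  rewrite // ?sQ ?rQ setICr.
have [||a ta] := full_of_cob cPQ.
- by have -> : src (P `|` Q) = src P `|` src Q by [exact: image_setU];
    rewrite sQ setUv.
- by have -> : rng (P `|` Q) = rng P `|` rng Q by [exact: image_setU];
    rewrite rQ setUv.
exists a; split=> [x|g Pg]; last by apply/ta; exists g => //; left.
have [g PQg [gx gax]] := (ta x (a x)).1 erefl.
by exists g => //; case: PQg => [/PK|/QK].
Qed.

(** The pairs (source, range) of the arrows of [K] that are not units form a compact set, which
    misses (x, x) by principality. Hence a small [N] meets each [K]-orbit at most once. *)
Lemma krel_small_nbhs x : exists N, [/\ clopen N, N x &
  forall k, K k -> N (gsrc k) -> N (grng k) -> grng k = gsrc k].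
Proof.
pose q (g : G) := (gsrc g, grng g).
have cq : continuous q.
  by move=> g; apply: cvg_pair; [exact: gsrc_continuous|exact: grng_continuous].
pose E := q @` (K `\` range (@gid G)).
have cE : compact E.
  apply: continuous_compact; first by apply: continuous_subspaceT.
  by have [] := copenD coK (gid_range_clopen G).
have hXX : hausdorff_space (units G * units G)%type.
  move=> [a b] [a' b'] cl; congr pair; apply: (@units_hausdorff G) => A B nA nB.
    have [||[z w] [/= [Az _] [Bz _]]] := cl (A `*` setT) (B `*` setT).
    - by exists (A, setT) => //; split=> //; exact: filterT.
    - by exists (B, setT) => //; split=> //; exact: filterT.
    - by exists z.
  have [||[z w] [/= [_ Aw] [_ Bw]]] := cl (setT `*` A) (setT `*` B).
  - by exists (setT, A) => //; split=> //; exact: filterT.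
  - by exists (setT, B) => //; split=> //; exact: filterT.
  - by exists w.
have nE : ~ E (x, x).
  by move=> [g [Kg ng] [gx gx']]; apply/ng/hp; rewrite gx gx'.
have := open_nbhs_nbhs (conj (closed_openC (compact_closed hXX cE)) nE).
move=> [[A B] /= [nA nB] AB].
have [N [cN Nx NAB]] := units_clopen_nbhs (filterI nA nB).
exists N; split=> // k Kk /NAB[sk _] /NAB[_ rk].
apply: contrapT => nk; apply: (AB (q k)) => //.
exists k => //; split=> // -[y _ yk]; apply: nk.
by rewrite -yk gsrc_id grng_id.
Qed.

(** Over a clopen [B] meeting each [K]-orbit at most once, the arrows [P] of [a] that start in [B]
    and are not units end outside [B]. So [P] is admissible, and [tau P * a] fixes [B] pointwise. *)
Lemma kfull_tau_class a : kfull a -> tau_class (ab_class a).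
Proof.
(* The last clause allows corrections over successive sets to be composed: points fixed earlier
   remain fixed. It holds because a point fixed by the injective map [a] is neither source nor range
   of an arrow of [P]. *)
pose Good B := forall a, kfull a -> exists b, [/\ kfull b,
  tau_class (ab_class a - ab_class b), forall x, B x -> b x = x &
  forall x, a x = x -> b x = x].
suff GT : Good setT.
  move=> ka; have [b [kb tab fb _]] := GT a ka.
  have b1 : b = 1%g by apply: full_group_ext => x; exact: fb.
  by move: tab; rewrite b1 ab_class1 subr0.
apply: (@clopen_units_ind _ G Good); last 2 first.
- exact: clopenT.
- move=> x _; have [N [cN Nx NK]] := krel_small_nbhs x.
  exists N; split=> // B cB BN _ {}a ka.
  pose P := restr (graph a `\` range (@gid G)) B.
  have cP : compact_open_Gset P.
    by apply: cobI; [apply: cobD; [exact: graph_cob|exact: gid_range_clopen]|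
       exact: gsrc_preimage_clopen].
  have PK : P `<=` K.
    by move=> g [[e _] _]; apply: krelK; rewrite -(e : a _ = _); exact: ka.
  have rPB g : P g -> ~ B (grng g).
    move=> Pg Bg; have [[_ ng] sg] := Pg; apply/ng/hp/NK;
      [exact: PK|exact: BN|exact: BN].
  have aP : adm P.
    split=> //; rewrite -subset0 => _ [[g Pg <-] [h [_ Bh] e]].
    by apply: (rPB g Pg); rewrite -e.
  have kt : kfull (tau P).
    move=> y; have [[g Pg <-]|ny] := pselect (src P y).
      by rewrite tau_src //; exact/Kkrel/PK.
    have [[g Pg <-]|ny'] := pselect (rng P y).
      by rewrite tau_rng //; exact/krel_sym/Kkrel/PK.
    by rewrite tau_out //; exact: krel_refl.
  have fixes y : a y = y -> ~ src P y /\ ~ rng P y.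
    move=> ay; split=> -[g [[e ng] _] gy].
      by apply/ng/hp; rewrite -(e : a _ = _) gy.
    apply/ng/hp; rewrite gy; apply: (@full_inj _ _ a).
    by rewrite ay -gy -(e : a _ = _).
  exists (tau P * a)%g; split.
  - exact: kfull_mul.
  - rewrite ab_class_mul opprD addrCA subrr addr0.
    exact/tau_classN/tau_class_tau.
  - move=> y By /=; have [g [ga gy gay]] := graph_arrow hp a y.
    have [ay|nay] := pselect (a y = y).
      by have [? ?] := fixes y ay; rewrite ay tau_out.
    have Pg : P g.
      split; last by rewrite /= gy.
      by split=> // -[z _ zg]; apply: nay; rewrite -gay -gy -zg gsrc_id grng_id.
    by rewrite -gay tau_rng.
  - by move=> y ay /=; have [? ?] := fixes y ay; rewrite ay tau_out.
- move=> {}a ka; exists a; split=> //; by rewrite subrr; exact: tau_class0.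
- move=> A B _ _ _ _ _ gA gB {}a ka.
  have [b [kb tab fA fab]] := gA a ka; have [c [kc tbc fB fbc]] := gB b kb.
  exists c; split=> //;
    first by rewrite -(subrK (ab_class b) (ab_class a)) -addrA;
      exact: tau_classD.
    by move=> x [Ax|Bx]; [apply/fbc/fA|exact: fB].
  by move=> x /fab/fbc.
Qed.

(** A set meeting each orbit at most once is its own transversal. When two partial transversals are
    united, the second loses the points whose orbit the first already meets, that is the clopen
    saturation [S]. *)
Lemma transversal : exists Y, [/\ clopen Y,
  forall x, exists2 y, Y y & krel x y &
  forall y z, Y y -> Y z -> krel y z -> y = z].
Proof.
pose Good B := exists Y, [/\ clopen Y, Y `<=` B,
  forall x, B x -> exists2 y, Y y & krel x y &
  forall y z, Y y -> Y z -> krel y z -> y = z].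
suff [Y [cY _ Yx Yu]] : Good setT by exists Y; split=> // x; exact: Yx.
apply: (@clopen_units_ind _ G Good); last 2 first.
- exact: clopenT.
- move=> x _; have [N [cN Nx NK]] := krel_small_nbhs x.
  exists N; split=> // B cB BN _; exists B; split=> //.
    by move=> y By; exists y => //; exact: krel_refl.
  by move=> y z By Bz [k Kk [ky kz]]; rewrite -ky -kz; apply/esym/NK => //;
     apply: BN; rewrite ?ky ?kz.
- by exists set0; split=> //; exact: clopen0.
- move=> A B cA cB _ _ _ [Y [cY YA Yx Yu]] [Z [cZ ZB Zx Zu]].
  pose S := rng (restr K Y).
  have cS : clopen S.
    by apply/rng_clopen/copenI => //; exact: gsrc_preimage_clopen.
  have SP x : S x <-> exists2 y, Y y & krel y x.
    split=> [[k [Kk Yk] <-]|[y Yy [k Kk [ky <-]]]].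
      by exists (gsrc k) => //; exact: Kkrel.
    by exists k => //; split=> //=; rewrite ky.
  exists (Y `|` (Z `\` S)); split.
  + by apply: clopenU => //; rewrite setDE; apply: clopenI => //;
      exact: clopen_setC.
  + by move=> x [/YA|[/ZB]]; [left|right].
  + move=> x [Ax|Bx].
      by have [y Yy xy] := Yx x Ax; exists y => //; left.
    have [z Zz xz] := Zx x Bx; have [Sz|nSz] := pselect (S z).
      have /SP[y Yy yz] := Sz; exists y; first by left.
      exact: krel_trans xz (krel_sym yz).
    by exists z => //; right.
  + move=> y z [Yy|[Zy nSy]] [Yz|[Zz nSz]] yz.
    * exact: Yu.
    * by case: nSz; apply/SP; exists y.
    * by case: nSy; apply/SP; exists z => //; exact: krel_sym.
    * exact: Zu.
Qed.

(* With [Z] the arrows of [K] from a transversal, the pairs (w, z) of [W] and [Z]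
   bound the difference between [W] and the paths through the transversal. *)
Lemma K_cycle_bounds (f : Cc G) : (forall g, f g != 0 -> K g) ->
  boundary1 f = 0 -> exists h : Cc (G2 G), f = boundary2 h :> (G -> int).
Proof.
move=> fK f0; have [Y [cY Yx Yu]] := transversal.
pose Z := restr K Y.
have coZ : copen Z by apply: copenI => //; exact: gsrc_preimage_clopen.
have Zr g h : Z g -> Z h -> grng g = grng h -> g = h.
  move=> [Kg Yg] [Kh Yh] e; apply: (arrow_unique hp) => //; apply: Yu => //.
  by apply: krel_trans (Kkrel Kg) _; rewrite e; exact/krel_sym/Kkrel.
have rZ : rng Z = setT.
  apply/seteqP; split=> // x _; have [y Yy /krel_sym[k Kk [ky kx]]] := Yx x.
  by exists k => //; split=> //=; rewrite ky.
(* An identity additive in [f], so it can be checked on small bisections; its correction term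
   vanishes when [f] is a cycle. *)
pose P (f : Cc G) := exists h : Cc (G2 G), forall g,
  f g = boundary2 h g - ind Z g * boundary1 f (grng g).
suff [h fh] : P f.
  exists h; apply/funext => g; rewrite fh f0.
  by rewrite (_ : (0 : units G -> int) (grng g) = 0) // mulr0 subr0.
have hG := @arrows_hausdorff G.
apply: (Cc_ind hG (P := P)).
- exists 0 => g; rewrite boundary2_0 boundary1_0.
  by rewrite (_ : (0 : units G -> int) (grng g) = 0) // mulr0 subr0.
- move=> f1 f2 [h1 e1] [h2 e2]; exists (h1 + h2) => g.
  rewrite CcD e1 e2 boundary2D boundary1D.
  have -> : (boundary2 h1 + boundary2 h2) g =
    boundary2 h1 g + boundary2 h2 g by [].
  have -> : (boundary1 f1 + boundary1 f2) (grng g) =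
     boundary1 f1 (grng g) + boundary1 f2 (grng g) by [].
  move: (boundary1 f1 _) (boundary1 f2 _) => x1 x2.
  by rewrite mulrDr opprD addrACA.
move=> g fg; have [N [cN Ng NK]] :=
  cob_nbhs_clopen (copen_arrows_clopen coK) (fK g fg).
exists N; split=> //; first exact: cob_copen.
move=> B coB BN; have cB := cob_sub cN coB BN.
have PB : P (indc B).
  exists (indc (pairs B Z)) => k; rewrite boundary2_pairs // boundary1_ind //.
  rewrite (indcE hG coB).
  have -> : (ind (Z `&` @grng G @^-1` src B) - ind (set_mul B Z) +
     ind (B `&` @gsrc G @^-1` rng Z)) k = ind (Z `&` @grng G @^-1` src B) k
     - ind (set_mul B Z) k + ind (B `&` @gsrc G @^-1` rng Z) k by [].
  have -> : (ind (src B) - ind (rng B)) (grng k) =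
    ind (src B) (grng k) - ind (rng B) (grng k) by [].
  rewrite rZ preimage_setT setIT.
  (* Multiplying by an arrow of [K] on the left keeps the source in the transversal. So an arrow [v]
     of [Z] with range in [rng B] factors through [B], the other factor being again in [Z]. *)
  have -> : set_mul B Z = Z `&` @grng G @^-1` rng B.
    apply/seteqP; split=> [_ [u [v [Bu Zv e ->]]]|v [Zv [u Bu e]]].
      split; last by exists u; rewrite ?grng_mul.
      have [Kv Yv] := Zv; split; last by rewrite /= gsrc_mul.
      by case: sK => _; apply; exists u, v; split=> //; apply/NK/BN.
    exists u, (gmul (ginv u) v);
      have eu : gsrc (ginv u) = grng v by rewrite gsrc_inv.
    split=> //; last by rewrite gmulVKl.
      split; last by rewrite /= gsrc_mul //; case: Zv.
      case: sK => iK; apply; exists (ginv u), v; split=> //; last by case: Zv.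
      exact/iK/NK/BN.
    by rewrite grng_mul // grng_inv.
  have iI (S : set (units G)) :
    ind (Z `&` @grng G @^-1` S) k = ind Z k * ind S (grng k).
    have [Zk|nZk] := pselect (Z k);
      last by rewrite !(indF nZk) mul0r indF // => -[].
    have [Sk|nSk] := pselect (S (grng k));
      last by rewrite !(indF nSk) mulr0 indF // => -[].
    by rewrite !indT // mulr1.
  by rewrite !iI mulrBr addrAC subrr add0r.
split=> //; have [h eh] := PB; exists (- h) => k.
rewrite CcN eh boundary2N boundary1N.
have -> : (- boundary2 h) k = - boundary2 h k by [].
have -> : (- boundary1 (indc B)) (grng k) = - boundary1 (indc B) (grng k) by [].
by move: (boundary1 _ _) => x; rewrite mulrN opprD.
Qed.

End Elementary.

Lemma count_add (T : eqType) (p q r : pred T) (s : seq T) :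
  {in s, forall z, (p z : nat) = (q z + r z)%N} ->
  (count p s = count q s + count r s)%N.
Proof.
elim: s => //= z s IH H; rewrite H ?mem_head // IH; first lia.
by move=> y ys; apply: H; rewrite inE ys orbT.
Qed.

(** * Comparing elements of the full group modulo an elementary subgroupoid *)

Section Merging.
Variables (R : realType) (G : cantor_groupoid R).
Hypothesis hp : principal G.
Variable K : set G.
Hypothesis oK : open K.
Hypothesis sK : subgroupoid K.
Hypothesis cK : compact K.
Hypothesis uK : range (@gid G) `<=` K.
Implicit Types (g h k : G) (x y z w : units G) (U V W D P : set G).
Implicit Types (A B S : set (units G)) (a b c : full_group G).

Let coK : copen K. Proof. by split. Qed.
Let krefl := krel_refl uK.
Let ksym := krel_sym sK.
Let ktrans := krel_trans sK.
Let korbP x y : reflect (krel K x y) (y \in korb K x).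
Proof. exact: korbP. Qed.

(** For [S] invariant under [K], a quantity that does not change when [a] is multiplied on either
    side by the full group of [K]. *)
Definition ncount x S a := count (fun z => `[< S (a z) >]) (korb K x).

Definition kinvariant S := forall y z, krel K y z -> S y -> S z.

Definition leaves a : set (units G) := [set z | ~ krel K z (a z)].

Lemma kinvariant_iff S y z :
  kinvariant S -> krel K y z -> `[< S y >] = `[< S z >].
Proof.
by move=> iS yz; apply/asbool_equiv_eq; split; apply: iS => //; exact: ksym.
Qed.

Lemma leavesE a : leaves a = src (graph a `\` K).
Proof.
apply/seteqP; split=> [z nz|_ [g [ga nK] <-] kz].
  have [g [ga gz gaz]] := graph_arrow hp a z.
  exists g => //; split=> // Kg; apply: nz.
  by rewrite -gaz -{1}gz; exists g.
by apply: nK; apply: (krelK hp); rewrite -(ga : a _ = _).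
Qed.

Lemma leaves_clopen a : clopen (leaves a).
Proof.
rewrite leavesE; apply/src_clopen/cob_copen/cobD; first exact: graph_cob.
exact: copen_arrows_clopen.
Qed.

Lemma kinvariant_off x : kinvariant [set y | ~ krel K x y].
Proof. by move=> y z yz /= nxy xz; apply/nxy/(ktrans xz)/ksym. Qed.

Lemma kcount_leaves a x :
  kcount K (leaves a) x = ncount x [set y | ~ krel K x y] a.
Proof.
apply: eq_in_count => z /korbP xz; apply/asbool_equiv_eq; split=> /= n k;
  apply: n.
  exact: ktrans (ksym xz) k.
exact: ktrans xz k.
Qed.

(** Multiply [a] by an element of the full group of [K] extending the inverse of the part of the
    graph of [a] inside [K]: it undoes [a] wherever [a] stays in the orbit. *)
Lemma normal_form a : exists b, [/\ tau_class (ab_class a - ab_class b),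
  forall z, krel K (a z) (b z) & forall z, krel K z (a z) -> b z = z].
Proof.
pose P := inv_set (graph a `&` K).
have cP : compact_open_Gset P.
  by apply/cob_inv/cobI; [exact: graph_cob|exact: copen_arrows_clopen].
have [|c [kc cE]] := extension hp oK sK cK uK cP.
  by move=> g [_ Kg]; rewrite -[g]ginvK; case: sK => + _; exact.
exists (c * a)%g; split.
- rewrite ab_class_mul opprD addrCA subrr addr0.
  exact/tau_classN/(kfull_tau_class hp oK sK cK uK).
- by move=> z; exact: kc.
move=> z zaz /=; have [g [ga gz gaz]] := graph_arrow hp a z.
have := cE (ginv g); rewrite /P /inv_set /= ginvK gsrc_inv grng_inv gaz gz;
  apply.
by split=> //; apply: (krelK hp); rewrite gz gaz.
Qed.

Lemma ncount_conj x S c b b' : kfull K c -> kinvariant S ->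
  (forall z, krel K (b z) (b' z)) ->
  ncount x S (c * b' * c^-1)%g = ncount x S b.
Proof.
move=> kc iS bb'; pose d := (c^-1)%g.
have kd : kfull K d by exact: kfull_inv.
have e1 : ncount x S (c * b' * c^-1)%g =
    count (fun z => `[< S (b (d z)) >]) (korb K x).
  apply: eq_count => z; apply: (kinvariant_iff iS).
  by apply: ksym; apply: ktrans (bb' _) (kc _).
rewrite e1 -(count_map d (fun z => `[< S (b z) >])).
apply/permP/uniq_perm.
- by rewrite map_inj_uniq; [exact: korb_uniq|exact: full_inj].
- exact: korb_uniq.
move=> z; apply/mapP/korbP => [[y /korbP xy ->]|xz];
  first exact: ktrans xy (kd y).
exists (c z); last by rewrite /d full_VK.
by apply/korbP; exact: ktrans xz (kc z).
Qed.

(** In normal form, [a] and [b] move only the points that leave their orbit. There is room in each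
    orbit to push those of [b] off those of [a] by an element of the full group of [K]; conjugating
    by it does not change the class. *)
Lemma merge a b :
  (forall x, kcount K (leaves a) x + kcount K (leaves b) x <= size (korb K x))%N ->
  exists c, tau_class (ab_class a + ab_class b - ab_class c) /\
    forall x S, kinvariant S -> ~ S x ->
      ncount x S c = (ncount x S a + ncount x S b)%N.
Proof.
move=> room.
have [a0 [ta a0r a0fix]] := normal_form a.
have [b0 [tb b0r b0fix]] := normal_form b.
have cA := leaves_clopen a; have cB := leaves_clopen b.
have [x|P [cP PK sP rP]] := transport_le oK sK cK uK cB (clopen_setC cA).
  by have := kcountC K (leaves a) x; have := room x; lia.
have [c [kc cE]] := extension hp oK sK cK uK cP PK.
have cBA w : leaves b w -> ~ leaves a (c w).
  rewrite -sP => -[g Pg <-]; rewrite cE //; apply: rP; by exists g.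
have a0fix' w : ~ leaves a w -> a0 w = w by move=> /contrapT; exact: a0fix.
have b0fix' w : ~ leaves b w -> b0 w = w by move=> /contrapT; exact: b0fix.
pose b1 := (c * b0 * c^-1)%g.
exists (a0 * b1)%g; split.
  rewrite /b1 !ab_class_mul ab_class_inv [ab_class c + _]addrC addrK opprD addrACA.
  exact: tau_classD.
move=> x S iS nSx; rewrite -(ncount_conj x kc iS b0r).
(* The supports being disjoint, the product acts on [z] as one of its factors; the other fixes [z]
   and contributes nothing, since [S] misses the orbit. *)
apply: count_add => z /korbP xz.
have nSz : ~ S z by move=> Sz; apply/nSx/(iS z) => //; exact: ksym.
have Sa0 y : `[< S (a0 y) >] = `[< S (a y) >].
  by apply/esym/(kinvariant_iff iS)/a0r.
rewrite -/b1; pose w := (c^-1)%g z.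
have cw : c w = z by exact: full_KV.
have b1z : b1 z = c (b0 w) by [].
have [Az|nAz] := pselect (leaves a z).
  have nBw : ~ leaves b w by move=> /cBA; rewrite cw.
  rewrite -[(a0 * b1)%g z]/(a0 (b1 z)) b1z b0fix' // cw Sa0 (asboolF nSz).
  by rewrite addn0.
have nA1 : ~ leaves a (b1 z).
  have [Bw|nBw] := pselect (leaves b w); last by rewrite b1z b0fix' // cw.
  rewrite b1z; apply: cBA; apply: contrapT => nBb0.
  apply: Bw; rewrite -{1}(@full_inj _ _ b0 _ _ (b0fix' _ nBb0)).
  exact/ksym/b0r.
rewrite -[(a0 * b1)%g z]/(a0 (b1 z)) a0fix' // -Sa0 a0fix' // (asboolF nSz).
by rewrite add0n.
Qed.

Lemma merge_seq (s : seq (full_group G)) :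
  (forall x, \sum_(a <- s) kcount K (leaves a) x <= size (korb K x))%N ->
  exists c, tau_class (\sum_(a <- s) ab_class a - ab_class c) /\
    forall x S, kinvariant S -> ~ S x ->
      ncount x S c = (\sum_(a <- s) ncount x S a)%N.
Proof.
elim: s => [|a s IH] room.
  exists 1%g; split; first by rewrite big_nil ab_class1 subr0;
    exact: tau_class0.
  move=> x S iS nSx; rewrite big_nil; apply/eqP;
    rewrite -leqn0 leqNgt -has_count.
  apply/hasPn => z /korbP xz; apply/asboolPn => Sz.
  by apply/nSx/(iS z) => //; exact: ksym.
have [x|b [tb bE]] := IH.
  by apply: leq_trans (room x); rewrite big_cons leq_addl.
(* Leaving the orbit is landing in its complement, an invariant set. So the counts in the induction
   hypothesis also bound the points leaving under the merged [b]. *)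
have [x|c [tc cE]] := @merge a b.
  apply: leq_trans (room x); rewrite big_cons leq_add2l.
  rewrite kcount_leaves bE; last 2 first.
  - exact: kinvariant_off.
  - by move=> /(_ (krefl x)).
  by apply: leq_sum => i _; rewrite kcount_leaves.
exists c; split; last by move=> x S iS nSx; rewrite cE // bE // big_cons.
rewrite big_cons; set t := \sum_(_ <- _) _ in tb *.
have -> : ab_class a + t - ab_class c =
    ab_class a + ab_class b - ab_class c + (t - ab_class b).
  by rewrite [RHS]addrC [RHS]addrA [ab_class a + ab_class b]addrC
    [t - _ + _]addrA subrK [t + _]addrC.
exact: tau_classD.
Qed.

(** Inversion exchanges the factors: [set_mul_open], which asks for injectivity of the range map on
    the first factor, becomes usable when it is the second factor that is a bisection. *)
Lemma set_mul_inv_set U V :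
  set_mul U V = inv_set (set_mul (inv_set V) (inv_set U)).
Proof.
apply/seteqP; split=> [_ [u [v [Uu Vv e ->]]]|g [v [u [Vv Uu e gE]]]].
  exists (ginv v), (ginv u); rewrite /inv_set /= !ginvK gsrc_inv grng_inv.
  split=> //; apply: (arrow_unique hp).
    by rewrite gsrc_inv grng_mul // gsrc_mul ?gsrc_inv ?grng_inv.
  by rewrite grng_inv gsrc_mul // grng_mul ?grng_inv ?gsrc_inv ?grng_inv.
exists (ginv u), (ginv v); split=> //; first by rewrite gsrc_inv grng_inv.
rewrite -[g]ginvK gE; apply: (arrow_unique hp).
  by rewrite gsrc_inv grng_mul // gsrc_mul ?gsrc_inv ?grng_inv.
by rewrite grng_inv gsrc_mul // grng_mul ?grng_inv ?gsrc_inv ?grng_inv.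
Qed.

(** These are the arrows of [K] that are a product of an arrow of the graph of [a], then one of [K],
    then an inverse of one of the graph of [b]; products of compact open sets of this kind are
    compact open. *)
Lemma color_copen a b :
  copen [set k | K k /\ krel K (a (gsrc k)) (b (grng k))].
Proof.
have [ca _ _] := graph_cob hp a; have cb := cob_inv (graph_cob hp b).
pose E := set_mul (inv_set (graph b)) (set_mul K (graph a)).
have coE : copen E.
  split.
    by apply: set_mul_compact; [case: cb|exact: set_mul_compact].
  apply: set_mul_open; first by case: cb => _ _ [].
    by case: cb.
  rewrite set_mul_inv_set; apply: inv_set_open; apply: set_mul_open.
  - by have [_ _ []] := cob_inv (graph_cob hp a).
  - by have [_ ? _] := cob_inv (graph_cob hp a).
  - exact: inv_set_open.
have -> : [set k | K k /\ krel K (a (gsrc k)) (b (grng k))] = E `&` K.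
  apply/seteqP; split=> [k [Kk [l Kl [la lb]]]|_ [[v [_ [bv [l [u [Kl au e1 ->]]] e ->]]] Kk]].
    have [u [au us ur]] := graph_arrow hp a (gsrc k).
    have [v [bv vs vr]] := graph_arrow hp b (grng k).
    have lu : gsrc l = grng u by rewrite la.
    have vl : gsrc (ginv v) = grng (gmul l u).
      by rewrite gsrc_inv grng_mul // vr lb.
    split=> //; exists (ginv v), (gmul l u); split=> //.
    + by rewrite /inv_set /= ginvK.
    + by exists l, u.
    + apply: (arrow_unique hp); first by rewrite gsrc_mul // gsrc_mul.
      by rewrite grng_mul // grng_inv.
  split=> //; rewrite gsrc_mul // gsrc_mul // grng_mul //.
  have <- : grng u = a (gsrc u) by exact: esym.
  move: bv; rewrite /inv_set /graph /= gsrc_inv grng_inv => ->.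
  by rewrite e grng_mul // -e1; exact: Kkrel.
by apply: copenI => //; exact: copen_arrows_clopen.
Qed.

(* By counting, the arrows [k] of [K] with [a (gsrc k)] and [b (grng k)] in the
   same [K]-orbit contain the graph of some [c], and then [b * c * a^-1] preserves
   the [K]-orbits. *)
Lemma same_ncount a b : (forall x S, kinvariant S -> ~ S x ->
    ncount x S a = ncount x S b) -> tau_class (ab_class a - ab_class b).
Proof.
move=> nab; have coD := color_copen a b.
have [x _|P [cP PD sP]] := matching (A := setT) coD.
  exists [seq z <- korb K x | `[< krel K (a z) (a x) >]],
    [seq y <- korb K x | `[< krel K (b y) (a x) >]]; split.
  - exact/filter_uniq/korb_uniq.
  - by rewrite mem_filter asboolT //=; exact/korbP.
  - have E c : size [seq y <- korb K x | `[< krel K (c y) (a x) >]] =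
        ncount x [set y | krel K y (a x)] c by rewrite size_filter.
    (* The hypothesis concerns only invariant sets missing [x]. If [a x] stays in the orbit of [x],
       compare the points landing in the complement of the orbit instead. *)
    rewrite !E; have [xax|nxax] := pselect (krel K x (a x)); last first.
      rewrite nab // => y z yz yax; exact: ktrans (ksym yz) yax.
    have C c : (ncount x [set y | krel K y (a x)] c +
        ncount x [set y | ~ krel K x y] c = size (korb K x))%N.
      rewrite -(count_predC (fun z => `[< krel K (c z) (a x) >])); congr addn.
      apply: eq_count => z /=; rewrite -asbool_neg; apply/asbool_equiv_eq.
      split=> n k; apply: n; first exact: ktrans xax (ksym k).
      exact: ksym (ktrans (ksym xax) k).
    have E' : ncount x [set y | ~ krel K x y] a =
      ncount x [set y | ~ krel K x y] b.
      by apply: nab; [exact: kinvariant_off|move=> /(_ (krefl x))].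
    by have := C a; have := C b; rewrite E'; lia.
  - move=> y; rewrite mem_filter => /andP[/asboolP byax /korbP[k Kk [kx ky]]].
    by exists k => //; split=> //; rewrite kx ky; exact: ksym.
  - move=> g [Kg ag]; rewrite !mem_filter => /andP[/asboolP bg /korbP xg].
    rewrite asboolT /=; last exact: ktrans ag bg.
    by apply/korbP/(ktrans xg)/ksym/Kkrel.
have PK : P `<=` K by move=> g /PD[].
have [c [kc cE]] := extension hp oK sK cK uK cP PK.
have abc x : krel K (a x) (b (c x)).
  by have [g Pg <-] := sP x I; rewrite cE //; have [_] := PD g Pg.
have : tau_class (ab_class (b * c * a^-1)%g).
  apply: (kfull_tau_class hp oK sK cK uK) => y.
  by have := abc ((a^-1)%g y); rewrite full_KV.
have := kfull_tau_class hp oK sK cK uK kc.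
rewrite !ab_class_mul ab_class_inv => tc tbca.
have -> : ab_class a - ab_class b =
    ab_class c - (ab_class b + ab_class c - ab_class a).
  by rewrite opprB addrCA [ab_class b + _]addrC opprD
    [ab_class c + (_ - _)]addrA subrr add0r.
exact: tau_classB.
Qed.

End Merging.

(** * The kernel of the index map *)

Section Kernel.
Variables (R : realType) (G : cantor_groupoid R).
Hypothesis hp : principal G.
Hypothesis haf : almost_finite G.
Implicit Types (g h k : G) (x y z w : units G) (U V W D P : set G).
Implicit Types (A B S : set (units G)) (a b c : full_group G).

(** A point [z] of the orbit of [x] that leaves it along [u] in [D] yields the arrow u k, with [k]
    in [K] from [x] to [z]. It is counted in the almost finiteness ratio, and its range determines
    [u], hence [z]. *)
Lemma small_leaving (l : seq (set G)) :
  (forall i, compact_open_Gset (nth set0 l i)) ->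
  exists K, [/\ open K, subgroupoid K, compact K, range (@gid G) `<=` K &
    forall x, (\sum_(D <- l) kcount K (src (D `\` K)) x <= size (korb K x))%N].
Proof.
move=> cl; pose C := \big[setU/set0]_(D <- l) D.
have sC i : nth set0 l i `<=` C.
  rewrite /C; elim: (l) i => [|D l' IH] [|i] //=; rewrite big_cons => g Dg.
    by left.
  by right; exact: (IH i).
have cC : compact C.
  rewrite /C; elim: (l) cl => [|D l' IH] cl'; first by rewrite big_nil;
    exact: compact0.
  rewrite big_cons; apply: compactU; first by case: (cl' 0%N).
  by apply: IH => i; exact: (cl' i.+1).
(* The successor keeps [n] positive for the empty list. The bound [p * n < q] gives
   [size l * p <= q], and [q] is at most the size of the orbit. *)
pose n := (size l).+1; pose eps : R := n%:R^-1.
have eps0 : 0 < eps by rewrite invr_gt0 ltr0n.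
have [K [oK sK [cK _] uK bK]] := haf cC eps0; exists K; split=> // x.
have finC : finite_set (set_mul C (arrows_from K x) `\` arrows_from K x).
  apply: (@sub_finite_set _ _ [set g | set_mul C K g /\ gsrc g = x]).
    by move=> _ [[u [k [Cu [Kk kx] e ->]]] _]; split;
      [exists u, k|rewrite gsrc_mul].
  exact/fibre_finite/set_mul_compact.
have finK : finite_set (arrows_from K x) by exact: fibre_finite.
set p := #|` fset_set (set_mul C (arrows_from K x) `\` arrows_from K x)|.
set q := #|` fset_set (arrows_from K x)|.
have qE : (q <= size (korb K x))%N.
  rewrite /q -(size_map (@grng G)); apply: uniq_leq_size.
    rewrite map_inj_in_uniq ?fset_uniq // => g h.
    rewrite !in_fset_set // => /set_mem[Kg gx] /set_mem[Kh hx].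
    by apply: (arrow_unique hp); rewrite gx hx.
  move=> _ /mapP[g + ->]; rewrite in_fset_set // => /set_mem[Kg gx].
  by apply/(korbP cK); exists g.
have q0 : (0 < q)%N.
  rewrite cardfs_gt0; apply/fset0Pn; exists (gid x); rewrite in_fset_set //.
  by apply/mem_set; split; [apply: uK; exists x|exact: gsrc_id].
have pq : (p * n < q)%N.
  have := bK x; rewrite -/p -/q ltr_pdivrMr ?ltr0n // /eps mulrC ltr_pdivlMr ?ltr0n //.
  by rewrite -natrM ltr_nat.
have bD D : D `<=` C -> compact_open_Gset D ->
  (kcount K (src (D `\` K)) x <= p)%N.
  move=> DC cD; rewrite -kcount_filter.
  have /choice[f fP] : forall z, exists g, src (D `\` K) z -> krel K x z ->
      exists u k, [/\ (D `\` K) u, K k, gsrc u = z, gsrc k = x &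
        grng k = z /\ g = gmul u k].
    move=> z; have [[u Du uz]|nz] := pselect (src (D `\` K) z);
      last by exists (gid x).
    have [[k Kk [kx kz]]|nk] := pselect (krel K x z); last by exists (gid x).
    by exists (gmul u k) => _ _; exists u, k.
  rewrite -(size_map f) /p; apply: uniq_leq_size.
    rewrite map_inj_in_uniq; first exact/filter_uniq/korb_uniq.
    move=> y z; rewrite !mem_filter => /andP[/asboolP sy /(korbP cK) xy].
    move=> /andP[/asboolP sz /(korbP cK) xz] e.
    have [u [k [[Du _] _ uy _ [ky fy]]]] := fP y sy xy.
    have [v [m [[Dv _] _ vz _ [mz fz]]]] := fP z sz xz.
    rewrite -uy -vz; congr gsrc; apply: (cob_rng_inj cD) => //.
    have := congr1 (@grng G) e; rewrite fy fz !grng_mul //;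
      first by rewrite vz mz.
    by rewrite uy ky.
  move=> _ /mapP[z + ->];
    rewrite mem_filter => /andP[/asboolP sz /(korbP cK) xz].
  have [u [k [[Du nKu] Kk uz kx [kz ->]]]] := fP z sz xz.
  have e : gsrc u = grng k by rewrite uz kz.
  rewrite in_fset_set //; apply/mem_set; split.
    by exists u, k; split=> //; exact: DC.
  move=> [Kuk _]; apply: nKu.
  have -> : u = gmul (gmul u k) (ginv k).
    by rewrite -gmulA ?grng_inv // gmulVr -e gmul1r.
  case: sK => iK; apply; exists (gmul u k), (ginv k); split=> //;
    first exact: iK.
  by rewrite gsrc_mul // grng_inv.
have sumle l' : (forall i, nth set0 l' i `<=` C) ->
    (forall i, compact_open_Gset (nth set0 l' i)) ->
    (\sum_(D <- l') kcount K (src (D `\` K)) x <= size l' * p)%N.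
  elim: l' => [|D l' IH] sC' cl'; first by rewrite big_nil.
  rewrite big_cons mulSn; apply: leq_add;
    first exact: (bD _ (sC' 0%N) (cl' 0%N)).
  by apply: IH => i; [exact: (sC' i.+1)|exact: (cl' i.+1)].
apply: leq_trans (sumle l sC cl) _; apply: leq_trans qE; apply: ltnW;
  apply: leq_ltn_trans pq.
by rewrite mulnC leq_mul2l leqnSn orbT.
Qed.

(** One [K] is chosen for all the elements of both lists. Each list is merged into a single element,
    and the two have the same orbit counts because these are sums of the counts of the lists. *)
Lemma full_relation (s t : seq (full_group G)) :
  (forall z w, z != w ->
     count (fun a : full_group G => a z == w) s =
     count (fun a : full_group G => a z == w) t) ->
  tau_class (\sum_(a <- s) ab_class a - \sum_(a <- t) ab_class a).
Proof.
move=> st.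
have [i|K [oK sK cK uK room]] :=
  @small_leaving [seq graph a | a : full_group G <- s ++ t].
  have [im|im] := ltnP i (size (s ++ t)).
    by rewrite (nth_map 1%g) //; exact: graph_cob.
  by rewrite nth_default ?size_map //; have [] := @adm0 _ G.
have room' r : (exists r1 r2, s ++ t = r1 ++ r ++ r2) -> forall x,
    (\sum_(a <- r) kcount K (leaves K a) x <= size (korb K x))%N.
  move=> [r1 [r2 e]] x; apply: leq_trans (room x).
  rewrite big_map e !big_cat /=.
  rewrite (eq_bigr (fun a : full_group G =>
    kcount K (src (graph a `\` K)) x)); last first.
    by move=> a _; rewrite leavesE.
  lia.
have [|c [tc cE]] := merge_seq hp oK sK cK uK (room' s _).
  by exists [::], t.
have [|d [td dE]] := merge_seq hp oK sK cK uK (room' t _).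
  by exists s, [::]; rewrite cats0.
have tcd : tau_class (ab_class c - ab_class d).
  apply: (same_ncount hp oK sK cK uK) => x S iS nSx;
    rewrite cE // dE // /ncount.
  have swap (r : seq (full_group G)) :
      (\sum_(a <- r) count (fun z => `[< S (a z) >]) (korb K x) =
       \sum_(z <- korb K x) count (fun a : full_group G => `[< S (a z) >]) r)%N.
    under eq_bigr do rewrite -sum1_count big_mkcond /=.
    by rewrite exchange_big /=; apply: eq_bigr => z _;
      rewrite -sum1_count [RHS]big_mkcond.
  rewrite !swap; apply: eq_big_seq => z /(korbP cK) xz.
  have nSz : ~ S z by move=> Sz; apply: nSx; apply: iS Sz; exact: krel_sym.
  (* Images equal to [z] can be discarded, as [S] misses [z]; by hypothesis the remaining images of
     [z] under [s] and under [t] agree up to order. *)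
  have E (r : seq (full_group G)) :
      count (fun a : full_group G => `[< S (a z) >]) r =
      count (fun w => `[< S w >])
        (seq.filter (predC1 z) [seq a z | a : full_group G <- r]).
    rewrite count_filter count_map; apply: eq_count => a /=.
    by case: eqP => [->|_] /=; rewrite ?andbT // andbF asboolF.
  rewrite !E; apply/permP/allP => w _ /=; rewrite !count_filter !count_map.
  have [->|wz] := eqVneq w z.
    rewrite !(eq_count (a2 := pred0)) ?count_pred0 // => a /=;
      by case: eqP => //= ->; rewrite eqxx.
  rewrite !(eq_count (a2 := fun a : full_group G => a z == w)) ?st
    1?eq_sym // => a /=;
    by case: eqP => //= ->; rewrite wz.
have -> : \sum_(a <- s) ab_class a - \sum_(a <- t) ab_class a =
    (\sum_(a <- s) ab_class a - ab_class c) - (\sum_(a <- t) ab_class a - ab_class d)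
    + (ab_class c - ab_class d).
  move: (\sum_(_ <- s) _) (\sum_(_ <- t) _) (ab_class c) (ab_class d) =>
    X Y C D.
  by rewrite opprB -addrA [D - Y + _]addrC [C - D + _]addrA subrK addrA subrK.
by apply: tau_classD => //; exact: tau_classB.
Qed.

End Kernel.

(** * Boundaries as signed sums of graphs *)

Section BoundaryTaus.
Variables (R : realType) (G : cantor_groupoid R).
Hypothesis hp : principal G.
Implicit Types (g h k u : G) (x y z w : units G) (U V W D P : set G).
Implicit Types (A B S : set (units G)) (a b c : full_group G).

(** Negative terms get a list of their own, to be moved across when sums of graphs are compared. *)
Definition off_units (f : G -> int) (s t : seq (full_group G)) : Prop :=
  forall u, ~ range (@gid G) u ->
    f u = \sum_(a <- s) ind (graph a) u - \sum_(a <- t) ind (graph a) u.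

Lemma boundary2_subset U V (B : set (G2 G)) : compact_open_Gset U ->
  compact_open_Gset V -> copen B -> B `<=` pairs U V ->
  exists U' V', [/\ compact_open_Gset U', compact_open_Gset V', src U' = rng V',
    U' `<=` U /\ V' `<=` V &
    forall g, boundary2 (indc B) g =
      ind V' g - ind (set_mul U' V') g + ind U' g].
Proof.
move=> cU cV coB BUV.
have [U' [V' [cU' cV' -> e sub]]] := subset_pairs cU cV coB BUV.
exists U', V'; split=> // g; rewrite boundary2_pairs //; last 2 first.
- exact: cob_copen.
- by move=> v w; exact: (cob_rng_inj cV').
have -> : V' `&` @grng G @^-1` src U' = V'.
  by apply/setIidl => v Vv /=; rewrite e; exists v.
by have -> : U' `&` @gsrc G @^-1` rng V' = U' by apply/setIidl => v Vv /=;
  rewrite -e; exists v.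
Qed.

Lemma adm_of_nbhs A B U : A `&` B = set0 -> compact_open_Gset U ->
  (forall g, U g -> A (gsrc g)) -> (forall g, U g -> B (grng g)) -> adm U.
Proof.
move=> AB cU UA UB; split=> //; rewrite -subset0 -AB => _ [[g Ug <-] [h Uh e]].
by split; [rewrite -e; exact: UA|exact: UB].
Qed.

Lemma ind_graph_tau U u : adm U -> ~ range (@gid G) u ->
  ind (graph (tau U)) u = ind U u + ind (inv_set U) u.
Proof.
move=> aU nu; rewrite -indU_disjoint; last first.
  by move=> [Uu Uu']; apply: (adm_neq aU Uu' Uu); rewrite grng_inv.
by apply: ind_equiv; exact: graph_tau.
Qed.

(* For disjoint sources and ranges [tau V * tau U] permutes cyclically the source
   of [V], the common set [src U = rng V], and the range of [U]. *)
Lemma ind_graph_cycle U V A B C u : compact_open_Gset U ->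
  compact_open_Gset V ->
  src U = rng V -> A `&` B = set0 -> B `&` C = set0 -> A `&` C = set0 ->
  (forall g, V g -> A (gsrc g)) -> (forall g, V g -> B (grng g)) ->
  (forall g, U g -> C (grng g)) -> ~ range (@gid G) u ->
  ind (graph (tau V * tau U)%g) u + ind (set_mul U V) u =
  ind V u + ind U u + ind (graph (tau (set_mul U V))) u.
Proof.
move=> cU cV e AB BC AC VA VB UC nu.
have UB g : U g -> B (gsrc g).
  by move=> Ug; have [v Vv <-] : rng V (gsrc g) by [rewrite -e; exists g];
    exact: VB.
have cW := compact_open_Gset_mul cU cV; set W := set_mul U V in cW *.
have WA g : W g -> A (gsrc g).
  by move=> [a [b [Ua Vb ab ->]]]; rewrite gsrc_mul //; exact: VA.
have WC g : W g -> C (grng g).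
  by move=> [a [b [Ua Vb ab ->]]]; rewrite grng_mul //; exact: UC.
have aV : adm V by exact: adm_of_nbhs AB cV VA VB.
have aU : adm U by exact: adm_of_nbhs BC cU UB UC.
have aW : adm W by exact: adm_of_nbhs AC cW WA WC.
rewrite ind_graph_tau // [ind W u + _]addrC addrA; congr (_ + _).
have nAB x : A x -> B x -> False by move=> Ax Bx; rewrite -[False]/(set0 x) -AB.
have nBC x : B x -> C x -> False by move=> Bx Cx; rewrite -[False]/(set0 x) -BC.
have nAC x : A x -> C x -> False by move=> Ax Cx; rewrite -[False]/(set0 x) -AC.
have nVU : ~ (V u /\ U u) by move=> [/VA Au /UB Bu]; exact: nAB Au Bu.
have nW : ~ ((V `|` U) u /\ inv_set W u).
  move=> [VUu /WC]; rewrite grng_inv => Cu.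
  by case: VUu => [/VA Au|/UB Bu]; [exact: nAC Au Cu|exact: nBC Bu Cu].
rewrite -(indU_disjoint nVU) -(indU_disjoint nW); apply: ind_equiv.
have sVA x : src V x -> A x by move=> [v Vv <-]; exact: VA.
have rVB x : rng V x -> B x by move=> [v Vv <-]; exact: VB.
have rUC x : rng U x -> C x by move=> [v Vv <-]; exact: UC.
have fixU g : V g -> tau U (gsrc g) = gsrc g.
  move=> /VA Ag; apply: tau_out => //; first by rewrite e => /rVB; exact: nAB.
  by move=> /rUC; exact: nAC.
have fixV g : U g -> tau V (grng g) = grng g.
  move=> /UC Cg; apply: tau_out => //; first by move=> /sVA Ag;
    exact: nAC Ag Cg.
  by move=> /rVB Bg; exact: nBC Bg Cg.
have cyc g h : U g -> V h -> gsrc g = grng h -> tau V (tau U (grng g)) = gsrc h.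
  by move=> Ug Vh gh; rewrite tau_rng // gh tau_rng.
have gE : graph (tau V * tau U)%g u <-> tau V (tau U (gsrc u)) = grng u by [].
split=> [/gE|[[Vu|Uu]|Wu]]; [|apply/gE|apply/gE|apply/gE].
- have [[v Vv vu]|nV] := pselect (src V (gsrc u)).
    rewrite -vu fixU // tau_src // => r; left; left.
    by rewrite (arrow_unique hp (esym vu) (esym r)).
  have [[w Uw wu]|nU] := pselect (src U (gsrc u)).
    rewrite -wu tau_src // fixV // => r; left; right.
    by rewrite (arrow_unique hp (esym wu) (esym r)).
  have [[w Uw wu]|nU'] := pselect (rng U (gsrc u)).
    have [v Vv vw] : rng V (gsrc w) by rewrite -e; exists w.
    rewrite -wu (cyc w v) // => r; right; rewrite /inv_set /=.
    have <- : gmul w v = ginv u.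
      by apply: (arrow_unique hp);
        rewrite ?gsrc_mul ?grng_mul ?gsrc_inv ?grng_inv.
    by exists w, v.
  rewrite (tau_out aU) // tau_out // -?e // => r.
  by case: nu; apply: hp.
- by rewrite fixU // tau_src.
- by rewrite tau_src // fixV.
have [w [v [Uw Vv vw uE]]] := Wu.
have su : gsrc u = grng w by rewrite -grng_inv uE grng_mul.
by rewrite su (cyc w v) // -gsrc_inv uE gsrc_mul.
Qed.

(** By additivity only pairs near a given (g1, g2) matter, and the outcome depends on which of the
    source of [g2], the common middle point and the range of [g1] coincide. *)
Lemma boundary_taus (h : Cc (G2 G)) : exists s t,
  [/\ tau_class (\sum_(a <- s) ab_class a),
    tau_class (\sum_(a <- t) ab_class a) &
     off_units (boundary2 h) s t].
Proof.
pose P (h : Cc (G2 G)) := exists s t,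
  [/\ tau_class (\sum_(a <- s) ab_class a),
    tau_class (\sum_(a <- t) ab_class a) &
     off_units (boundary2 h) s t].
have PN f : P f -> P (- f).
  move=> [s [t [ts tt E]]]; exists t, s; split=> // u nu.
  by rewrite boundary2N -[LHS]/(- boundary2 f u) E // opprB.
have nil0 : tau_class (\sum_(a <- [::]) ab_class (a : full_group G)).
  by rewrite big_nil; exact: tau_class0.
apply: (Cc_ind (@G2_hausdorff _ G) (P := P)).
- exists [::], [::]; split=> // u _; rewrite !big_nil boundary2_0 subrr //.
- move=> f1 f2 [s1 [t1 [ts1 tt1 e1]]] [s2 [t2 [ts2 tt2 e2]]].
  exists (s1 ++ s2), (t1 ++ t2); split; rewrite ?big_cat; try exact: tau_classD.
  move=> u nu; rewrite boundary2D -[LHS]/(boundary2 f1 u + boundary2 f2 u) e1 // e2 //.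
  by rewrite !big_cat /= opprD addrACA.
move=> p _.
suff [U [V [cU cV Up PUV]]] : exists U V, [/\ compact_open_Gset U,
    compact_open_Gset V, pairs U V p &
    forall U' V', compact_open_Gset U' -> compact_open_Gset V' ->
      src U' = rng V' -> U' `<=` U -> V' `<=` V -> exists s t,
      [/\ tau_class (\sum_(a <- s) ab_class a),
        tau_class (\sum_(a <- t) ab_class a) &
      off_units (fun g => ind V' g - ind (set_mul U' V') g + ind U' g) s t]].
  exists (pairs U V); split=> //; first by apply: pairs_copen; exact: cob_copen.
  move=> B coB BUV.
  have [U' [V' [cU' cV' e [UU VV] bE]]] := boundary2_subset cU cV coB BUV.
  have [s [t [ts tt E]]] := PUV U' V' cU' cV' e UU VV.
  have PB : P (indc B) by exists s, t; split=> // u nu; rewrite bE E.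
  by split=> //; exact: PN.
have offgid D u : D `<=` range (@gid G) -> ~ range (@gid G) u -> ind D u = 0.
  by move=> Dg nu; rewrite indF // => /Dg.
case: p => -[g1 g2] gP; have e12 : gsrc g1 = grng g2 := set_mem gP.
set p := exist _ _ _; have pE : val p = (g1, g2) by [].
(* With [V'] made of units, the product cancels [U'] and nothing survives off the units. *)
have [r2|n2] := pselect (range (@gid G) g2).
  have [U [cU U1 _]] := @cob_nbhs _ G g1 setT filterT.
  exists U, (range (@gid G)); split=> //; first exact/cob_gid/clopenT.
  move=> U' V' cU' cV' e UU VV; exists [::], [::]; split=> // u nu.
  rewrite !big_nil subrr offgid // sub0r (_ : set_mul U' V' = U') ?addNr //.
  apply/seteqP; split=> [_ [a [b [Ua Vb ab ->]]]|a Ua].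
    by have [x _ xb] := VV _ Vb; rewrite -xb grng_id in ab *;
      rewrite -ab gmul1r.
  have [b Vb ba] : rng V' (gsrc a) by rewrite -e; exists a.
  have [x _ xb] := VV _ Vb.
  exists a, b; split=> //; rewrite -xb in ba *; rewrite grng_id in ba.
  by rewrite ba gmul1r.
(* Likewise with [U'] made of units: the product cancels [V']. *)
have [r1|n1] := pselect (range (@gid G) g1).
  have [V [cV V2 _]] := @cob_nbhs _ G g2 setT filterT.
  exists (range (@gid G)), V; split=> //; first exact/cob_gid/clopenT.
  move=> U' V' cU' cV' e UU VV; exists [::], [::]; split=> // u nu.
  rewrite !big_nil subrr [ind U' u]offgid // addr0.
  rewrite (_ : set_mul U' V' = V') ?subrr //.
  apply/seteqP; split=> [_ [a [b [Ua Vb ab ->]]]|b Vb].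
    by have [x _ xa] := UU _ Ua; rewrite -xa gsrc_id in ab *; rewrite ab gmul1l.
  have [a Ua ab] : src U' (grng b) by rewrite e; exists b.
  have [x _ xa] := UU _ Ua.
  exists a, b; split=> //; rewrite -xa in ab *; rewrite gsrc_id in ab.
  by rewrite ab gmul1l.
have ne g : ~ range (@gid G) g -> grng g <> gsrc g by move=> ng /hp.
(* Here [g1] is the inverse of [g2]: the product consists of units, and the other two terms form the
   graph of one transposition. *)
have [r12|n12] := pselect (grng g1 = gsrc g2).
  have [V aV V2] := small_adm (ne _ n2); have [cV _] := aV.
  exists (inv_set V), V; split=> //; first exact: cob_inv.
    split=> //; rewrite pE /inv_set /=.
    have -> // : ginv g1 = g2.
    by apply: (arrow_unique hp); rewrite ?gsrc_inv ?grng_inv.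
  move=> U' V' cU' cV' e UU VV.
  have aV' : adm V' by apply: (adm_sub aV) => //; exact: cob_copen.
  exists [:: tau V'], [::]; rewrite !big_seq1; split=> //;
    first exact: tau_class_tau.
  move=> u nu; rewrite big_seq1 big_nil subr0 ind_graph_tau // [ind (set_mul _ _) u]offgid //.
    rewrite subr0; congr (_ + _); congr (ind _ u).
    apply/seteqP; split=> a.
      move=> Ua; have [b Vb ba] : rng V' (gsrc a) by rewrite -e; exists a.
      rewrite /inv_set /=; have -> // : ginv a = b.
      by apply: (cob_rng_inj cV); [exact: UU|exact: VV|rewrite grng_inv].
    rewrite /inv_set /= => Va.
    have [b Ub ba] : src U' (grng (ginv a)) by rewrite e; exists (ginv a).
    have -> // : a = b; apply: (cob_src_inj (cob_inv cV));
      last by rewrite ba grng_inv.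
      by rewrite /inv_set /=; exact: VV.
    exact: UU.
  move=> _ [a [b [Ua Vb ab ->]]].
  have -> : b = ginv a by apply: (cob_rng_inj cV);
    [exact: VV|exact: UU|rewrite grng_inv].
  by rewrite gmulVr; exists (grng a).
(* Three distinct points, with disjoint clopen neighbourhoods [A], [B'], [C']. The boundary is the
   graph of a 3-cycle minus that of the transposition given by the product. *)
pose x := gsrc g2; pose y := grng g2; pose z := grng g1.
have avoid x0 (s : seq (units G)) : x0 \notin s ->
    exists N, [/\ clopen N, N x0 & forall w, w \in s -> ~ N w].
  move=> ns; have [|N [cN Nx Ns]] :=
    @units_clopen_nbhs _ G x0 [set w | w \notin s].
    by apply: open_nbhs_nbhs; split=> //; exact: open_avoid.
  by exists N; split=> // w ws /Ns /=; rewrite ws.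
have xy : x != y by apply/eqP => e; exact: (ne _ n2 (esym e)).
have yz : y != z by apply/eqP => e; apply: (ne _ n1); rewrite e12.
have xz : x != z by apply/eqP => e; apply: n12.
have [|A [cA Ax nA]] := avoid x [:: y; z].
  by rewrite !inE negb_or xy xz.
have [|B [cB By nB]] := avoid y [:: z]; first by rewrite inE.
pose B' := B `&` ~` A; pose C' := ~` B `&` ~` A.
have cB' : clopen B' by apply: clopenI => //; exact: clopen_setC.
have cC' : clopen C' by apply: clopenI; exact: clopen_setC.
have B'y : B' y by split=> //; apply: nA; rewrite mem_head.
have C'z : C' z by split; [apply: nB; rewrite mem_head|apply: nA;
  rewrite !inE eqxx orbT].
have [V [cV V2 VS]] := cob_nbhs_clopen (clopenI (gsrc_preimage_clopen cA)
  (grng_preimage_clopen cB')) (conj Ax B'y).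
have [U [cU U1 US]] :=
  cob_nbhs_clopen (grng_preimage_clopen cC') (C'z : C' (grng g1)).
exists U, V; split=> // U' V' cU' cV' e UU VV.
have aB : A `&` B' = set0 by rewrite -subset0 => w [Aw [_ /(_ Aw)]].
have bC : B' `&` C' = set0 by rewrite -subset0 => w [[Bw _] [/(_ Bw)]].
have aC : A `&` C' = set0 by rewrite -subset0 => w [Aw [_ /(_ Aw)]].
have VA g : V' g -> A (gsrc g) by move=> /VV/VS[].
have VB g : V' g -> B' (grng g) by move=> /VV/VS[].
have UC g : U' g -> C' (grng g) by move=> /UU/US.
have aV : adm V' by exact: adm_of_nbhs aB cV' VA VB.
have aU : adm U'.
  apply: adm_of_nbhs bC cU' _ UC => g Ug.
  by have [v Vv <-] : rng V' (gsrc g) by [rewrite -e; exists g]; exact: VB.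
have aW : adm (set_mul U' V').
  apply: adm_of_nbhs aC (compact_open_Gset_mul cU' cV') _ _ =>
    _ [a [b [Ua Vb ab ->]]].
    by rewrite gsrc_mul //; exact: VA.
  by rewrite grng_mul //; exact: UC.
exists [:: (tau V' * tau U')%g], [:: tau (set_mul U' V')]; rewrite !big_seq1;
  split.
- by rewrite ab_class_mul; apply: tau_classD; exact: tau_class_tau.
- exact: tau_class_tau.
move=> u nu; rewrite !big_seq1; apply/eqP; rewrite eq_sym subr_eq; apply/eqP.
have := ind_graph_cycle cU' cV' e aB bC aC VA VB UC nu.
move: (ind (graph (tau V' * tau U')%g) u) (ind (set_mul U' V') u) => X m E.
by rewrite -[X](addrK m) E [_ - m + _]addrAC [RHS]addrAC.
Qed.

Hypothesis haf : almost_finite G.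

(** With the negative terms moved across, [a :: t] and [s] have the same sum of graphs off the
    units. By principality the value at the arrow from [z] to [w] counts the elements sending [z] to
    [w]. *)
Lemma index_kernel a (h : Cc (G2 G)) : ind (graph a) = boundary2 h ->
  tau_class (ab_class a).
Proof.
move=> ah; have [s [t [ts tt E]]] := boundary_taus h.
have : tau_class (\sum_(b <- a :: t) ab_class b - \sum_(b <- s) ab_class b).
  apply: (full_relation hp haf) => z w zw.
  have cE (r : seq (full_group G)) : (\sum_(b <- r) ((b z == w) : nat))%N =
      count (fun b : full_group G => b z == w) r.
    by rewrite -sum1_count [RHS]big_mkcond; apply: eq_bigr => b _; case: ifP.
  have [[u [uz uw]]|nu] := pselect (exists u : G, gsrc u = z /\ grng u = w);
    last first.
    have n0 (r : seq (full_group G)) :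
        count (fun b : full_group G => b z == w) r = 0%N.
      rewrite (eq_count (a2 := pred0)) ?count_pred0 // => b; apply/eqP => bz;
        apply: nu.
      by have [u [_ uz ub]] := graph_arrow hp b z; exists u; rewrite uz ub.
    by rewrite !n0.
  have nr : ~ range (@gid G) u.
    by move=> [x _ xu]; move: zw; rewrite -uz -uw -xu gsrc_id grng_id eqxx.
  have iE (r : seq (full_group G)) : \sum_(b <- r) ind (graph b) u =
      (count (fun b : full_group G => b z == w) r)%:R.
    rewrite -cE natr_sum; apply: eq_bigr => b _; rewrite /ind; congr (_ %:R);
      congr nat_of_bool.
    by rewrite /graph /= uz uw; apply/asboolP/eqP.
  have := E u nr; rewrite -ah !iE => /eqP;
    rewrite eq_sym subr_eq eq_sym => /eqP.
  rewrite -[ind (graph a) u](big_seq1 +%R a (fun b : full_group G =>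
    ind (graph b) u)).
  rewrite iE -natrD => /eqP; rewrite eqr_nat => /eqP <-.
  by rewrite /= addn0.
rewrite big_cons -addrA => H.
rewrite -[ab_class a](addrK (\sum_(b <- t) ab_class b - \sum_(b <- s) ab_class b)).
by apply: tau_classB => //; exact: tau_classB.
Qed.

End BoundaryTaus.

(** * The index map *)

Section Index.
Variables (R : realType) (G : cantor_groupoid R).
Hypothesis hp : principal G.
Implicit Types (g h k u : G) (x y z w : units G) (U V W D P : set G).
Implicit Types (A B S : set (units G)) (a b c : full_group G).

Let hG := @arrows_hausdorff G.

Definition mkcycle (f : Cc G) (f0 : boundary1 f = 0) : cycles1 G :=
  MkCycles1 (asboolT f0 : f \in @is_cycle1 G).

Lemma homology1_class_eq (z z' : cycles1 G) :
  homology1_class z = homology1_class z' <->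
  exists h : Cc (G2 G), (z : Cc G) - (z' : Cc G) = boundary2 h :> (G -> int).
Proof.
have E : (z - z' \in @is_boundary1 G) =
    (z == z' %[mod Quotient.quot (GRing.ZmodClosed.clone _ (@is_boundary1 G) _)])%qT.
  exact: Quotient.idealrBE.
split=> [e|e].
  have : z - z' \in @is_boundary1 G by rewrite E; apply/eqP.
  by move=> /asboolP.
by apply/eqP; rewrite -E; apply/asboolP.
Qed.

Lemma homology1_classB (z z' : cycles1 G) :
  homology1_class (z - z') = homology1_class z - homology1_class z'.
Proof. by rewrite /homology1_class !piE. Qed.

Lemma homology1_class0 (z : cycles1 G) : homology1_class z = 0 <->
  exists h : Cc (G2 G), z = boundary2 h :> (G -> int).
Proof.
have z0 : homology1_class (0 : cycles1 G) = 0.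
  by have := homology1_classB 0 0; rewrite !subrr.
rewrite -z0 homology1_class_eq.
by rewrite (_ : (z : Cc G) - ((0 : cycles1 G) : Cc G) = z) // subr0.
Qed.

Lemma boundary1_graph a : boundary1 (indc (graph a)) = 0.
Proof.
rewrite boundary1_ind; last exact: graph_cob.
by rewrite src_graph // rng_graph // subrr.
Qed.

Definition graph_cycle a : cycles1 G := mkcycle (boundary1_graph a).

Definition idx a : homology1 G := homology1_class (graph_cycle a).

Lemma graph_mul a b : graph (a * b)%g = set_mul (graph a) (graph b).
Proof.
by apply/esym/(theta_graph hp)/theta_comp; exact: full_theta.
Qed.

Lemma idxM a b : idx (a * b)%g = idx a + idx b.
Proof.
apply/eqP; rewrite addrC -subr_eq eq_sym -homology1_classB; apply/eqP.
have [|_ [h hE]] := bounds_mul (graph_cob hp a) (graph_cob hp b).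
  by rewrite src_graph // rng_graph.
apply/homology1_class_eq; exists h; rewrite -hE -graph_mul.
apply/funext => g; rewrite -[RHS]/(indc (graph a) g + indc (graph b) g - _).
rewrite -[LHS]/(indc (graph b) g - (indc (graph (a * b)%g) g - indc (graph a) g)).
by rewrite opprB addrA [indc (graph b) g + _]addrC.
Qed.

Lemma idx1 : idx 1%g = 0.
Proof.
by have /eqP := idxM 1%g 1%g; rewrite mulg1 eq_sym -subr_eq0 addrK => /eqP.
Qed.

Lemma idxV a : idx (a^-1)%g = - idx a.
Proof. by apply/eqP; rewrite -addr_eq0 -idxM mulVg idx1. Qed.

(** The derived subgroup is the intersection of all subgroups containing the commutators, and the
    kernel of [idx] is one of them. *)
Lemma index_exists : exists I : abelianization (full_group G) -> homology1 G,
  (forall a, I (ab_class a) = idx a) /\ forall s t, I (s - t) = I s - I t.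
Proof.
pose I (t : abelianization (full_group G)) := idx (ab_repr t).
have IE a : I (ab_class a) = idx a.
  have /ab_classP /(_ [set c | idx c = 0]) :
    ab_class (ab_repr (ab_class a)) = ab_class a.
    exact: ab_reprK.
  have H : is_subgroup [set c : full_group G | idx c = 0].
    split=> /= [|x y x0 y0|x x0]; first exact: idx1.
      by rewrite idxM x0 y0 addr0.
    by rewrite idxV x0 oppr0.
  move=> /(_ H); have C b c : [set c : full_group G | idx c = 0] [~ b, c]%g.
    rewrite /= /commg /conjg !idxM !idxV.
    by rewrite [idx b + _]addrC addKr addNr.
  move=> /(_ C) /=; rewrite idxM idxV => /eqP.
  by rewrite addrC subr_eq0 => /eqP ->.
exists I; split=> // s t.
by rewrite -(ab_reprK s) -(ab_reprK t) -ab_class_inv -ab_class_mul !IE idxM idxV.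
Qed.

(** The graph splits into [U] with its inverse and the units over the points not moved; both parts
    bound. *)
Lemma idx_tau U : adm U -> idx (tau U) = 0.
Proof.
move=> aU; have [cU dU] := aU; have cI := cob_inv cU.
have cM : clopen (moved U).
  by apply: clopenU; [apply: src_clopen|apply: rng_clopen]; exact: cob_copen.
have cE := cob_gid (clopen_setC cM).
apply/homology1_class0 => /=.
have [_ [h hE]] := boundsD (bounds_inv cU) (bounds_gid (clopen_setC cM)).
exists h; rewrite -hE; apply/funext => g; rewrite !CcD !indcE //;
  try by apply: cob_copen => //; exact: graph_cob.
have [[x _ xg]|ng] := pselect (range (@gid G) g); last first.
  rewrite ind_graph_tau // (@indF _ (@gid G @` _)) ?addr0 // => -[x _ xg].
  by apply: ng; exists x.
rewrite (@indF _ U) ?(@indF _ (inv_set U)) ?addr0 ?add0r; last 2 first.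
- move=> Ug; apply: (adm_neq aU Ug Ug).
  by rewrite gsrc_inv grng_inv -xg gsrc_id grng_id.
- by move=> Ug; apply: (adm_neq aU Ug Ug); rewrite -xg gsrc_id grng_id.
apply: ind_equiv; rewrite -xg /graph /= gsrc_id grng_id; split=> [tx|[y nm yx]].
  exists x => // -[[v Vv vx]|[v Vv vx]].
    by apply: (adm_neq aU Vv Vv); rewrite -(tau_src aU Vv) vx.
  by apply: (adm_neq aU Vv Vv); rewrite -(tau_rng aU Vv) vx.
have <- : y = x by rewrite -(gsrc_id y) yx gsrc_id.
by apply: tau_out => // H; apply: nm; [left|right].
Qed.

End Index.

(** * Surjectivity of the index map *)

Section Surjectivity.
Variables (R : realType) (G : cantor_groupoid R).
Hypothesis hp : principal G.
Implicit Types (g h k u : G) (x y z w : units G) (U V W D P : set G).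

Let hG := @arrows_hausdorff G.

(** Modulo boundaries, the negative of the indicator of a bisection is the indicator of its inverse,
    so signs can be removed; multiplicities become repetitions in the list. *)
Lemma cycle_cobs (f : Cc G) : exists l : seq (set G),
  (forall i, compact_open_Gset (nth set0 l i)) /\
  bounds (f - \sum_(D <- l) indc D).
Proof.
have nilP i : compact_open_Gset (nth set0 [::] i : set G).
  by rewrite nth_nil; have [] := @adm0 _ G.
pose P (f : Cc G) := exists l : seq (set G),
  (forall i, compact_open_Gset (nth set0 l i)) /\
  bounds (f - \sum_(D <- l) indc D).
apply: (Cc_ind hG (P := P)).
- by exists [::]; split; rewrite // big_nil subr0; exact: bounds0.
- move=> f1 f2 [l1 [c1 b1]] [l2 [c2 b2]]; exists (l1 ++ l2); split.
    by move=> i; rewrite nth_cat; case: ifP.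
  by rewrite big_cat /= opprD addrACA; exact: boundsD.
move=> g _; have [N [cN Ng _]] := @cob_nbhs _ G g setT filterT.
exists N; split=> //; first exact: cob_copen.
move=> B coB BN; have cB := cob_sub cN coB BN; split.
  exists [:: B]; split; first by case=> // i; exact: nilP.
  by rewrite big_seq1 subrr; exact: bounds0.
exists [:: inv_set B]; split.
  by case=> [|i]; [exact: cob_inv|exact: nilP].
by rewrite big_seq1 -opprD; apply/boundsN/bounds_inv.
Qed.

Variable K : set G.
Hypothesis oK : open K.
Hypothesis sK : subgroupoid K.
Hypothesis cK : compact K.
Hypothesis uK : range (@gid G) `<=` K.

Let clK : clopen K. Proof. by apply: copen_arrows_clopen; split. Qed.

Definition supported (f : Cc G) : Prop := forall g, f g != 0 -> K g.

Lemma supportedB (f1 f2 : Cc G) :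
  supported f1 -> supported f2 -> supported (f1 - f2).
Proof.
move=> s1 s2 g; apply: contra_neqP => nK; rewrite CcB.
have [/eqP ->] : f1 g == 0 by apply: contra_notT nK; exact: s1.
by have [/eqP ->] : f2 g == 0 by [apply: contra_notT nK; exact: s2];
  rewrite subr0.
Qed.

Lemma supported_indc U : copen U -> U `<=` K -> supported (indc U).
Proof.
by move=> cU UK g; apply: contra_neqP => nK; rewrite indcE // indF // => /UK.
Qed.

Lemma supported0 : supported 0. Proof. by move=> g; rewrite eqxx. Qed.

Lemma K_inv_set P : P `<=` K -> inv_set P `<=` K.
Proof.
by move=> PK g Pg; rewrite -[g]ginvK; case: sK => + _; apply; exact: PK.
Qed.

(** The two count equations carry the recursion: they show that the orbits still have room, on the
    source and on the range side, for the next bisection. *)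
Lemma pack (l : seq (set G)) : (forall i, compact_open_Gset (nth set0 l i)) ->
  (forall x, \sum_(D <- l) kcount K (src (D `\` K)) x <= size (korb K x))%N ->
  (forall x, \sum_(D <- l) kcount K (rng (D `\` K)) x <= size (korb K x))%N ->
  exists V f, [/\ compact_open_Gset V, supported f,
    bounds (\sum_(D <- l) indc D - indc V - f),
    forall x, kcount K (src V) x =
      (\sum_(D <- l) kcount K (src (D `\` K)) x)%N &
    forall x, kcount K (rng V) x =
      (\sum_(D <- l) kcount K (rng (D `\` K)) x)%N].
Proof.
elim: l => [|D l IH] cl sl rl.
  have kc0 x : kcount K set0 x = 0%N.
    by rewrite /kcount (eq_count (a2 := pred0)) ?count_pred0 // => y;
      rewrite asboolF.
  exists set0, 0; split.
  - by have [] := @adm0 _ G.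
  - exact: supported0.
  - rewrite big_nil subr0 sub0r (_ : indc set0 = 0) ?oppr0;
      first exact: bounds0.
    by apply: Cc_ext => g; rewrite indcE ?indF //; exact: copen0.
  - by move=> x; rewrite big_nil /src image_set0.
  - by move=> x; rewrite big_nil /rng image_set0.
have [|x|x|V [f [cV sf bV sV rV]]] := IH.
- by move=> i; exact: (cl i.+1).
- by apply: leq_trans (sl x); rewrite big_cons leq_addl.
- by apply: leq_trans (rl x); rewrite big_cons leq_addl.
have cD : compact_open_Gset D := cl 0%N.
pose D' := D `\` K; have cD' : compact_open_Gset D' by exact: cobD.
have csV := src_clopen (cob_copen cV); have crV := rng_clopen (cob_copen cV).
have csD := src_clopen (cob_copen cD'); have crD := rng_clopen (cob_copen cD').
have [x|P [cP PK sP rP]] := transport_le oK sK cK uK csD (clopen_setC csV).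
  have := kcountC K (src V) x; have := sl x.
  by rewrite big_cons -sV -/D'; lia.
have [x|Q [cQ QK sQ rQ]] := transport_le oK sK cK uK crD (clopen_setC crV).
  have := kcountC K (rng V) x; have := rl x.
  by rewrite big_cons -rV -/D'; lia.
have cP' := cob_inv cP.
have e1 : src D' = rng (inv_set P) by rewrite rng_inv_set sP.
(* [W] is [D'] translated by [P] and [Q] so that its source and range avoid those of [V]. As [P] and
   [Q] lie in [K], it differs from [D'] by a boundary and a chain supported in [K]. *)
pose E := set_mul D' (inv_set P).
have cE : compact_open_Gset E by exact: compact_open_Gset_mul.
have e2 : src Q = rng E by rewrite rng_mul.
pose W := set_mul Q E.
have cW : compact_open_Gset W by exact: compact_open_Gset_mul.
have sW : src W = rng P by rewrite !src_mul // src_inv_set.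
have rW : rng W = rng Q by rewrite rng_mul.
have sVW : src V `&` src W = set0.
  by rewrite sW -subset0 => x [Vx /rP].
have rVW : rng V `&` rng W = set0.
  by rewrite rW -subset0 => x [Vx /rQ].
have VW : V `&` W = set0.
  by rewrite -subset0 => g [Vg Wg]; rewrite -[set0 g]/(set0 (gsrc g)) -sVW;
    split; exists g.
have cDK : copen (D `&` K) by apply: copenI => //; exact: cob_copen.
exists (V `|` W), (f + indc (D `&` K) - indc (inv_set P) - indc Q); split.
- exact: cobU.
- apply: supportedB; last by apply: supported_indc => //; exact: cob_copen.
  apply: supportedB; last first.
    by apply: supported_indc; [exact: cob_copen|exact: K_inv_set].
  rewrite -[indc (D `&` K)]opprK; apply: supportedB => //.
  rewrite -[- indc _]add0r; apply: supportedB; first exact: supported0.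
  by apply: supported_indc => // g [].
- have b1 := bounds_mul cD' cP' e1; have b2 := bounds_mul cQ cE e2.
  rewrite -/E in b1; rewrite -/W in b2.
  have := boundsD bV (boundsD b1 b2).
  congr bounds; rewrite big_cons (indcU hG (cob_copen cV) (cob_copen cW) VW).
  have -> : indc D = indc D' + indc (D `&` K).
    rewrite -indcU //; [|exact: cob_copen|].
      by congr indc; rewrite /D' setUC setUIDK.
    by rewrite -subset0 => g [[_ nK] [_ /nK]].
  move: (\sum_(_ <- _) _) (indc V) (indc D') (indc (inv_set P)) (indc E) (indc Q)
    (indc W) (indc (D `&` K)) => s v d p e q w m.
  apply: Cc_ext => g; rewrite !(CcD, CcB, CcN).
  move: (s g) (v g) (d g) (p g) (e g) (q g) (w g) (m g) (f g); lia.
- move=> x; rewrite big_cons -sV -/D' -sP (kcount_src_rng hp sK cK x cP PK) -sW.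
  rewrite -kcountU; last by rewrite setIC.
  by congr (kcount _ _ x); rewrite setUC; exact: image_setU.
move=> x; rewrite big_cons -rV -/D' -sQ (kcount_src_rng hp sK cK x cQ QK) -rW.
rewrite -kcountU; last by rewrite setIC.
by congr (kcount _ _ x); rewrite setUC; exact: image_setU.
Qed.

(** In a cycle each point is as often a source as a range. Within an orbit the arrows of [K]
    contribute equally to both, hence so do the remaining ones. *)
Lemma balanced (l : seq (set G)) :
  (forall i, compact_open_Gset (nth set0 l i)) ->
  boundary1 (\sum_(D <- l) indc D) = 0 ->
  forall x, (\sum_(D <- l) kcount K (src (D `\` K)) x =
             \sum_(D <- l) kcount K (rng (D `\` K)) x)%N.
Proof.
move=> cl b0 x.
have b1 z : \sum_(D <- l) ind (src D) z = \sum_(D <- l) ind (rng D) z.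
  apply/eqP; rewrite -subr_eq0.
  suff -> : \sum_(D <- l) ind (src D) z - \sum_(D <- l) ind (rng D) z =
      boundary1 (\sum_(D <- l) indc D) z by rewrite b0.
  elim: l cl {b0} => [|D l IH] cl; first by rewrite !big_nil boundary1_0 subrr.
  rewrite !big_cons boundary1D (boundary1_ind (cl 0%N)).
  rewrite -[RHS]/((ind (src D) z - ind (rng D) z) + boundary1 (\sum_(D <- l) indc D) z).
  rewrite -IH; last by move=> i; exact: (cl i.+1).
  by rewrite opprD addrACA.
have sums (F : set G -> set (units G)) :
    ((\sum_(D <- l) kcount K (F D) x)%N)%:R =
    \sum_(z <- korb K x) \sum_(D <- l) ind (F D) z :> int.
  rewrite natr_sum exchange_big /=; apply: eq_bigr => D _.
  rewrite /kcount -sum1_count big_mkcond natr_sum /=; apply: eq_bigr => z _.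
  by rewrite /ind; case: asbool.
have tot : (\sum_(D <- l) kcount K (src D) x =
  \sum_(D <- l) kcount K (rng D) x)%N.
  apply/eqP; rewrite -(eqr_nat int) !sums; apply/eqP.
  by apply: eq_bigr => z _; exact: b1.
have split_ (D : set G) : compact_open_Gset D ->
    kcount K (src D) x = (kcount K (src (D `\` K)) x + kcount K (src (D `&` K)) x)%N /\
    kcount K (rng D) x = (kcount K (rng (D `\` K)) x + kcount K (src (D `&` K)) x)%N.
  move=> cD; have cDK : compact_open_Gset (D `&` K) by exact: cobI.
  have DE : D = D `\` K `|` D `&` K by rewrite setUC setUIDK.
  split; last rewrite (kcount_src_rng hp sK cK x cDK); last by move=> g [].
    rewrite -kcountU; last first.
      rewrite -subset0 => _ [[g [Dg nK] <-] [g' [Dg' Kg'] e]].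
      by apply: nK; rewrite -(cob_src_inj cD Dg' Dg e).
    by congr (kcount _ _ x); rewrite {1}DE; exact: image_setU.
  rewrite -kcountU; last first.
    rewrite -subset0 => _ [[g [Dg nK] <-] [g' [Dg' Kg'] e]].
    by apply: nK; rewrite -(cob_rng_inj cD Dg' Dg e).
  by congr (kcount _ _ x); rewrite {1}DE; exact: image_setU.
have : (\sum_(D <- l) kcount K (src D) x =
    \sum_(D <- l) kcount K (src (D `\` K)) x +
    \sum_(D <- l) kcount K (src (D `&` K)) x /\
  \sum_(D <- l) kcount K (rng D) x =
    \sum_(D <- l) kcount K (rng (D `\` K)) x +
    \sum_(D <- l) kcount K (src (D `&` K)) x)%N.
  elim: l cl {b0 b1 sums tot} => [|D l IH] cl; first by rewrite !big_nil.
  have [] := IH (fun i => cl i.+1); have [] := split_ D (cl 0%N).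
  by rewrite !big_cons; lia.
by rewrite tot => -[]; lia.
Qed.

End Surjectivity.

Section IndexSurjective.
Variables (R : realType) (G : cantor_groupoid R).
Hypothesis hp : principal G.
Hypothesis haf : almost_finite G.

Lemma idx_surjective (c : homology1 G) : exists a, idx hp a = c.
Proof.
have hG := @arrows_hausdorff G.
pose z := repr c; have zc : homology1_class z = c by exact: reprK.
pose f : Cc G := z.
have f0 : boundary1 f = 0 by have /asboolP := cycles1_funP z.
have [l [cl bl]] := cycle_cobs f.
have l0 : boundary1 (\sum_(D <- l) indc D) = 0.
  by have [] := bl; rewrite boundary1B f0 sub0r => /eqP;
    rewrite oppr_eq0 => /eqP.
have [K [oK sK cK uK room]] := small_leaving hp haf cl.
have bal := balanced hp oK sK cK cl l0.
have [|V [k [cV sk bV sV rV]]] := pack hp oK sK cK uK cl room.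
  by move=> x; rewrite -bal.
have csV := src_clopen (cob_copen cV); have crV := rng_clopen (cob_copen cV).
have [x|W [cW WK sW rW]] :=
  transport hp oK sK cK uK (clopen_setC csV) (clopen_setC crV).
  have := kcountC K (src V) x; have := kcountC K (rng V) x.
  by rewrite sV rV bal; lia.
have cU : compact_open_Gset (V `|` W) by apply: cobU; rewrite // ?sW ?rW setICr.
have [||a ta] := full_of_cob cU.
- by have -> : src (V `|` W) = src V `|` src W by [exact: image_setU];
    rewrite sW setUv.
- by have -> : rng (V `|` W) = rng V `|` rng W by [exact: image_setU];
    rewrite rW setUv.
have aU := theta_graph hp ta.
have VW : V `&` W = set0.
  rewrite -subset0 => g [Vg Wg]; have : (~` src V) (gsrc g) by rewrite -sW;
    exists g.
  by apply; exists g.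
have iU : indc (graph a) = indc V + indc W.
  by rewrite -aU; apply: indcU => //; exact: cob_copen.
have b2 := boundsD bl bV.
have E : f - indc (graph a) = (f - \sum_(D <- l) indc D +
    (\sum_(D <- l) indc D - indc V - k)) + (k - indc W).
  rewrite iU; move: (\sum_(_ <- _) _) (indc V) (indc W) => s v w.
  by apply: Cc_ext => g; rewrite !(CcD, CcB, CcN);
    move: (f g) (s g) (v g) (w g) (k g); lia.
have kW0 : boundary1 (k - indc W) = 0.
  have : boundary1 (f - indc (graph a)) = 0.
    by rewrite boundary1B f0 boundary1_graph // subrr.
  by rewrite E boundary1D b2.1 add0r.
have skW : supported K (k - indc W).
  by apply: supportedB => //; apply: supported_indc => //; exact: cob_copen.
have [h hE] := K_cycle_bounds hp oK sK cK uK skW kW0.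
have [_ [h' hE']] := boundsD b2 (conj kW0 (ex_intro _ h hE)).
exists a; rewrite -zc; apply/esym/homology1_class_eq; exists h'.
by rewrite -hE' -E.
Qed.

End IndexSurjective.

(** * The exact sequence *)

Lemma zmod_additive (A B : zmodType) (f : A -> B) :
  (forall s t, f (s - t) = f s - f t) ->
  exists g : {additive A -> B}, g = f :> (A -> B).
Proof.
move=> fB; pose m := GRing.isZmodMorphism.Build A B f fB.
pose g : {additive A -> B} := HB.pack f m.
by exists g.
Qed.

Theorem theorem3p6 (R : realType) (G : cantor_groupoid R)
    (hprincipal : principal G) (hminimal : minimal G)
    (haf : almost_finite G) :
  (exists (j : {additive tensor (homology0 G) 'Z_2 ->
                  abelianization (full_group G)})
          (I : {additive abelianization (full_group G) -> homology1 G}),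
     [/\ is_j_map j, is_index_map I, exact_at j I & surjective I]) /\
  (two_divisible (homology0 G) ->
     zmod_isomorphic (abelianization (full_group G)) (homology1 G)).
Proof.
have [j0 [jP jB jtau jdiv]] := j_exists hprincipal hminimal.
have [j jE] := zmod_additive jB.
have [I0 [IP IB]] := index_exists hprincipal.
have [I IE] := zmod_additive IB.
have tau_in_j u : tau_class u -> exists t, j t = u.
  move=> [s [sa ->]]; elim: s sa => [|U s IH] sa.
    by exists 0; rewrite big_nil raddf0.
  have [t tE] := IH (fun i => sa i.+1); have aU : adm U := sa 0%N.
  have [cU dU] := aU; have csU := adm_src_clopen aU.
  pose f : Cc (units G) := indc (src U).
  have fE : f = ind (src U) :> (units G -> int).
    by apply: indcE; [exact: units_hausdorff|exact: clopen_copen].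
  (* A single bisection is a valid choice for the indicator of its own source, so [j] takes the
     class of [tau U] as a value. *)
  have jc : j_choice f (fun _ : 'I_1 => U) (fun _ => tau U).
    split=> // [i k _ _ _||_]; [by rewrite !ord1| |exact: tauP].
    have -> : [set x | ~~ (2 %| f x)%Z] = src U by rewrite fE;
      exact: odd_set_ind.
    by apply/seteqP; split=> [x [] //|x Ux]; exists ord0.
  have [_ /(_ _ _ _ jc)] := jP f; rewrite big_ord1 => jU.
  by exists (tensor_pure (homology0_class f) 1 + t);
    rewrite raddfD /= tE jE jU big_cons.
have kerI u : I u = 0 -> tau_class u.
  rewrite IE -(ab_reprK u) IP => /homology1_class0[h hE].
  apply: (index_kernel hprincipal haf (h := h)); rewrite -hE /=.
  by rewrite indcE //; [exact: arrows_hausdorff|exact/cob_copen/graph_cob].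
have tauI u : tau_class u -> I u = 0.
  move=> [s [sa ->]]; elim: s sa => [|U s IH] sa;
    first by rewrite big_nil raddf0.
  rewrite big_cons raddfD /= IH ?addr0; last by move=> i; exact: (sa i.+1).
  by rewrite IE IP idx_tau //; exact: (sa 0%N).
have Isurj : surjective I.
  move=> c; have [a <-] := idx_surjective hprincipal haf c.
  by exists (ab_class a); rewrite IE IP.
split.
  exists j, I; split=> //; first by rewrite jE.
  - move=> a U cU tU; exists (graph_cycle hprincipal a); split;
      last by rewrite IE IP.
    move=> g /=; rewrite -(theta_graph hprincipal tU) indcE //.
      exact: arrows_hausdorff.
    exact: cob_copen.
  - by move=> u; split=> [/kerI/tau_in_j//|[t <-]]; apply: tauI; rewrite jE.
move=> h2; exists I.
(* The kernel of [I] is the image of [j], which is zero in the 2-divisible case. *)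
have Iinj : injective I.
  move=> u v /eqP; rewrite -subr_eq0 -raddfB => /eqP /kerI/tau_in_j[t].
  by rewrite jE jdiv // => /esym/eqP; rewrite subr_eq0 => /eqP.
have [g gP] := choice Isurj.
exists g => // u; exact: Iinj (gP (I u)).
Qed.
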